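(* Let $\mathfrak g$ be a complex simple Lie algebra with Borel subalgebra $\mathfrak b=\mathfrak t\oplus\mathfrak u^+$. Then the cascade element $x_{\mathcal K}$ is an Ooms element for the Frobenius Lie algebra $\mathfrak b_{\mathcal K}=\mathfrak t_{\mathcal K}\oplus\mathfrak u^+$.
   Context: Let $\mathfrak t$ be a Cartan subalgebra of $\mathfrak g$ contained in $\mathfrak b$, $\mathfrak u^+=[\mathfrak b,\mathfrak b]$, $\Delta$ the root system of $(\mathfrak g,\mathfrak t)$, $\Delta^+$ the positive roots corresponding to $\mathfrak u^+$, $\theta$ the highest root. Let $(\ ,\ )$ be the positive-definite form on the $\mathbb Q$-span of $\Delta$ induced by the Killing form; it is used to identify $\mathfrak t$ and $\mathfrak t^*$. For $\gamma\in\Delta$ put $\gamma^\vee=2\gamma/(\gamma,\gamma)$. Kostant cascade $\mathcal K=\{\beta_1,\dots,\beta_m\}\subset\Delta^+$: it is defined recursively. Its first element is $\beta_1=\theta$. The root system $\Delta_\theta=\{\gamma\in\Delta\mid(\gamma,\theta)=0\}$ is decomposed into irreducible components, each with the set of positive roots inherited from $\Delta^+$; the highest roots of these components are added to $\mathcal K$, and the procedure is repeated for each component until it terminates. The roots in $\mathcal K$ are pairwise strongly orthogonal. The cascade element is $x_{\mathcal K}=\frac12\sum_{i=1}^m\beta_i^\vee\in\mathfrak t$, i.e., the unique element of the $\mathbb Q$-span of $\mathcal K$ with $\beta_i(x_{\mathcal K})=1$ for all $i$. Let $\mathfrak t_{\mathcal K}\subset\mathfrak t$ be the $\mathbb C$-linear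 span of $\mathcal K$ (equivalently $\bigoplus_{i=1}^m[\mathfrak g_{\beta_i},\mathfrak g_{-\beta_i}]$) and $\mathfrak b_{\mathcal K}=\mathfrak t_{\mathcal K}\oplus\mathfrak u^+$, an ideal of $\mathfrak b$. It is a known fact that $\mathfrak b_{\mathcal K}$ is Frobenius. For a Lie algebra $\mathfrak q$ and $\xi\in\mathfrak q^*$, the Kirillov form is $\mathcal B_\xi(x,y)=\langle\xi,[x,y]\rangle=-\langle\mathrm{ad}^*(x)\xi,y\rangle$. The algebra $\mathfrak q$ is Frobenius if $\mathcal B_\xi$ is non-degenerate for some $\xi\in\mathfrak q^*$. For such $\xi$, the Ooms element associated with $\xi$ is the unique $x_\xi\in\mathfrak q$ with $(\mathrm{ad}^*x_\xi)\cdot\xi=-\xi$, i.e. $\mathcal B_\xi(x_\xi,y)=\langle\xi,y\rangle$ for all $y\in\mathfrak q$. An Ooms element of $\mathfrak q$ is an element $x_\xi$ for some $\xi$ with $\mathcal B_\xi$ non-degenerate. *)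

(* Defs.v *)
From HB Require Import structures.
From mathcomp Require Import all_boot all_order all_algebra.
From mathcomp Require Import boolp classical_sets reals.
From mathcomp Require Import complex.

Set Implicit Arguments.
Unset Strict Implicit.
Unset Printing Implicit Defensive.

Import GRing.Theory.

Local Open Scope classical_set_scope.
Local Open Scope ring_scope.

(** ** Finite-dimensional Lie algebras

A Lie algebra is a finite-dimensional vector space [L] together with a map
[br : L -> L -> L] satisfying [lie_bracket br]. *)

Definition lie_bracket (F : fieldType) (L : vectType F) (br : L -> L -> L) :
    Prop :=
  [/\ forall x, linear (br x),
      forall y, linear (br^~ y),
      forall x, br x x = 0
    & forall x y z, br x (br y z) + br y (br z x) + br z (br x y) = 0].

Definition ad (F : fieldType) (L : vectType F) (br : L -> L -> L) (x : L) :
    'End(L) := linfun (br x).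

Definition lfun_trace (F : fieldType) (L : vectType F) (f : 'End(L)) : F :=
  \tr (passmx.mxof (vbasis {:L}) (vbasis {:L}) f).

Definition killing (F : fieldType) (L : vectType F) (br : L -> L -> L)
    (x y : L) : F :=
  lfun_trace (ad br x \o ad br y)%VF.

(* the linear span [U, V] of all brackets; by bilinearity, brackets of basis
   vectors suffice *)
Definition brv (F : fieldType) (L : vectType F) (br : L -> L -> L)
    (U V : {vspace L}) : {vspace L} :=
  <<[seq br u v | u <- vbasis U, v <- vbasis V]>>%VS.

Definition subalgebra (F : fieldType) (L : vectType F) (br : L -> L -> L)
    (U : {vspace L}) : Prop := (brv br U U <= U)%VS.

Definition ideal (F : fieldType) (L : vectType F) (br : L -> L -> L)
    (U : {vspace L}) : Prop := (brv br fullv U <= U)%VS.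

(* The induced bracket on the vector space underlying [U]; [vsproj U] restricts
   to the identity on [U], so this is the restriction of [br] as soon as [U] is
   a subalgebra. *)
Definition sub_br (F : fieldType) (L : vectType F) (br : L -> L -> L)
    (U : {vspace L}) (x y : subvs_of U) : subvs_of U :=
  vsproj U (br (vsval x) (vsval y)).

Definition simple_lie (F : fieldType) (L : vectType F) (br : L -> L -> L) :
    Prop :=
  brv br fullv fullv <> 0%VS /\
  forall U : {vspace L}, ideal br U -> U = 0%VS \/ U = fullv.

Definition solvable_lie (F : fieldType) (L : vectType F) (br : L -> L -> L)
    (U : {vspace L}) : Prop :=
  exists n, iter n (fun V => brv br V V) U = 0%VS.

Definition nilpotent_lie (F : fieldType) (L : vectType F) (br : L -> L -> L)
    (U : {vspace L}) : Prop :=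
  exists n, iter n (fun V => brv br U V) U = 0%VS.

(* nilpotent and self-normalizing subalgebra *)
Definition cartan (F : fieldType) (L : vectType F) (br : L -> L -> L)
    (t : {vspace L}) : Prop :=
  [/\ subalgebra br t,
      nilpotent_lie br t
    & forall x, (forall h, h \in t -> br x h \in t) -> x \in t].

(* maximal solvable subalgebra *)
Definition borel (F : fieldType) (L : vectType F) (br : L -> L -> L)
    (b : {vspace L}) : Prop :=
  [/\ subalgebra br b,
      solvable_lie br b
    & forall c : {vspace L}, subalgebra br c -> solvable_lie br c ->
        (b <= c)%VS -> c = b].

(** ** Roots and the form on the dual of a Cartan subalgebra *)

Definition dual (F : fieldType) (V : vectType F) := 'Hom(V, F^o).

Definition root_space (F : fieldType) (L : vectType F) (br : L -> L -> L)
    (t : {vspace L}) (gamma : dual (subvs_of t)) : set L :=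
  [set x | forall h : subvs_of t, br (vsval h) x = (gamma h : F) *: x].

Definition roots (F : fieldType) (L : vectType F) (br : L -> L -> L)
    (t : {vspace L}) : set (dual (subvs_of t)) :=
  [set gamma | gamma <> 0 /\ exists2 x, x <> 0 & root_space br gamma x].

(* the roots whose root space lies in [b, b], for b a Borel subalgebra *)
Definition pos_roots (F : fieldType) (L : vectType F) (br : L -> L -> L)
    (b t : {vspace L}) : set (dual (subvs_of t)) :=
  [set gamma | roots br gamma /\
     forall x, root_space br gamma x -> x \in brv br b b].

(* h |-> killing h _ *)
Definition killing_map (F : fieldType) (L : vectType F) (br : L -> L -> L)
    (t : {vspace L}) : 'Hom(subvs_of t, dual (subvs_of t)) :=
  linfun (fun h : subvs_of t =>
    linfun (fun h' : subvs_of t => killing br (vsval h) (vsval h') : F^o)).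

(* The identification of the dual of t with t. The linear map [f^-1%VF] is a
   two-sided inverse of [f] when [f] is bijective, that is, here, when the
   Killing form is nondegenerate on t. *)
Definition dual_to_cartan (F : fieldType) (L : vectType F) (br : L -> L -> L)
    (t : {vspace L}) : 'Hom(dual (subvs_of t), subvs_of t) :=
  ((killing_map br t)^-1)%VF.

Definition root_form (F : fieldType) (L : vectType F) (br : L -> L -> L)
    (t : {vspace L}) (gamma delta : dual (subvs_of t)) : F :=
  killing br (vsval (dual_to_cartan br t gamma))
             (vsval (dual_to_cartan br t delta)).

Definition coroot (F : fieldType) (L : vectType F) (br : L -> L -> L)
    (t : {vspace L}) (gamma : dual (subvs_of t)) : subvs_of t :=
  (2 / root_form br gamma gamma) *: dual_to_cartan br t gamma.

(** ** The Kostant cascade *)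

Definition irreducible_roots (F : fieldType) (L : vectType F)
    (br : L -> L -> L) (t : {vspace L}) (Phi : set (dual (subvs_of t))) :
    Prop :=
  Phi !=set0 /\
  forall A : set (dual (subvs_of t)), A `<=` Phi ->
    (forall gamma delta, A gamma -> (Phi `\` A) delta ->
       root_form br gamma delta = 0) ->
    A = set0 \/ A = Phi.

Definition irreducible_component (F : fieldType) (L : vectType F)
    (br : L -> L -> L) (t : {vspace L})
    (Phi Psi : set (dual (subvs_of t))) : Prop :=
  [/\ Psi `<=` Phi,
      irreducible_roots br Psi
    & forall gamma delta, Psi gamma -> (Phi `\` Psi) delta ->
        root_form br gamma delta = 0].

(* [theta] is the largest element of [Phi] for the root order defined by the
   positive roots of [Phi]: each difference [theta - gamma] is a sum, possibly
   empty and with repetitions, of positive roots of [Phi]. *)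
Definition highest_root (F : fieldType) (L : vectType F) (br : L -> L -> L)
    (b t : {vspace L}) (Phi : set (dual (subvs_of t)))
    (theta : dual (subvs_of t)) : Prop :=
  (Phi `&` @pos_roots F L br b t) theta /\
  forall gamma, Phi gamma ->
    exists s : seq (dual (subvs_of t)),
      (forall delta, delta \in s -> (Phi `&` @pos_roots F L br b t) delta) /\
      theta - gamma = \sum_(delta <- s) delta.

(* the irreducible root systems met in the recursive construction, starting
   from the whole root system *)
Inductive cascade_component (F : fieldType) (L : vectType F)
    (br : L -> L -> L) (b t : {vspace L}) :
    set (dual (subvs_of t)) -> Prop :=
| cascade_start : cascade_component br b (@roots F L br t)
| cascade_next (Phi Psi : set (dual (subvs_of t)))
    (theta : dual (subvs_of t)) :
    cascade_component br b Phi ->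
    highest_root br b Phi theta ->
    irreducible_component br
      (Phi `&` [set gamma | root_form br gamma theta = 0]) Psi ->
    cascade_component br b Psi.

Definition kostant_cascade (F : fieldType) (L : vectType F)
    (br : L -> L -> L) (b t : {vspace L}) : set (dual (subvs_of t)) :=
  [set beta | exists2 Phi, cascade_component br b Phi
                         & highest_root br b Phi beta].

(* In the next three definitions, [K] enumerates the cascade without
   repetition. *)
Definition cascade_element (F : fieldType) (L : vectType F)
    (br : L -> L -> L) (t : {vspace L}) (K : seq (dual (subvs_of t))) :
    subvs_of t :=
  2^-1 *: \sum_(beta <- K) coroot br beta.

Definition cascade_torus (F : fieldType) (L : vectType F)
    (br : L -> L -> L) (t : {vspace L}) (K : seq (dual (subvs_of t))) :
    {vspace L} :=
  <<[seq vsval (dual_to_cartan br t beta) | beta <- K]>>%VS.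

Definition cascade_algebra (F : fieldType) (L : vectType F)
    (br : L -> L -> L) (b t : {vspace L}) (K : seq (dual (subvs_of t))) :
    {vspace L} :=
  (cascade_torus br K + brv br b b)%VS.

(** ** Frobenius Lie algebras and Ooms elements *)

Definition kirillov (F : fieldType) (q : vectType F) (br : q -> q -> q)
    (xi : dual q) (x y : q) : F := xi (br x y).

(* the Kirillov form is alternating, so its left radical is its radical *)
Definition kirillov_nondegenerate (F : fieldType) (q : vectType F)
    (br : q -> q -> q) (xi : dual q) : Prop :=
  forall x, (forall y, kirillov br xi x y = 0) -> x = 0.

Definition frobenius_lie (F : fieldType) (q : vectType F)
    (br : q -> q -> q) : Prop :=
  exists xi : dual q, kirillov_nondegenerate br xi.

Definition ooms_element (F : fieldType) (q : vectType F)
    (br : q -> q -> q) (x : q) : Prop :=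
  exists xi : dual q, kirillov_nondegenerate br xi /\
    forall y, kirillov br xi x y = xi y.

(* Main.v *)
Require Import Defs.
From HB Require Import structures.
From mathcomp Require Import all_boot all_order all_algebra.
From mathcomp Require Import boolp classical_sets reals.
From mathcomp Require Import complex.
From mathcomp Require Import ring.

(** Every root space is a line, so fix root vectors and put
[f = \sum_(beta in K) e_(-beta)], [xi = kappa(f, _)], where [kappa] is the Killing form.
The cascade is orthogonal, hence [beta(x_K) = 1] for each [beta] in [K], so
[[x_K, f] = -f] and invariance of [kappa] gives [xi [x_K, y] = xi y]
([br_element_lowering]). What has to be proved is that [xi] has a nondegenerate
Kirillov form on [b_K] ([lowering_nondegenerate]).

Every positive root [a] lies in the hook of some [beta] in [K]: it belongs to the
irreducible system whose highest root is [beta], and is not orthogonal to [beta]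
([hook_exists]). For [a <> beta], the root [beta - a] lies in the same hook
([hook_complement]), and a sum of two positive roots can be in [K] only if it is the
head of the hooks of both summands ([hook_sum_left]). So, for the Kirillov form, the line
[g_a] meets only [g_(beta - a)] when [a] is not in [K], while each [g_beta] is paired with
the torus. Evaluating on these vectors kills the components of an element of the radical
one at a time. The comparison of hooks rests on the tree structure of the irreducible
systems of the cascade: any two are equal, nested below a highest root, or orthogonal
([component_tree]).

The structure theory behind this is developed from the definitions. A Cartan subalgebra is
nilpotent and self-normalizing, and its generalized weight spaces decompose [g]
([weight_span]), the zero weight space being [t] ([weight_space0]). If [x] and [y] have
opposite weights [l] and [-l], the trace of [[x, y]] on an [l]-string of weight spaces
vanishes, so all weights are real multiples of [l] at [[x, y]] ([string_real]); this gives
Cartan's criterion ([killing_neq0]) and, with a second trace computation, that root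
spaces are lines on which [t] acts by scalars ([dim_weight_opp], [weight_eigen]). The
usual [sl_2] computation yields root strings. A Borel subalgebra containing [t] is spanned
by [t] and the root spaces of a positive system ([borel_positive]): if neither [a] nor [-a]
were one of its roots, one of the two could be adjoined ([half_closed_extend]) without
losing solvability ([cone_algebra_solvable]). Highest roots exist by the classical argument
with simple roots ([highest_exists]), applied to each irreducible system of the cascade. *)

Set Implicit Arguments.
Unset Strict Implicit.
Unset Printing Implicit Defensive.

Import Order.TTheory GRing.Theory Num.Theory.

Local Open Scope ring_scope.

(** * Linear algebra: traces on subspaces and generalized eigenvectors *)

Lemma linfunE (F : fieldType) (U V : vectType F) (f : U -> V) :
  linear f -> linfun f =1 f.
Proof.
move=> lf x; pose fl : {linear U -> V} := HB.pack f (GRing.isLinear.Build F U V _ f lf).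
exact: (lfunE fl).
Qed.

Section SubspaceOfPredicate.
Variables (F : fieldType) (V : vectType F).

(** A subspace contained in [P] and of maximal dimension exhausts [P]. *)
Lemma vspace_of_pred (P : V -> Prop) :
    P 0 -> (forall a x y, P x -> P y -> P (a *: x + y)) ->
  exists U : {vspace V}, forall x, x \in U <-> P x.
Proof.
move=> P0 PL.
have key n : forall U : {vspace V}, (forall x, x \in U -> P x) ->
    (\dim {:V} - \dim U <= n)%N ->
    exists U' : {vspace V}, forall x, x \in U' <-> P x.
  elim: n => [|n IHn] U UP dimU; have [PU|] := pselect (forall x, P x -> x \in U).
  - by exists U => x; split; [apply: UP | apply: PU].
  - case=> x _; suff -> : U = fullv by apply: memvf.
    apply/eqP; rewrite -(geq_leqif (dimv_leqif_eq (subvf U))).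
    by rewrite -subn_eq0 -leqn0.
  - by exists U => x; split; [apply: UP | apply: PU].
  move=> nPU; have [x Px xU] : exists2 x, P x & x \notin U.
    apply: contrapT => nex; apply: nPU => x Px; apply: contrapT => /negP xU.
    by apply: nex; exists x.
  apply: (IHn (U + <[x]>)%VS).
    move=> y /memv_addP[u uU [v /vlineP[a ->] ->]].
    by rewrite addrC; apply: PL => //; apply: UP.
  rewrite dimv_disjoint_sum.
    rewrite dim_vline; have -> : x != 0 by apply: contraNneq xU => ->; rewrite mem0v.
    by rewrite addn1 subnS; case: (_ - _)%N dimU => [|m] //=.
  apply/eqP; rewrite -subv0; apply/subvP => y.
  rewrite memv_cap memv0 => /andP[yU /vlineP[a ya]]; rewrite ya.
  have [->|a0] := eqVneq a 0; first by rewrite scale0r.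
  case/negP: xU; have -> : x = a^-1 *: y by rewrite ya scalerA mulVf ?scale1r.
  exact: memvZ.
apply: (key (\dim {:V} - \dim (0%VS : {vspace V}))%N 0%VS) => // x.
by rewrite memv0 => /eqP->.
Qed.

End SubspaceOfPredicate.

Section Trace.
Variables (F : fieldType) (V : vectType F).
Implicit Types (f g : 'End(V)) (U W : {vspace V}).

Lemma lfun_traceE f :
  lfun_trace f = \sum_i coord (vbasis {:V}) i (f (vbasis {:V})`_i).
Proof.
by apply: eq_bigr => i _; rewrite !mxE /= !passmx.vecof_delta.
Qed.

Lemma lfun_traceC f g : lfun_trace (f \o g)%VF = lfun_trace (g \o f)%VF.
Proof.
have vb := vbasisP {:V}; by rewrite /lfun_trace !(passmx.mxof_comp _ _ vb) mxtrace_mulC.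
Qed.

Lemma lfun_traceD f g : lfun_trace (f + g) = lfun_trace f + lfun_trace g.
Proof.
by rewrite !lfun_traceE -big_split; apply: eq_bigr => i _; rewrite add_lfunE linearD.
Qed.

Lemma lfun_traceZ a f : lfun_trace (a *: f) = a * lfun_trace f.
Proof.
by rewrite !lfun_traceE mulr_sumr; apply: eq_bigr => i _; rewrite scale_lfunE linearZ.
Qed.

Lemma lfun_trace_rank1 f (phi : {scalar V}) v :
  (forall x, f x = phi x *: v) -> lfun_trace f = phi v.
Proof.
move=> fE; rewrite lfun_traceE.
rewrite [in RHS](coord_vbasis (memvf v)) linear_sum /=.
by apply: eq_bigr => i _; rewrite fE !linearZ /= mulrC.
Qed.

(** The trace of the restriction of [f] to [U] when [f] preserves [U]. *)
Definition sub_trace U f : F := lfun_trace (f \o projv U)%VF.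

Lemma sub_tracef f : sub_trace fullv f = lfun_trace f.
Proof.
by congr lfun_trace; apply/lfunP => x; rewrite comp_lfunE projv_id ?memvf.
Qed.

Lemma eq_sub_trace U f g :
  (forall x, x \in U -> f x = g x) -> sub_trace U f = sub_trace U g.
Proof.
by move=> fg; congr lfun_trace; apply/lfunP => x; rewrite !comp_lfunE fg ?memv_proj.
Qed.

Lemma sub_traceD U f g : sub_trace U (f + g) = sub_trace U f + sub_trace U g.
Proof. by rewrite /sub_trace comp_lfunDl lfun_traceD. Qed.

Lemma sub_traceZ U a f : sub_trace U (a *: f) = a * sub_trace U f.
Proof. by rewrite /sub_trace -comp_lfunZl lfun_traceZ. Qed.

(** [f] factors through the projection onto [W], and the trace is cyclic. *)
Lemma sub_traceS U W f : (W <= U)%VS -> (forall x, x \in U -> f x \in W) ->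
  sub_trace U f = sub_trace W f.
Proof.
move=> sWU fUW.
have -> : sub_trace U f = lfun_trace (projv W \o (f \o projv U))%VF.
  congr lfun_trace; apply/lfunP => x; rewrite !comp_lfunE.
  by rewrite [RHS]projv_id ?fUW ?memv_proj.
rewrite lfun_traceC; congr lfun_trace; apply/lfunP => x; rewrite !comp_lfunE.
by rewrite [projv U _]projv_id // (subvP sWU) ?memv_proj.
Qed.

Lemma sub_traceC U f g : (forall x, x \in U -> f x \in U) ->
  (forall x, x \in U -> g x \in U) ->
  sub_trace U (f \o g)%VF = sub_trace U (g \o f)%VF.
Proof.
have aux f' g' : (forall x, x \in U -> g' x \in U) ->
    (sub_trace U (f' \o g') = lfun_trace ((f' \o projv U) \o (g' \o projv U)))%VF.
  move=> gU; congr lfun_trace; apply/lfunP => x; rewrite !comp_lfunE.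
  by rewrite [projv U (g' _)]projv_id ?gU ?memv_proj.
by move=> fU gU; rewrite !aux // lfun_traceC.
Qed.

(** Cyclicity of the trace makes [sub_trace] independent of the projection onto [U] that is
used, so one may project along the other summand. *)
Lemma sub_trace_add U W f : (U :&: W = 0)%VS ->
  (forall x, x \in U -> f x \in U) -> (forall x, x \in W -> f x \in W) ->
  sub_trace (U + W) f = sub_trace U f + sub_trace W f.
Proof.
move=> dUW fU fW; have dWU : (W :&: U = 0)%VS by rewrite capvC.
have aux A B : (A :&: B = 0)%VS -> (forall x, x \in A -> f x \in A) ->
    (sub_trace A f = lfun_trace (f \o (daddv_pi A B \o projv (A + B))))%VF.
  move=> dAB fA; rewrite comp_lfunA.
  have -> : ((f \o daddv_pi A B) \o projv (A + B) =
             projv A \o ((f \o daddv_pi A B) \o projv (A + B)))%VF.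
    apply/lfunP => x; rewrite !comp_lfunE.
    by rewrite [RHS]projv_id // fA // memv_pi.
  rewrite [RHS]lfun_traceC /sub_trace; congr (lfun_trace _); apply/lfunP => x; rewrite !comp_lfunE.
  rewrite [projv (A + B) _]projv_id ?(subvP (addvSl _ _)) ?memv_proj //.
  by rewrite (daddv_pi_id dAB) ?memv_proj.
rewrite (aux U W) // (aux W U) // -lfun_traceD; congr lfun_trace.
apply/lfunP => x; rewrite add_lfunE !comp_lfunE -linearD [in projv (W + U)]addvC.
by rewrite daddv_pi_add ?memv_proj.
Qed.

(** Induction on the dimension, splitting off a line; on a line the projection has rank one. *)
Lemma sub_trace1 U : sub_trace U \1%VF = (\dim U)%:R.
Proof.
have id_st W : forall x, x \in W -> \1%VF x \in W by move=> x; rewrite id_lfunE.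
have [n] := ubnP (\dim U); elim: n U => // n IHn U dimU.
have [->|U0] := eqVneq U 0%VS.
  rewrite dimv0 /sub_trace (@lfun_trace_rank1 _ (\0 : {scalar V}) 0) // => x.
  rewrite comp_lfunE id_lfunE /= scale0r; apply/eqP.
  by rewrite -memv0 memv_proj.
pose v := vpick U; have v0 : v != 0 by rewrite vpick0.
have vU : (<[v]> <= U)%VS by rewrite -memvE memv_pick.
pose W := (U :\: <[v]>)%VS.
have UE : U = (<[v]> + W)%VS.
  by rewrite addvC /W addv_diff (addv_idPl vU).
have dvW : (<[v]> :&: W = 0)%VS by rewrite capvC capv_diff.
have dimE : (\dim U = 1 + \dim W)%N by rewrite UE dimv_disjoint_sum // dim_vline v0.
rewrite dimE natrD {1}UE (sub_trace_add dvW (id_st _) (id_st _)); congr (_ + _); last first.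
  by apply: IHn; rewrite dimE in dimU.
pose phi : {scalar V} := coord [tuple v] ord0 \o projv <[v]>.
have fr : free [tuple v] by rewrite seq1_free.
rewrite /sub_trace (@lfun_trace_rank1 _ phi v).
  rewrite /phi /= projv_id ?memv_line //.
  by have := coord_free ord0 ord0 fr; rewrite /= => ->.
move=> x; rewrite comp_lfunE id_lfunE /phi /=.
have := memv_proj <[v]> x; set y := projv _ x => yv.
have yv' : y \in <<[tuple v]>>%VS by rewrite span_seq1.
by rewrite {1}(coord_span yv') big_ord_recl big_ord0 addr0.
Qed.

Lemma lfun_img_proper U f : U != 0%VS -> (forall x, x \in U -> f x \in U) ->
  (exists2 x, x \in U & x != 0 /\ f x = 0) -> (\dim (f @: U) < \dim U)%N.
Proof.
move=> U0 fU [x xU [x0 fx]].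
rewrite -(limg_ker_dim f U) -[X in (X < _)%N]add0n ltn_add2r lt0n dimv_eq0.
apply: contra_neq x0 => kerU.
by apply/eqP; rewrite -memv0 -kerU memv_cap xU memv_ker fx eqxx.
Qed.

Lemma iter_lfun0 f k : iter k f 0 = 0.
Proof. by elim: k => //= k ->; rewrite linear0. Qed.

(** A nilpotent map sends [U] into a proper subspace, on which it has the same trace. *)
Lemma sub_trace_nilp U f : (forall x, x \in U -> f x \in U) ->
  (forall x, x \in U -> exists k, iter k f x = 0) -> sub_trace U f = 0.
Proof.
have [n] := ubnP (\dim U); elim: n U => // n IHn U dimU fU nilf.
have [U0|U0] := eqVneq U 0%VS.
  rewrite (eq_sub_trace (g := 0)); last first.
    by move=> x; rewrite U0 memv0 => /eqP->; rewrite linear0 zero_lfunE.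
  by rewrite -(scale0r 0) sub_traceZ mul0r.
have [x xU [x0 fx]] : exists2 x, x \in U & x != 0 /\ f x = 0.
  have v0 : vpick U != 0 by rewrite vpick0.
  have vU := memv_pick U.
  have [k fk] := nilf _ vU.
  elim: k (vpick U) v0 vU fk => [|k IHk] y y0 yU; first by move=> /= /eqP; rewrite (negPf y0).
  rewrite iterSr => fk; have [fy|fy] := eqVneq (f y) 0; first by exists y.
  exact: (IHk _ fy (fU _ yU)).
have dW : (\dim (f @: U) < \dim U)%N by apply: lfun_img_proper => //; exists x.
have fUU : (f @: U <= U)%VS by apply/subvP => _ /memv_imgP[y yU ->]; apply: fU.
rewrite (sub_traceS fUU) => [|y yU]; last exact: memv_img.
apply: IHn; first exact: leq_trans dW _.
  by move=> y yU; apply/memv_img/(subvP fUU).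
by move=> y /(subvP fUU); apply: nilf.
Qed.

End Trace.

Section Predicates.
Variables (F : fieldType) (V : vectType F).

Definition lin_closed (P : V -> Prop) :=
  P 0 /\ forall a x y, P x -> P y -> P (a *: x + y).

(** Subspaces are often described by a property; this is the subspace of the vectors that
satisfy it, meaningful when [lin_closed P] holds. *)
Definition vspace_of (P : V -> Prop) : {vspace V} :=
  xget 0%VS [set U : {vspace V} | forall x, x \in U <-> P x]%classic.

Lemma mem_vspace_of (P : V -> Prop) x : lin_closed P -> x \in vspace_of P <-> P x.
Proof.
case=> P0 PL; have [U UP] := vspace_of_pred P0 PL.
by have := @xgetPex _ 0%VS [set U : {vspace V} | forall x, x \in U <-> P x]%classic
  (ex_intro _ U UP); apply.
Qed.

Lemma lin_closed_sum (P : V -> Prop) (I : Type) (s : seq I) (Q : pred I) (f : I -> V) :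
  lin_closed P -> (forall i, Q i -> P (f i)) -> P (\sum_(i <- s | Q i) f i).
Proof.
case=> P0 PL fP; elim/big_ind: _ => //.
by move=> x y Px Py; rewrite -[x]scale1r; apply: PL.
Qed.

Lemma vspace_lin_closed (U : {vspace V}) : lin_closed (fun x => x \in U).
Proof. by split=> [|a x y xU yU]; rewrite ?mem0v // rpredD // memvZ. Qed.

End Predicates.

Section GeneralizedEigenvectors.
Variables (F : numClosedFieldType) (V : vectType F).
Implicit Types (f : 'End(V)) (U : {vspace V}) (c d : F).

Definition shift f c : 'End(V) := f - c *: \1%VF.

Lemma shiftE f c x : shift f c x = f x - c *: x.
Proof. by rewrite /shift add_lfunE opp_lfunE scale_lfunE id_lfunE. Qed.

Lemma iter_lfunP f k a x y : iter k f (a *: x + y) = a *: iter k f x + iter k f y.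
Proof. by elim: k => //= k ->; rewrite linearP. Qed.

Lemma iter_lfun_leq f k m x : (k <= m)%N -> iter k f x = 0 -> iter m f x = 0.
Proof. by move=> km fx; rewrite -(subnK km) iterD fx iter_lfun0. Qed.

Lemma iter_stable f U k x : (forall y, y \in U -> f y \in U) -> x \in U ->
  iter k f x \in U.
Proof. by move=> fU xU; elim: k => //= k; apply: fU. Qed.

Definition geneig f c x := exists k, iter k (shift f c) x = 0.

Lemma geneig_lin_closed f c : lin_closed (geneig f c).
Proof.
split=> [|a x y [k fx] [m fy]]; first by exists 0.
exists (maxn k m); rewrite iter_lfunP.
by rewrite (iter_lfun_leq (leq_maxl k m) fx) (iter_lfun_leq (leq_maxr k m) fy) scaler0 addr0.
Qed.

Lemma shift_comm f c d x : shift f c (shift f d x) = shift f d (shift f c x).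
Proof.
rewrite !shiftE !linearB !linearZ /= !opprK !scalerA [d * c]mulrC -!addrA.
by congr (_ + _); rewrite addrCA.
Qed.

Lemma iter_shift_comm f c d k x :
  iter k (shift f c) (shift f d x) = shift f d (iter k (shift f c) x).
Proof. by elim: k => //= k ->; rewrite shift_comm. Qed.

Lemma geneig_disjoint f c d x : c != d -> geneig f c x -> geneig f d x -> x = 0.
Proof.
move=> cd [p]; elim: p x => [|p IHp] x //; rewrite iterSr => fx [q fdx].
have y0 : shift f c x = 0.
  by apply: IHp => //; exists q; rewrite iter_shift_comm fdx linear0.
have dx k : iter k (shift f d) x = (c - d) ^+ k *: x.
  elim: k => [|k /= ->]; first by rewrite scale1r.
  have fxc : f x = c *: x by apply/eqP; rewrite -subr_eq0 -shiftE y0.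
  by rewrite linearZ /= shiftE fxc -scalerBl scalerA exprSr.
move/eqP: fdx; rewrite dx scaler_eq0 expf_eq0 subr_eq0 (negPf cd) andbF.
by move/eqP.
Qed.

(** On a generalized eigenvector for [d], write [(d - c) y = (f - c) y - (f - d) y]; the last
term is handled by induction, since [f - d] lowers the nilpotency order. *)
Lemma geneig_divide f U c d y : c != d -> (forall x, x \in U -> f x \in U) ->
  y \in U -> geneig f d y ->
  exists2 z, z \in U & geneig f d z /\ y = shift f c z.
Proof.
move=> cd fU yU [p]; elim: p y yU => [|p IHp] y yU.
  by move=> /= ->; exists 0; rewrite ?mem0v ?linear0; split=> //; exists 0.
rewrite iterSr => fy.
have [|z' z'U [z'd z'E]] := IHp (shift f d y) _ fy.
  by rewrite shiftE rpredB ?memvZ ?fU.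
exists ((d - c)^-1 *: (y - z')); first by rewrite memvZ // rpredB.
split.
  have [d0 L] := geneig_lin_closed f d.
  rewrite -[_ *: _]addr0; apply: (L) => //.
  rewrite addrC -scaleN1r; apply: L => //; exists p.+1; by rewrite iterSr.
have yE : shift f c y - shift f c z' = (d - c) *: y.
  by rewrite -z'E !shiftE scalerBl opprB addrC addrA subrK.
by rewrite linearZ linearB /= yE scalerA mulVf ?scale1r // subr_eq0 eq_sym.
Qed.

Lemma exists_eigenvector f U : U != 0%VS -> (forall x, x \in U -> f x \in U) ->
  exists c, exists2 x, x \in U & x != 0 /\ f x = c *: x.
Proof.
move=> U0 fU; pose e := vbasis U.
pose A := \matrix_(i < \dim U, j < \dim U) coord e j (f e`_i).
have [|c /eigenvalueP[v vA v0]] := @eigenvalue_closed F _ A.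
  by rewrite lt0n dimv_eq0.
have eU (i : 'I_(\dim U)) : e`_i \in U by rewrite vbasis_mem // mem_nth // size_tuple.
exists c, (\sum_i v 0 i *: e`_i).
  by apply: rpred_sum => i _; apply: memvZ.
split.
  apply: contra_neq v0 => x0; apply/rowP => i; rewrite mxE.
  by have /freeP := basis_free (vbasisP U); apply.
rewrite linear_sum scaler_sumr /=.
under eq_bigr => i _ do rewrite linearZ /= (coord_vbasis (fU _ (eU i))) scaler_sumr.
rewrite exchange_big /=; apply: eq_bigr => j _.
under eq_bigr => i _ do rewrite scalerA.
rewrite -scaler_suml scalerA; congr (_ *: _).
have /rowP/(_ j) := vA; rewrite !mxE => <-.
by apply: eq_bigr => i _; rewrite mxE.
Qed.

(** An induction principle that expresses that [U] is the sum of its generalized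
eigenspaces. If [c] is an eigenvalue, then [(f - c) U] is smaller, so [(f - c) x] is a sum
of generalized eigenvectors; those with eigenvalue other than [c] can be divided by [f - c],
and what remains of [x] is a generalized eigenvector for [c]. *)
Lemma geneig_span f U (P : V -> Prop) : (forall x, x \in U -> f x \in U) ->
  lin_closed P -> (forall c x, x \in U -> geneig f c x -> P x) ->
  forall x, x \in U -> P x.
Proof.
have [n] := ubnP (\dim U); elim: n U P => // n IHn U P dimU fU Plin PU x xU.
have [U0|U0] := eqVneq U 0%VS.
  by move: xU; rewrite U0 memv0 => /eqP->; case: Plin.
have [c [v vU [v0 fv]]] := exists_eigenvector U0 fU.
have sU y : y \in U -> shift f c y \in U by move=> yU; rewrite shiftE rpredB ?memvZ ?fU.
pose U' := (shift f c @: U)%VS.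
have U'U y : y \in U' -> y \in U by case/memv_imgP=> z zU ->; apply: sU.
have dimU' : (\dim U' < n)%N.
  apply: leq_trans (lfun_img_proper U0 sU _) _; last by [].
  by exists v; rewrite // shiftE fv subrr.
have fU' y : y \in U' -> f y \in U'.
  case/memv_imgP=> z zU ->; apply/memv_imgP; exists (f z); first exact: fU.
  by rewrite !shiftE linearB linearZ.
pose P' y := exists2 w, w \in U & P w /\ geneig f c (y - shift f c w).
have [gc0 gcL] := geneig_lin_closed f c.
have [P0 PL] := Plin.
have P'lin : lin_closed P'.
  split; first by exists 0; rewrite ?mem0v // linear0 subr0.
  move=> a y z [w wU [Pw gw]] [w' w'U [Pw' gw']].
  exists (a *: w + w'); first by rewrite rpredD ?memvZ.
  split; first exact: PL.
  by rewrite linearP /= opprD addrACA -scalerBr; apply: gcL.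
have := IHn U' P' dimU' fU' P'lin _ (shift f c x) (memv_img _ xU).
case=> [d y yU' yd|w wU [Pw [k gw]]].
  have [cd|cd] := eqVneq c d.
    by exists 0; rewrite ?mem0v //; split=> //; rewrite linear0 subr0 cd.
  have [z zU' [zd yE]] := geneig_divide cd fU' yU' yd.
  exists z; first exact: U'U.
  by split; [apply: PU zd; apply: U'U | rewrite -yE subrr].
have -> : x = 1 *: (x - w) + w by rewrite scale1r subrK.
apply: PL => //; apply: (PU c); first by rewrite rpredB.
by exists k.+1; rewrite iterSr linearB.
Qed.

End GeneralizedEigenvectors.

(** * Brackets and the Killing form *)

Section LieBasics.
Variables (F : fieldType) (g : vectType F) (br : g -> g -> g).
Hypothesis lie : lie_bracket br.
Implicit Types (x y z : g) (U V W : {vspace g}).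

Lemma adE x y : ad br x y = br x y.
Proof. by case: lie => linl _ _ _; rewrite /ad linfunE. Qed.

Lemma brDr x y z : br x (y + z) = br x y + br x z.
Proof. by rewrite -!adE linearD. Qed.
Lemma brZr a x y : br x (a *: y) = a *: br x y.
Proof. by rewrite -!adE linearZ. Qed.
Lemma br0r x : br x 0 = 0. Proof. by rewrite -adE linear0. Qed.
Lemma brNr x y : br x (- y) = - br x y. Proof. by rewrite -!adE linearN. Qed.
Lemma brBr x y z : br x (y - z) = br x y - br x z.
Proof. by rewrite brDr brNr. Qed.
Lemma br_sumr (I : Type) (s : seq I) (P : pred I) f x :
  br x (\sum_(i <- s | P i) f i) = \sum_(i <- s | P i) br x (f i).
Proof. by rewrite -adE linear_sum; apply: eq_bigr => i _; rewrite /= adE. Qed.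

Lemma brDl x y z : br (x + y) z = br x z + br y z.
Proof.
by case: lie => _ linr _ _; have /= := linr z 1 x y; rewrite !scale1r.
Qed.

Lemma brxx x : br x x = 0. Proof. by case: lie. Qed.

Lemma brC x y : br x y = - br y x.
Proof.
apply/eqP; rewrite -addr_eq0; have := brxx (x + y).
by rewrite brDr !brDl !brxx add0r addr0 addrC => ->.
Qed.

Lemma brZl a x y : br (a *: x) y = a *: br x y.
Proof. by rewrite brC brZr -scalerN -brC. Qed.
Lemma br0l x : br 0 x = 0. Proof. by rewrite brC br0r oppr0. Qed.
Lemma brNl x y : br (- x) y = - br x y. Proof. by rewrite brC brNr -brC. Qed.
Lemma brBl x y z : br (x - y) z = br x z - br y z.
Proof. by rewrite brDl brNl. Qed.
Lemma br_suml (I : Type) (s : seq I) (P : pred I) f x :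
  br (\sum_(i <- s | P i) f i) x = \sum_(i <- s | P i) br (f i) x.
Proof. by rewrite brC br_sumr -sumrN; apply: eq_bigr => i _; rewrite -brC. Qed.

Lemma br_br x y z : br x (br y z) = br (br x y) z + br y (br x z).
Proof.
case: lie => _ _ _ jac; have /eqP := jac x y z.
rewrite (brC z (br x y)) (brC z x) brNr -addrA -opprD subr_eq0 => /eqP->.
by rewrite addrC.
Qed.

Lemma ad_br x y : ad br (br x y) = ((ad br x \o ad br y) - (ad br y \o ad br x))%VF.
Proof.
apply/lfunP => z; rewrite add_lfunE opp_lfunE !comp_lfunE !adE.
by rewrite (br_br x y z) addrK.
Qed.

Lemma adP a x y : ad br (a *: x + y) = a *: ad br x + ad br y.
Proof. by apply/lfunP => z; rewrite add_lfunE scale_lfunE !adE brDl brZl. Qed.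

Lemma memv_brv U V x y : x \in U -> y \in V -> br x y \in brv br U V.
Proof.
move=> xU yV; rewrite (coord_vbasis xU) (coord_vbasis yV) br_suml.
apply: rpred_sum => i _; rewrite brZl br_sumr memvZ //.
apply: rpred_sum => j _; rewrite brZr memvZ // memv_span //.
by apply: allpairs_f; apply: mem_nth; rewrite size_tuple.
Qed.

Lemma brv_sub U V W : (forall x y, x \in U -> y \in V -> br x y \in W) ->
  (brv br U V <= W)%VS.
Proof.
move=> sW; apply/span_subvP => z /allpairsP[[x y] /= [xU yV ->]].
by apply: sW; apply: vbasis_mem.
Qed.

Lemma subalgebraP U : subalgebra br U <-> forall x y, x \in U -> y \in U -> br x y \in U.
Proof.
split=> [/subvP sU x y xU yU|]; last exact: brv_sub.
by apply: sU; apply: memv_brv.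
Qed.

Lemma idealP U : ideal br U <-> forall x y, y \in U -> br x y \in U.
Proof.
split=> [/subvP sU x y yU|sU]; last by apply: brv_sub => x y _; apply: sU.
by apply: sU; apply: memv_brv => //; apply: memvf.
Qed.

Lemma brvS U U' V V' : (U <= U')%VS -> (V <= V')%VS -> (brv br U V <= brv br U' V')%VS.
Proof.
by move=> /subvP sU /subvP sV; apply: brv_sub => x y xU yV; apply: memv_brv; auto.
Qed.

Lemma killingC x y : killing br x y = killing br y x.
Proof. exact: lfun_traceC. Qed.

Lemma killingDl x y z : killing br (x + y) z = killing br x z + killing br y z.
Proof.
rewrite /killing -lfun_traceD -comp_lfunDl; congr lfun_trace; congr (_ \o _)%VF.
by rewrite -[x]scale1r adP !scale1r.
Qed.

Lemma killingZl a x y : killing br (a *: x) y = a * killing br x y.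
Proof.
rewrite /killing -lfun_traceZ comp_lfunZl; congr lfun_trace; congr (_ \o _)%VF.
by apply/lfunP => z; rewrite scale_lfunE !adE brZl.
Qed.

Lemma killing0l x : killing br 0 x = 0.
Proof. by rewrite -(scale0r 0) killingZl mul0r. Qed.
Lemma killing0r x : killing br x 0 = 0. Proof. by rewrite killingC killing0l. Qed.
Lemma killingNl x y : killing br (- x) y = - killing br x y.
Proof. by rewrite -scaleN1r killingZl mulN1r. Qed.
Lemma killingNr x y : killing br x (- y) = - killing br x y.
Proof. by rewrite killingC killingNl killingC. Qed.
Lemma killingBl x y z : killing br (x - y) z = killing br x z - killing br y z.
Proof. by rewrite killingDl killingNl. Qed.
Lemma killingDr x y z : killing br x (y + z) = killing br x y + killing br x z.
Proof. by rewrite ![killing br x _]killingC killingDl. Qed.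
Lemma killingZr a x y : killing br x (a *: y) = a * killing br x y.
Proof. by rewrite killingC killingZl killingC. Qed.
Lemma killing_suml (I : Type) (s : seq I) (P : pred I) f x :
  killing br (\sum_(i <- s | P i) f i) x = \sum_(i <- s | P i) killing br (f i) x.
Proof.
elim/big_rec2: _ => [|i y z _ <-]; first exact: killing0l.
by rewrite killingDl.
Qed.
Lemma killing_sumr (I : Type) (s : seq I) (P : pred I) f x :
  killing br x (\sum_(i <- s | P i) f i) = \sum_(i <- s | P i) killing br x (f i).
Proof. by rewrite killingC killing_suml; apply: eq_bigr => i _; rewrite killingC. Qed.

Lemma killing_br x y z : killing br (br x y) z = killing br x (br y z).
Proof.
rewrite /killing !ad_br comp_lfunDl comp_lfunDr !lfun_traceD.
rewrite comp_lfunNl comp_lfunNr -!scaleN1r !lfun_traceZ !comp_lfunA.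
congr (_ + _ * _).
by rewrite -comp_lfunA lfun_traceC.
Qed.

End LieBasics.

(** * Weight spaces of a Cartan subalgebra *)

(** A duplicate-free sequence of maximal length lists everything. *)
Lemma max_uniq_seq (T : eqType) (S : T -> Prop) N :
  (forall s : seq T, uniq s -> (forall x, x \in s -> S x) -> (size s <= N)%N) ->
  exists s : seq T, uniq s /\ forall x, x \in s <-> S x.
Proof.
move=> bound; suff key n (s : seq T) : uniq s -> (forall x, x \in s -> S x) ->
    (N - size s <= n)%N -> exists s : seq T, uniq s /\ forall x, x \in s <-> S x.
  by apply: (key N [::]); rewrite ?leq_subr.
elim: n s => [|n IHn] s us sS Ns.
  exists s; split=> // x; split=> [/sS //|Sx]; apply: contrapT => /negP xs.
  have := bound (x :: s); rewrite /= xs us => /(_ isT) H.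
  have : (size s < N)%N.
    by apply: H => y; rewrite inE => /orP[/eqP->|/sS].
  by rewrite -subn_gt0 ltnNge Ns.
have [all|] := pselect (forall x, S x -> x \in s).
  by exists s; split=> // x; split=> [/sS|/all].
move=> /existsNP[x /not_implyP[Sx /negP xs]].
apply: (IHn (x :: s)); first by rewrite /= xs us.
  by move=> y; rewrite inE => /orP[/eqP->|/sS].
by rewrite /= subnS; case: (_ - _)%N Ns.
Qed.

Section WeightsDef.
Variables (F : numClosedFieldType) (g : vectType F) (br : g -> g -> g).
Variable t : {vspace g}.

Definition weight_vector (l : dual (subvs_of t)) (x : g) :=
  forall h : subvs_of t, geneig (ad br (vsval h)) (l h) x.

(** Generalized weight spaces: that [t] acts on them by scalars is only known later. *)
Definition weight_space (l : dual (subvs_of t)) : {vspace g} :=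
  vspace_of (weight_vector l).

Definition weights : seq (dual (subvs_of t)) :=
  xget [::] [set s | uniq s /\ forall l, l \in s <-> weight_space l != 0%VS]%classic.

Definition tstable (U : {vspace g}) :=
  forall h x, h \in t -> x \in U -> br h x \in U.
End WeightsDef.

Section Weights.
Variables (F : numClosedFieldType) (g : vectType F) (br : g -> g -> g).
Hypothesis lie : lie_bracket br.
Variable t : {vspace g}.
Hypothesis cartan_t : cartan br t.
Implicit Types (x y z : g) (U V W : {vspace g}) (l m : dual (subvs_of t)).
Implicit Types (h : subvs_of t).
Local Notation wv := (@weight_vector F g br t).
Local Notation wsp := (@weight_space F g br t).
Local Notation wts := (@weights F g br t).
Local Notation tstable := (@tstable F g br t).

(** The Leibniz rule for [ad h - (c + d)] on brackets, iterated. *)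
Lemma iter_shift_br (h : g) c d p q x y :
  iter p (shift (ad br h) c) x = 0 -> iter q (shift (ad br h) d) y = 0 ->
  iter (p + q) (shift (ad br h) (c + d)) (br x y) = 0.
Proof.
have [n] := ubnP (p + q); elim: n p q x y => // n IHn p q x y pq.
case: p pq => [|p] pq; first by move=> /= -> _; rewrite (br0l lie) // iter_lfun0.
case: q pq => [|q] pq; first by move=> _ y0; rewrite [y]y0 (br0r lie) // iter_lfun0.
move=> xp yq; rewrite addSn iterSr.
have -> : shift (ad br h) (c + d) (br x y) =
    br (shift (ad br h) c x) y + br x (shift (ad br h) d y).
  rewrite !shiftE !(adE lie) (brBl lie) (brBr lie) (brZl lie) (brZr lie).
  by rewrite (br_br lie h) scalerDl opprD addrACA.
have hA : iter (p + q.+1) (shift (ad br h) (c + d)) (br (shift (ad br h) c x) y) = 0.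
  by apply: IHn => //; rewrite -iterSr.
have hB : iter (p + q.+1) (shift (ad br h) (c + d)) (br x (shift (ad br h) d y)) = 0.
  by rewrite addnS -addSn; apply: IHn; rewrite ?addSnnS // -iterSr.
by rewrite -[X in iter _ _ (X + _)]scale1r iter_lfunP hA hB scaler0 addr0.
Qed.

Lemma geneig_br (h : g) c d x y : geneig (ad br h) c x -> geneig (ad br h) d y ->
  geneig (ad br h) (c + d) (br x y).
Proof. by move=> [p xp] [q yq]; exists (p + q)%N; apply: iter_shift_br. Qed.

Lemma weight_vector_lin_closed l : lin_closed (wv l).
Proof.
split=> [h|a x y xl yl h]; first by case: (geneig_lin_closed (ad br (vsval h)) (l h)).
by case: (geneig_lin_closed (ad br (vsval h)) (l h)) => _; apply.
Qed.

Lemma mem_wsp l x : x \in wsp l <-> wv l x.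
Proof. exact/mem_vspace_of/weight_vector_lin_closed. Qed.

Lemma weight_vector_br l m x y : wv l x -> wv m y -> wv (l + m) (br x y).
Proof. by move=> xl ym h; rewrite add_lfunE; apply: geneig_br. Qed.

Lemma wsp_br l m x y : x \in wsp l -> y \in wsp m -> br x y \in wsp (l + m).
Proof. by rewrite !mem_wsp; apply: weight_vector_br. Qed.

Lemma cartan_sub0 : (t <= wsp 0%R)%VS.
Proof.
case: cartan_t => _ [n tn] _; apply/subvP => x xt; apply/mem_wsp => h.
rewrite zero_lfunE; exists n; apply/eqP; rewrite -memv0 -tn.
elim: n {tn} => //= n IHn.
by rewrite shiftE scale0r subr0 (adE lie) // memv_brv // subvsP.
Qed.

Lemma tstable_wsp l : tstable (wsp l).
Proof.
by move=> h x /(subvP cartan_sub0) h0 xl; rewrite -[l]add0r; apply: wsp_br.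
Qed.

Lemma cartan_br x y : x \in t -> y \in t -> br x y \in t.
Proof. by case: cartan_t => /(subalgebraP lie) st _ _; apply: st. Qed.

Lemma sub_trace_geneig U (f : 'End(g)) c : (forall x, x \in U -> f x \in U) ->
  (forall x, x \in U -> geneig f c x) -> sub_trace U f = c * (\dim U)%:R.
Proof.
move=> fU gU; have -> : f = shift f c + c *: \1%VF by rewrite /shift subrK.
rewrite sub_traceD sub_traceZ sub_trace1 sub_trace_nilp ?add0r // => x xU.
by rewrite shiftE rpredB ?fU ?memvZ.
Qed.

(** The common eigenvalue of [ad h] is its trace divided by the dimension, which is linear
in [h]. *)
Lemma single_eigenvalue_linear U : tstable U -> U != 0%VS ->
  (forall h, exists c, forall x, x \in U -> geneig (ad br (vsval h)) c x) ->
  exists l, forall x, x \in U -> wv l x.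
Proof.
move=> tU U0 sing.
have dU0 : ((\dim U)%:R : F) != 0 by rewrite pnatr_eq0 dimv_eq0.
pose f (h : subvs_of t) : F^o := sub_trace U (ad br (vsval h)) / (\dim U)%:R.
have flin : linear f.
  move=> a h k; rewrite /f linearP (adP lie) sub_traceD sub_traceZ mulrDl.
  by rewrite -mulrA.
exists (linfun f) => x xU h; rewrite linfunE // /f.
have [c cU] := sing h.
rewrite (@sub_trace_geneig _ _ c) //; first by rewrite mulfK //; apply: cU.
by move=> y yU; rewrite (adE lie) // tU // subvsP.
Qed.

(** An induction principle that expresses that a stable subspace is the sum of its
intersections with the weight spaces. As long as some [h] has several eigenvalues on [U],
its generalized eigenspaces in [U] are smaller; they are stable because [ad h] is nilpotent
on [t]. Otherwise the eigenvalues form a weight. *)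
Lemma weight_span U (P : g -> Prop) : tstable U -> lin_closed P ->
  (forall l x, x \in U -> x \in wsp l -> P x) -> forall x, x \in U -> P x.
Proof.
have [n] := ubnP (\dim U); elim: n U => // n IHn U dimU tU Plin PU x xU.
have [U0|U0] := eqVneq U 0%VS.
  by move: xU; rewrite U0 memv0 => /eqP->; case: Plin.
have [sing|] := pselect (forall h, exists c, forall x, x \in U ->
    geneig (ad br (vsval h)) c x).
  have [l lU] := single_eigenvalue_linear tU U0 sing.
  by apply: (PU l) => //; apply/mem_wsp/lU.
move=> /existsNP[h nsing].
have sU y : y \in U -> ad br (vsval h) y \in U.
  by move=> yU; rewrite (adE lie) // tU // subvsP.
apply: (geneig_span sU Plin _ xU) => c y yU yc.
have [g0 gL] := geneig_lin_closed (ad br (vsval h)) c.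
pose Q z := z \in U /\ geneig (ad br (vsval h)) c z.
have Qlin : lin_closed Q.
  split=> [|a u v [uU uc] [vU vc]]; first by split; rewrite ?mem0v.
  by split; [rewrite rpredD ?memvZ | apply: gL].
have memQ z := mem_vspace_of z Qlin.
set W := vspace_of Q in memQ.
apply: (IHn W) => //.
- have sWU : (W <= U)%VS by apply/subvP => z /memQ[].
  apply: leq_trans (_ : (\dim W < \dim U)%N) _; last by [].
  rewrite (ltn_leqif (dimv_leqif_sup sWU)); apply/negP => /subvP sUW.
  by apply: nsing; exists c => z /sUW/memQ[].
- move=> h' z h't /memQ[zU zc]; apply/memQ; split; first exact: tU.
  rewrite -[c]add0r; apply: geneig_br => //.
  by have /mem_wsp/(_ h) := subvP cartan_sub0 _ h't; rewrite zero_lfunE.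
- by move=> l z /memQ[zU _]; apply: PU.
- by apply/memQ.
Qed.

(** A power of [ad h - m h], where [h] separates [l] from [m], removes the term of weight [m]
and is injective on the weight space of [l]. *)
Lemma weight_indep (s : seq (dual (subvs_of t))) l x (y : dual (subvs_of t) -> g) :
  l \notin s -> x \in wsp l -> (forall m, y m \in wsp m) ->
  x = \sum_(m <- s) y m -> x = 0.
Proof.
elim: s x y => [|m s IHs] x y; first by rewrite big_nil.
rewrite inE negb_or => /andP[lm ls] xl ym xE.
have [h lmh] : exists h, l h != m h.
  apply: contrapT => nex; case/eqP: lm; apply/lfunP => h.
  by apply/eqP; apply: contrapT => /negP lmh; apply: nex; exists h.
have /mem_wsp/(_ h)[k yk] := ym m.
have stab n z : z \in wsp n -> iter k (shift (ad br (vsval h)) (m h)) z \in wsp n.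
  move=> zn; apply: iter_stable zn => u un.
  by rewrite shiftE rpredB ?memvZ // (adE lie) // tstable_wsp // subvsP.
have sumk (r : seq (dual (subvs_of t))) :
    iter k (shift (ad br (vsval h)) (m h)) (\sum_(n <- r) y n) =
    \sum_(n <- r) iter k (shift (ad br (vsval h)) (m h)) (y n).
  elim: r => [|n r IHr]; first by rewrite !big_nil iter_lfun0.
  by rewrite !big_cons -[X in X + _]scale1r iter_lfunP scale1r IHr.
apply: (geneig_disjoint lmh); first by have /mem_wsp := xl; apply.
exists k; apply: (IHs _ (fun n => iter k (shift (ad br (vsval h)) (m h)) (y n))) => //.
- exact: stab.
- by move=> n; apply: stab.
- by rewrite xE sumk big_cons yk add0r.
Qed.

Definition weight_sum (s : seq (dual (subvs_of t))) := (\sum_(l <- s) wsp l)%VS.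

Lemma wsumP s x : uniq s -> x \in weight_sum s ->
  exists2 y : dual (subvs_of t) -> g, (forall m, y m \in wsp m) & x = \sum_(m <- s) y m.
Proof.
elim: s x => [|m s IHs] x; rewrite /weight_sum.
  by rewrite big_nil memv0 => _ /eqP->; exists (fun=> 0) => [n|]; rewrite ?mem0v ?big_nil.
rewrite big_cons /= => /andP[ms us] /memv_addP[u um [v vs ->]].
have [y yw yE] := IHs _ us vs.
exists (fun n => if n == m then u else y n).
  by move=> n; case: eqP => [->|].
rewrite big_cons eqxx yE; congr (_ + _); apply: eq_big_seq => n ns.
by case: eqP => // nm; rewrite -nm ns in ms.
Qed.

Lemma wsum_cap0 l s : uniq s -> l \notin s -> (wsp l :&: weight_sum s = 0)%VS.
Proof.
move=> us ls; apply/eqP; rewrite -subv0; apply/subvP => x.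
rewrite memv_cap memv0 => /andP[xl xs]; have [y yw yE] := wsumP us xs.
by apply/eqP; apply: weight_indep xl yw yE.
Qed.

Lemma sub_wsum l s : l \in s -> (wsp l <= weight_sum s)%VS.
Proof.
by rewrite /weight_sum => ls; rewrite (big_rem l) //=; apply: addvSl.
Qed.

(** Independence bounds the number of weights by the dimension of [g]. *)
Lemma weightsP : uniq wts /\ forall l, l \in wts <-> wsp l != 0%VS.
Proof.
have [|s sP] := @max_uniq_seq _ (fun l => wsp l != 0%VS) (\dim {:g}).
  move=> s us s0; apply: (@leq_trans (\dim (weight_sum s))); last exact/dimvS/subvf.
  elim: s us s0 => //= l s IHs /andP[ls us] s0.
  rewrite /weight_sum big_cons dimv_disjoint_sum; last exact: wsum_cap0.
  rewrite -add1n leq_add // ?lt0n ?dimv_eq0 ?s0 ?inE ?eqxx // IHs //.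
  by move=> m ms; rewrite s0 // inE ms orbT.
by have /(xgetPex [::]) := ex_intro (fun s => uniq s /\ forall l, l \in s <-> wsp l != 0%VS) s sP.
Qed.

Lemma weights_uniq : uniq wts. Proof. by case: weightsP. Qed.

Lemma mem_weights l x : x \in wsp l -> x != 0 -> l \in wts.
Proof.
move=> xl x0; case: weightsP => _ /(_ l)[_]; apply.
by apply: contraNneq x0 => w0; rewrite w0 memv0 in xl.
Qed.

Lemma wsum_weights : weight_sum wts = fullv.
Proof.
apply/eqP; rewrite eqEsubv subvf; apply/subvP => x xg.
apply: (@weight_span fullv (fun x => x \in weight_sum wts)) xg => //.
- by move=> h y _ _; apply: memvf.
- exact: vspace_lin_closed.
move=> l y _ yl; have [->|y0] := eqVneq y 0; first exact: mem0v.
exact: subvP (sub_wsum (mem_weights yl y0)) _ yl.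
Qed.

Lemma weight_span_full (P : g -> Prop) : lin_closed P ->
  (forall l x, x \in wsp l -> P x) -> forall x, P x.
Proof.
move=> Plin Pw x; apply: (@weight_span fullv) (memvf x) => //.
  by move=> h y _ _; apply: memvf.
by move=> l y _; apply: Pw.
Qed.

Lemma sub_trace_wsum s (f : 'End(g)) : uniq s ->
  (forall l x, l \in s -> x \in wsp l -> f x \in wsp l) ->
  sub_trace (weight_sum s) f = \sum_(l <- s) sub_trace (wsp l) f.
Proof.
rewrite /weight_sum; elim: s => [|l s IHs] /=.
  move=> _ _; rewrite !big_nil; apply: sub_trace_nilp => x; rewrite memv0 => /eqP->.
    by rewrite linear0 mem0v.
  by exists 0.
move=> /andP[ls us] fs; rewrite !big_cons sub_trace_add ?IHs ?wsum_cap0 //.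
- by move=> m x ms; apply: fs; rewrite inE ms orbT.
- by move=> x; apply: fs; rewrite inE eqxx.
- move=> x /(wsumP us)[y yw ->]; rewrite linear_sum big_seq; apply: rpred_sum => m ms.
  by apply: (subvP (sub_wsum ms)); apply: fs => //; rewrite inE ms orbT.
Qed.

(** The trace of a commutator vanishes on the weight space. *)
Lemma weight_br0 l (h k d : subvs_of t) : wsp l != 0%VS ->
  vsval d = br (vsval h) (vsval k) -> l d = 0.
Proof.
move=> l0 dE.
have st (e : subvs_of t) x : x \in wsp l -> ad br (vsval e) x \in wsp l.
  by move=> xl; rewrite (adE lie) // tstable_wsp // subvsP.
have tr0 : sub_trace (wsp l) (ad br (vsval d)) = 0.
  rewrite dE (ad_br lie) // sub_traceD -scaleN1r sub_traceZ sub_traceC; try exact: st.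
  by rewrite mulN1r subrr.
move/eqP: tr0; rewrite (@sub_trace_geneig _ _ (l d)) //; first last.
- by move=> x /mem_wsp.
- exact: st.
by rewrite mulf_eq0 pnatr_eq0 dimv_eq0 (negPf l0) orbF => /eqP.
Qed.

(** Take [y] in the last term of the lower central series of [t] that is not inside [S]. *)
Lemma nilpotent_ideal_step (S : {vspace g}) : ~~ (t <= S)%VS ->
  exists y, [/\ y \in t, y \notin S & forall k : g, k \in t -> br k y \in S].
Proof.
case: cartan_t => _ [n tn] _ tS.
pose T i := iter i (fun V => brv br t V) t.
have Tt i : (T i <= t)%VS.
  elim: i => [|i IHi]; first exact: subvv.
  by apply: brv_sub => x y xt /(subvP IHi) yt; apply: cartan_br.
have [i Ti Ti1] : exists2 i, ~~ (T i <= S)%VS & (T i.+1 <= S)%VS.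
  have: (T n <= S)%VS by rewrite /T tn sub0v.
  elim: (n) => [|i IHi]; first by rewrite /T /= (negPf tS).
  by have [/IHi //|TiS TS] := boolP (T i <= S)%VS; exists i.
have [y yT yS] := subvPn Ti.
exists y; split=> // [|h ht]; first exact: subvP (Tt i) _ yT.
by apply: (subvP Ti1); apply: memv_brv.
Qed.

(** The argument of Engel and Lie: [t] has an eigenvector of weight [l] in [V / V0]. Given an
ideal [S] of [t] that acts by [l] on some vector of [V / V0], the space of all such vectors
is stable under [t] since [l] vanishes on brackets; if [S] is proper, some [y] outside [S]
is central modulo [S], and iterating [ad y - l y] gives a vector on which [S + <[y]>]
acts by [l]. *)
Lemma weight_vector_modulo l (V0 V : {vspace g}) :
  tstable V0 -> tstable V -> (V0 <= V)%VS -> V0 != V -> (V <= wsp l)%VS ->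
  exists x, [/\ x \in V, x \notin V0 &
     forall h, br (vsval h) x - (l h : F) *: x \in V0].
Proof.
move=> tV0 tV sV0 nV0 Vl.
have l0 : wsp l != 0%VS.
  apply: contra_neq nV0 => w0; rewrite w0 in Vl.
  have V00 : V = 0%VS by apply/eqP; rewrite -subv0.
  by apply/eqP; rewrite V00 -subv0 -V00.
suff key n (S : {vspace g}) : (\dim t - \dim S <= n)%N -> (S <= t)%VS ->
    (forall k s : g, k \in t -> s \in S -> br k s \in S) ->
    (exists x, [/\ x \in V, x \notin V0 &
      forall s : subvs_of t, vsval s \in S -> br (vsval s) x - (l s : F) *: x \in V0]) ->
    exists x, [/\ x \in V, x \notin V0 &
      forall h, br (vsval h) x - (l h : F) *: x \in V0].
  apply: (key (\dim t) 0%VS); rewrite ?leq_subr ?sub0v //.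
    by move=> h s _; rewrite memv0 => /eqP->; rewrite (br0r lie) // mem0v.
  have [x xV xV0] : exists2 x, x \in V & x \notin V0.
    by apply/subvPn; apply: contra nV0 => VV0; rewrite eqEsubv sV0.
  exists x; split=> // s; rewrite memv0 => /eqP s0.
  have -> : s = 0 by apply: val_inj.
  by rewrite /= (br0l lie) // linear0 scale0r subr0 mem0v.
elim: n S => [|n IHn] S dS St iS [x [xV xV0 xS]].
  have tS : (t <= S)%VS.
    by rewrite -(geq_leqif (dimv_leqif_sup St)) -subn_eq0 -leqn0.
  by exists x; split=> // h; apply: xS; apply: (subvP tS); apply: subvsP.
have [tS|/nilpotent_ideal_step[y [yt yS ty]]] := boolP (t <= S)%VS.
  by exists x; split=> // h; apply: xS; apply: (subvP tS); apply: subvsP.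
pose Q z := z \in V /\ forall s : subvs_of t, vsval s \in S ->
  br (vsval s) z - (l s : F) *: z \in V0.
pose y' := vsproj t y; have y'E : vsval y' = y by rewrite vsprojK.
pose f := shift (ad br y) (l y').
have fE z : f z = br y z - (l y' : F) *: z by rewrite /f shiftE adE.
have fQ z : Q z -> Q (f z).
  move=> [zV zS]; split; first by rewrite fE rpredB ?memvZ // tV.
  move=> s sS; rewrite fE (brBr lie) (brZr lie) scalerBr opprB.
  have -> : br (vsval s) (br y z) = br (br (vsval s) y) z + br y (br (vsval s) z).
    exact: br_br.
  pose d := vsproj t (br (vsval s) y).
  have dt : br (vsval s) y \in t by apply: cartan_br; rewrite ?subvsP.
  have dE : vsval d = br (vsval s) y by rewrite vsprojK.
  have ld : l d = 0 by apply: (@weight_br0 l s y') => //; rewrite y'E.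
  have d0 : br (vsval d) z \in V0.
    have := zS d; rewrite ld scale0r subr0; apply.
    by rewrite dE ty ?subvsP // (brC lie) rpredN ty // subvsP.
  have -> : br (br (vsval s) y) z = br (vsval d) z by rewrite dE.
  have -> : br (vsval d) z + br y (br (vsval s) z) - (l y' : F) *: br (vsval s) z
      + ((l s : F) *: ((l y' : F) *: z) - (l s : F) *: br y z) =
      br (vsval d) z + (br y (br (vsval s) z - (l s : F) *: z)
        - (l y' : F) *: (br (vsval s) z - (l s : F) *: z)).
    rewrite (brBr lie) (brZr lie) scalerBr !scalerA [(l y' : F) * _]mulrC opprB.
    rewrite -!addrA; congr (_ + (_ + _)); rewrite !addrA addrC !addrA.
    by rewrite -!addrA; congr (_ + _); rewrite addrC.
  by rewrite rpredD // rpredB ?memvZ ?tV0 ?zS.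
have [j xj fxj] : exists2 j, iter j f x \notin V0 & iter j.+1 f x \in V0.
  have /mem_wsp/(_ y')[k] := subvP Vl _ xV; rewrite y'E => fk.
  have: iter k f x \in V0 by rewrite fk mem0v.
  elim: (k) => [|i IHi]; first by rewrite /= (negPf xV0).
  by have [/IHi //|fi fi1] := boolP (iter i f x \in V0); exists i.
have [jV jS] : Q (iter j f x) by elim: j {xj fxj} => //= j; apply: fQ.
apply: (IHn (S + <[y]>)%VS).
- have : (\dim S < \dim (S + <[y]>))%N.
    rewrite (ltn_leqif (dimv_leqif_sup (addvSl _ _))).
    by apply: contra yS => /subvP; apply; apply: subvP (addvSr _ _) _ (memv_line y).
  by move: dS; rewrite !leq_subLR => dS lt; apply: leq_trans dS _; rewrite -addSnnS leq_add2r.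
- by rewrite subv_add St -memvE.
- move=> h s ht /memv_addP[u uS [v /vlineP[a ->] ->]].
  apply: (subvP (addvSl _ _)); rewrite (brDr lie) (brZr lie).
  by apply: rpredD; [apply: iS | apply: memvZ; apply: (ty h)].
exists (iter j f x); split=> // s /memv_addP[u uS [v /vlineP[a ->] sE]].
pose u' := vsproj t u; have u'E : vsval u' = u by rewrite vsprojK // (subvP St).
have -> : s = u' + a *: y' by apply: val_inj; rewrite /= sE u'E y'E.
have -> : br (vsval (u' + a *: y')) (iter j f x) - (l (u' + a *: y') : F) *: iter j f x =
   (br (vsval u') (iter j f x) - (l u' : F) *: iter j f x) + a *: f (iter j f x).
  have -> : (l (u' + a *: y') : F) = (l u' : F) + a * (l y' : F).
    by rewrite linearD linearZ.
  rewrite [vsval _]/= y'E (brDl lie) (brZl lie) fE scalerDl scalerBr scalerA.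
  by rewrite opprD addrACA.
by rewrite rpredD ?memvZ // jS // u'E.
Qed.
End Weights.

(** * Nondegeneracy of the Killing form *)

Section Toral.
Variables (F : numClosedFieldType) (g : vectType F) (br : g -> g -> g).
Hypothesis lie : lie_bracket br.
Hypothesis simple_g : simple_lie br.
Variable t : {vspace g}.
Hypothesis cartan_t : cartan br t.
Implicit Types (x y z : g) (U V W : {vspace g}) (l m n : dual (subvs_of t)).
Implicit Types (h k d : subvs_of t).
Local Notation wsp := (@weight_space F g br t).
Local Notation wts := (@weights F g br t).
Local Notation wsum := (@weight_sum F g br t).
Local Notation kf := (killing br).
Local Notation tv := (dual_to_cartan br t).

(** Otherwise [weight_vector_modulo] gives an element outside [t] that normalizes [t]. *)
Lemma weight_space0 : wsp 0 = t.
Proof.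
apply/eqP; rewrite eq_sym; apply/negPn/negP => nt.
have [||||x [x0 /negP xt hx]] := weight_vector_modulo lie cartan_t (l := 0) _ _ _ nt.
- by move=> h x ht xt; apply: (cartan_br lie cartan_t).
- exact: tstable_wsp.
- exact: cartan_sub0.
- exact: subvv.
apply: xt; case: cartan_t => _ _; apply=> h ht.
have := hx (vsproj t h); rewrite zero_lfunE scale0r subr0 vsprojK //.
by rewrite (brC lie) rpredN.
Qed.

(** By invariance, [(l h + m h) kappa(x, y)] is a combination of values on vectors of smaller
nilpotency order. *)
Lemma killing_weights l m x y : l + m != 0 -> x \in wsp l -> y \in wsp m -> kf x y = 0.
Proof.
move=> lm0 /(mem_wsp _ _) xl /(mem_wsp _ _) ym.
have [h lmh] : exists h, (l h : F) + m h != 0.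
  apply: contrapT => nex; case/eqP: lm0; apply/lfunP => h; rewrite add_lfunE zero_lfunE.
  by apply/eqP; apply: contrapT => /negP lmh; apply: nex; exists h.
have [p xp] := xl h; have [q yq] := ym h.
have [b] := ubnP (p + q); elim: b p q x y {xl ym} xp yq => // b IHb p q x y xp yq pq.
case: p xp pq => [|p] xp pq; first by rewrite [x]xp killing0l.
case: q yq pq => [|q] yq pq; first by rewrite [y]yq killing0r.
have k1 : kf (shift (ad br (vsval h)) (l h) x) y = 0.
  by apply: (IHb p q.+1) => //; rewrite -iterSr.
have k2 : kf x (shift (ad br (vsval h)) (m h) y) = 0.
  apply: (IHb p.+1 q) => //; first by rewrite -iterSr.
  by rewrite addSnnS.
have inv : kf (br (vsval h) x) y + kf x (br (vsval h) y) = 0.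
  by rewrite (brC lie) (killingNl lie) (killing_br lie) addNr.
move: k1 k2; rewrite !shiftE !(adE lie) (killingBl lie) (killingZl lie).
rewrite (killingDr lie) (killingNr lie) (killingZr lie) => k1 k2.
have : ((l h : F) + m h) * kf x y = 0.
  move/eqP: k1; rewrite subr_eq0 => /eqP k1; move/eqP: k2; rewrite subr_eq0 => /eqP k2.
  by rewrite mulrDl -k1 -k2.
by move/eqP; rewrite mulf_eq0 (negPf lmh) => /eqP.
Qed.

Lemma weight_stable_ad l h x : x \in wsp l -> ad br (vsval h) x \in wsp l.
Proof. by move=> xl; rewrite (adE lie) // (tstable_wsp lie cartan_t) // subvsP. Qed.

Lemma lfun_trace_weights (f : 'End(g)) : (forall l x, x \in wsp l -> f x \in wsp l) ->
  lfun_trace f = \sum_(l <- wts) sub_trace (wsp l) f.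
Proof.
move=> fw; rewrite -sub_tracef -(wsum_weights lie cartan_t).
apply: (sub_trace_wsum lie cartan_t (weights_uniq lie cartan_t)) => l x _.
exact: fw.
Qed.

Lemma killing_cartan_sq h :
  kf (vsval h) (vsval h) = \sum_(l <- wts) (\dim (wsp l))%:R * (l h : F) ^+ 2.
Proof.
rewrite /killing lfun_trace_weights.
  apply: eq_bigr => l _; set f := ad br (vsval h); set c : F := l h.
  have fl x : x \in wsp l -> f x \in wsp l by apply: weight_stable_ad.
  have sl x : x \in wsp l -> shift f c x \in wsp l.
    by move=> xl; rewrite shiftE rpredB ?memvZ ?fl.
  have gl x : x \in wsp l -> geneig f c x by move=> /mem_wsp; apply.
  (* [f^2 = (f - c)^2 + c (f - c) + c f], with the first two terms nilpotent. *)
  have -> : (f \o f)%VF = (shift f c \o f)%VF + c *: f.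
    by apply/lfunP => x; rewrite add_lfunE scale_lfunE !comp_lfunE shiftE subrK.
  have -> : (shift f c \o f)%VF = (shift f c \o shift f c)%VF + c *: shift f c.
    apply/lfunP => x; rewrite add_lfunE scale_lfunE !comp_lfunE -linearZ -linearD.
    by congr (shift f c _); rewrite shiftE subrK.
  rewrite !sub_traceD !sub_traceZ (sub_trace_geneig fl gl).
  rewrite (@sub_trace_nilp _ _ _ (_ \o _)%VF); first last.
  - move=> x /gl[k xk]; exists k.
    have xk2 : iter (k + k) (shift f c) x = 0 by rewrite (iter_lfun_leq _ xk) ?leq_addr.
    rewrite -xk2 addnn; elim: k {xk xk2} => //= k ->.
    by rewrite comp_lfunE.
  - by move=> x /sl/sl; rewrite comp_lfunE.
  rewrite (sub_trace_nilp sl gl) mulr0 !add0r mulrA mulrC expr2; ring.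
by move=> l x xl; rewrite comp_lfunE !weight_stable_ad.
Qed.

(** Polarization of [killing_cartan_sq], where a single operator has to be traced. *)
Lemma killing_cartan h k : kf (vsval h) (vsval k) =
  \sum_(l <- wts) (\dim (wsp l))%:R * ((l h : F) * l k).
Proof.
have := killing_cartan_sq (h + k).
have -> : vsval (h + k) = vsval h + vsval k by [].
rewrite (killingDl lie) !(killingDr lie) (killingC _ (vsval k)) !killing_cartan_sq => H.
have F2 : (2 : F) != 0 by rewrite pnatr_eq0.
apply: (mulfI F2).
have -> : 2 * kf (vsval h) (vsval k) =
  \sum_(l <- wts) (\dim (wsp l))%:R * (l (h + k) : F) ^+ 2
  - \sum_(l <- wts) (\dim (wsp l))%:R * (l h : F) ^+ 2
  - \sum_(l <- wts) (\dim (wsp l))%:R * (l k : F) ^+ 2 by rewrite -H; ring.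
rewrite -!sumrB mulr_sumr; apply: eq_bigr => l _.
have -> : (l (h + k) : F) = (l h : F) + l k by rewrite linearD.
by ring.
Qed.

(** The sum of the weight spaces of weights [m + k l] is stable under [ad x] and [ad y], so
the trace of [ad d] on it is zero. That trace is [\sum_k dim_k (m d + k l d)]. *)
Lemma string_real l m x y d : x \in wsp l -> y \in wsp (- l) -> vsval d = br x y ->
  m \in wts -> exists2 r : F, r \is Num.real & (m d : F) = r * l d.
Proof.
move=> xl yl dE mw.
have [_ memw] := weightsP lie cartan_t.
pose P n := `[<exists k : int, n = m + l *~ k>].
pose s := [seq n <- wts | P n].
have us : uniq s by rewrite filter_uniq // (weights_uniq lie cartan_t).
have ms : m \in s.
  by rewrite mem_filter mw andbT; apply/asboolP; exists 0; rewrite mulr0z addr0.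
have shft (e : int) w z n : w \in wsp (l *~ e) -> n \in s -> z \in wsp n -> br w z \in wsum s.
  move=> wl; rewrite mem_filter => /andP[/asboolP[k nE] _] zn.
  have [->|z0] := eqVneq (br w z) 0; first exact: mem0v.
  have zw := wsp_br lie wl zn.
  apply: (subvP (sub_wsum _ _) _ zw).
  rewrite mem_filter (mem_weights lie cartan_t zw z0) andbT.
  by apply/asboolP; exists (e + k); rewrite nE addrCA -mulrzDr.
have stab (e : int) w : w \in wsp (l *~ e) -> forall z, z \in wsum s -> ad br w z \in wsum s.
  move=> wl z /(wsumP us)[u uw ->]; rewrite linear_sum big_seq.
  by apply: rpred_sum => n ns; rewrite /= (adE lie) //; apply: shft wl ns _; apply: uw.
have tr0 : sub_trace (wsum s) (ad br (vsval d)) = 0.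
  rewrite dE (ad_br lie) // sub_traceD -scaleN1r sub_traceZ sub_traceC ?mulN1r ?subrr //.
    by apply: (stab 1); rewrite mulr1z.
  by apply: (stab (-1)); rewrite mulrN1z.
rewrite (sub_trace_wsum lie cartan_t us) in tr0; last by move=> n z _; apply: weight_stable_ad.
have trE n : sub_trace (wsp n) (ad br (vsval d)) = (n d : F) * (\dim (wsp n))%:R.
  apply: sub_trace_geneig => z; first exact: weight_stable_ad.
  by move/(mem_wsp _ _); apply.
have /choice[k kE] n : exists k : int, n \in s -> n = m + l *~ k.
  have [|] := boolP (n \in s); last by exists 0.
  by rewrite mem_filter => /andP[/asboolP[k nE] _]; exists k.
pose D : nat := \sum_(n <- s) \dim (wsp n).
pose K : int := \sum_(n <- s) k n * (\dim (wsp n))%:Z.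
have D0 : (D%:R : F) != 0.
  rewrite pnatr_eq0 -lt0n /D (big_rem m) //= addn_gt0 lt0n dimv_eq0.
  by have /memw -> := mw.
have sumE : (m d : F) * D%:R + l d * K%:~R = 0.
  rewrite -tr0 /D /K natr_sum rmorph_sum /= !mulr_sumr -big_split /=.
  rewrite [LHS]big_seq [RHS]big_seq; apply: eq_bigr => n ns.
  have nd : (n d : F) = (m d : F) + l d * (k n)%:~R.
    by rewrite {1}(kE n ns) add_lfunE -scaler_int scale_lfunE [in RHS]mulrC.
  by rewrite trE nd rmorphM /= mulrDl !mulrA.
exists (- (K%:~R / D%:R)).
  by rewrite rpredN rpredM // ?rpredV ?realz ?realn.
apply: (mulIf D0); rewrite [RHS]mulrAC mulNr divfK // mulNr [K%:~R * _]mulrC.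
by apply/eqP; rewrite -addr_eq0 sumE.
Qed.

Lemma cartan_weights_vanish d : (forall l, l \in wts -> l d = 0) ->
  forall k, kf (vsval d) (vsval k) = 0.
Proof.
move=> ld k; rewrite killing_cartan big_seq big1 // => l /ld ->.
by rewrite mul0r mulr0.
Qed.

Lemma derived_full : brv br fullv fullv = fullv.
Proof.
case: simple_g => nab /(_ (brv br fullv fullv)) [|//|//].
by apply/(idealP lie) => x y _; apply: memv_brv => //; apply: memvf.
Qed.

(** All weights are real multiples of [l] at [d], and [kappa(d, d)] is a sum of their squares. *)
Lemma string_vanish l x y d : x \in wsp l -> y \in wsp (- l) -> vsval d = br x y ->
  kf (vsval d) (vsval d) = 0 -> forall m, m \in wts -> m d = 0.
Proof.
move=> xl yl dE kd.
have /choice[r rE] m : exists r : F, m \in wts -> r \is Num.real /\ (m d : F) = r * l d.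
  have [mw|] := boolP (m \in wts); last by exists 0.
  by have [r rr rE] := string_real xl yl dE mw; exists r.
have [ld0|ld0] := eqVneq (l d : F) 0.
  by move=> m /rE[_]; rewrite ld0 mulr0.
have [_ memw] := weightsP lie cartan_t.
have : \sum_(m <- wts | m \in wts) (\dim (wsp m))%:R * r m ^+ 2 = 0.
  apply: (mulIf (expf_neq0 2 ld0)); rewrite mul0r -[RHS]kd killing_cartan_sq mulr_suml.
  rewrite [RHS]big_seq; apply: eq_bigr => m /rE[_ ->].
  by rewrite [in RHS]exprMn [RHS]mulrA.
move/eqP; rewrite psumr_eq0 => [|m /rE[rr _]]; last first.
  by rewrite mulr_ge0 ?ler0n // real_exprn_even_ge0.
move=> /allP all0 m mw; have [_ ->] := rE m mw.
have := all0 m mw; rewrite mw /= mulf_eq0 pnatr_eq0 dimv_eq0 sqrf_eq0.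
by have /memw/negPf -> := mw; move=> /eqP ->; rewrite mul0r.
Qed.

(** Cartan's criterion. If [kappa] vanishes, each bracket of vectors of opposite weights is
killed by all weights; as [g] is perfect, so is all of [t]. Then zero is the only weight and
[g = t] is nilpotent. *)
Lemma killing_neq0 : ~ (forall x y, kf x y = 0).
Proof.
move=> kf0; have [_ memw] := weightsP lie cartan_t.
pose s := [seq l <- wts | l != 0].
have us : uniq s by rewrite filter_uniq // (weights_uniq lie cartan_t).
pose T (d : subvs_of t) := forall m, m \in wts -> m d = 0.
have Tlin a d e : T d -> T e -> T (a *: d + e).
  by move=> Td Te m mw; rewrite linearP /= (Td m mw) (Te m mw) scaler0 addr0.
(* [B z]: modulo the nonzero weight spaces, [z] is an element of [t] killed by all weights. *)
pose B z := exists d, T d /\ z - vsval d \in wsum s.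
have Blin : lin_closed B.
  split; first by exists 0; split=> [m _|]; [exact: linear0 | rewrite (linear0 vsval) subrr mem0v].
  move=> a u v [d [Td ud]] [e [Te ve]]; exists (a *: d + e); split; first exact: Tlin.
  by rewrite /= opprD addrACA -scalerBr rpredD ?memvZ.
have Bw l m x y : x \in wsp l -> y \in wsp m -> B (br x y).
  move=> xl ym; have xy := wsp_br lie xl ym.
  have [lm0|lm0] := eqVneq (l + m) 0.
    have xyt : br x y \in t by rewrite -weight_space0 -lm0.
    have dE : vsval (vsproj t (br x y)) = br x y by rewrite vsprojK.
    exists (vsproj t (br x y)); split; last by rewrite dE subrr mem0v.
    apply: (string_vanish xl _ dE) => //.
    by have /eqP := lm0; rewrite addrC addr_eq0 => /eqP <-.
  exists 0; split=> [n _|]; first exact: linear0.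
  rewrite (linear0 vsval) subr0; have [->|xy0] := eqVneq (br x y) 0; first exact: mem0v.
  apply: (subvP (sub_wsum _ _) _ xy).
  by rewrite mem_filter lm0 (mem_weights lie cartan_t xy xy0).
have [B0 BL] := Blin.
have Bxy x y : B (br x y).
  move: x; apply: (weight_span_full lie cartan_t) => [|l x xl].
    by split=> [|a u v Bu Bv]; rewrite ?(br0l lie) // (brDl lie) // (brZl lie) //; apply: BL.
  move: y; apply: (weight_span_full lie cartan_t) => [|m y ym].
    by split=> [|a u v Bu Bv]; rewrite ?(br0r lie) // (brDr lie) // (brZr lie) //; apply: BL.
  exact: Bw xl ym.
have memB z : z \in vspace_of B <-> B z := mem_vspace_of z Blin.
have Bg z : B z.
  have : z \in brv br fullv fullv by rewrite derived_full memvf.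
  move=> zg; apply/memB; apply: subvP zg; apply: (brv_sub) => x y _ _; apply/memB.
  exact: Bxy.
have w0 m : m \in wts -> m = 0.
  move=> mw; apply/lfunP => d; rewrite zero_lfunE.
  have [e [Te de]] := Bg (vsval d).
  suff -> : d = e by apply: Te.
  apply/val_inj/eqP; rewrite -subr_eq0 -memv0.
  rewrite -(wsum_cap0 lie cartan_t (l := 0) us) ?memv_cap ?de ?andbT.
    by rewrite weight_space0 rpredB ?subvsP.
  by rewrite mem_filter eqxx.
have tf : t = fullv.
  apply/eqP; rewrite eqEsubv subvf; apply/subvP => z.
  rewrite -(wsum_weights lie cartan_t) => /(wsumP (weights_uniq lie cartan_t))[y yw ->].
  rewrite big_seq; apply: rpred_sum => m mw.
  have <- : wsp m = t by rewrite (w0 m mw) weight_space0.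
  exact: yw.
case: cartan_t => _ [k tk] _; case: simple_g => nab _; apply: nab.
rewrite derived_full -tk tf; elim: (k) => //= i <-.
by rewrite derived_full.
Qed.

Lemma killing_nondegenerate x : (forall y, kf x y = 0) -> x = 0.
Proof.
move=> x0; pose P z := forall y, kf z y = 0.
have Plin : lin_closed P.
  split=> [y|a u v uP vP y]; first exact: killing0l.
  by rewrite (killingDl lie) (killingZl lie) uP vP mulr0 addr0.
have memP z : z \in vspace_of P <-> P z := mem_vspace_of z Plin.
case: simple_g => nab /(_ (vspace_of P)) [|U0|Uf].
- apply/(idealP lie) => u v /memP vP; apply/memP => y.
  by rewrite (brC lie) (killingNl lie) (killing_br lie) vP oppr0.
- by apply/eqP; rewrite -memv0 -U0; apply/memP.
case: killing_neq0 => y; have /memP : y \in vspace_of P by rewrite Uf memvf.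
exact.
Qed.

Lemma weight_dual_killing l x : x \in wsp l -> x != 0 ->
  exists2 y, y \in wsp (- l) & kf x y != 0.
Proof.
move=> xl x0; apply: contrapT => nex; case/eqP: x0; apply: killing_nondegenerate.
apply: (weight_span_full lie cartan_t) => [|m y ym].
  by split=> [|a u v ku kv]; rewrite ?killing0r // (killingDr lie) // (killingZr lie) // ku kv mulr0 addr0.
have [lm0|lm0] := eqVneq (l + m) 0; last exact: killing_weights lm0 xl ym.
apply: contrapT => /eqP k0; apply: nex; exists y => //.
by have /eqP := lm0; rewrite addrC addr_eq0 => /eqP <-.
Qed.

Lemma killing_cartan_nondegenerate d : (forall k, kf (vsval d) (vsval k) = 0) -> d = 0.
Proof.
move=> kd; apply/val_inj/eqP/negPn/negP => d0.
have dt : vsval d \in wsp 0 by rewrite weight_space0 subvsP.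
have [y] := weight_dual_killing dt d0; rewrite oppr0 weight_space0 => yt.
by have := kd (vsproj t y); rewrite vsprojK // => ->; rewrite eqxx.
Qed.

Lemma killing_mapE h k : (killing_map br t h : 'Hom(subvs_of t, F^o)) k =
  kf (vsval h) (vsval k).
Proof.
have lin1 d : linear (fun k : subvs_of t => kf (vsval d) (vsval k) : F^o).
  by move=> a u v; rewrite (killingDr lie) (killingZr lie).
rewrite /killing_map linfunE; first by rewrite linfunE.
move=> a u v; apply/lfunP => e; rewrite add_lfunE scale_lfunE !linfunE //.
by rewrite (killingDl lie) (killingZl lie).
Qed.

Lemma killing_tv l h : kf (vsval (tv l)) (vsval h) = l h.
Proof.
have ker0 : lker (killing_map br t) == 0%VS.
  apply/eqP/vspaceP => d; rewrite memv_ker memv0; apply/eqP/eqP => [d0|->]; last exact: linear0.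
  by apply: killing_cartan_nondegenerate => k; rewrite -killing_mapE d0 zero_lfunE.
have full : limg (killing_map br t) = fullv.
  apply/eqP; rewrite -(geq_leqif (dimv_leqif_eq (subvf _))).
  rewrite limg_dim_eq; last by rewrite (eqP ker0) capv0.
  by rewrite !dimvf /dim /= muln1.
rewrite -killing_mapE /dual_to_cartan limg_lfunVK ?full ?memvf //.
Qed.
End Toral.

(** * The root space decomposition *)

Section RootDecomposition.
Variables (F : numClosedFieldType) (g : vectType F) (br : g -> g -> g).
Hypothesis lie : lie_bracket br.
Hypothesis simple_g : simple_lie br.
Variable t : {vspace g}.
Hypothesis cartan_t : cartan br t.
Implicit Types (x y z : g) (U V W : {vspace g}) (l m n : dual (subvs_of t)).
Implicit Types (h k d : subvs_of t).
Local Notation wsp := (@weight_space F g br t).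
Local Notation wts := (@weights F g br t).
Local Notation wsum := (@weight_sum F g br t).
Local Notation roots := (@Defs.roots F g br t).
Local Notation kf := (killing br).
Local Notation tv := (dual_to_cartan br t).

Lemma common_eigenvector l : wsp l != 0%VS ->
  exists e, [/\ e \in wsp l, e != 0 & forall h, br (vsval h) e = (l h : F) *: e].
Proof.
rewrite eq_sym => l0.
have [||x [xl x0 xh]] := weight_vector_modulo lie cartan_t (l := l) _ _ (sub0v _) l0 (subvv _).
- by move=> h x _; rewrite memv0 => /eqP->; rewrite (br0r lie) // mem0v.
- exact: tstable_wsp.
exists x; split=> //; first by rewrite -memv0.
by move=> h; apply/eqP; rewrite -subr_eq0 -memv0.
Qed.

(** Both sides lie in [t] and have the same Killing product with [t]. *)
Lemma br_eigenvector l e y : e \in wsp l -> (forall h, br (vsval h) e = (l h : F) *: e) ->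
  y \in wsp (- l) -> br e y = kf e y *: vsval (tv l).
Proof.
move=> el eh yl; have := wsp_br lie el yl.
rewrite subrr (weight_space0 lie cartan_t) => eyt.
have eyE : vsval (vsproj t (br e y)) = br e y by rewrite vsprojK.
rewrite -eyE -[_ *: _]/(vsval (kf e y *: tv l)); congr vsval.
apply/eqP; rewrite -subr_eq0; apply/eqP.
apply: (killing_cartan_nondegenerate lie simple_g cartan_t) => k.
rewrite [vsval _]/= eyE (killingBl lie) (killingZl lie).
rewrite (killing_tv lie simple_g cartan_t) (killing_br lie) (brC lie y).
by rewrite (killingNr lie) -(killing_br lie) (brC lie e) (killingNl lie) opprK eh (killingZl lie) mulrC subrr.
Qed.

Lemma weight_neg l : l \in wts -> - l \in wts.
Proof.
have [_ memw] := weightsP lie cartan_t => /memw l0.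
have xl := memv_pick (wsp l); have := vpick0 (wsp l).
rewrite (negPf l0) => /negbT x0.
have [y yl kxy] := weight_dual_killing lie simple_g cartan_t xl x0.
apply: (mem_weights lie cartan_t yl); apply: contraNneq kxy => ->.
by rewrite killing0r.
Qed.

Lemma eigen_pair l : l \in wts -> exists e f, [/\ e \in wsp l, f \in wsp (- l),
  e != 0, forall h, br (vsval h) e = (l h : F) *: e & br e f = vsval (tv l)].
Proof.
have [_ memw] := weightsP lie cartan_t => /memw l0.
have [e [el e0 eh]] := common_eigenvector l0.
have [y yl kxy] := weight_dual_killing lie simple_g cartan_t el e0.
exists e, ((kf e y)^-1 *: y); split=> //; first exact: memvZ.
by rewrite (brZr lie) (br_eigenvector el eh yl) scalerA mulVf ?scale1r.
Qed.

(** If [l] vanishes at its dual vector, then so do all weights by [string_real], and this vector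
is in the radical of the Killing form. *)
Lemma weight_tv_neq0 l : l \in wts -> l != 0 -> (l (tv l) : F) != 0.
Proof.
move=> lw; apply: contra_neq => ltv0.
have [e [f [el fl _ _ ef]]] := eigen_pair lw.
have vanish m : m \in wts -> m (tv l) = 0.
  move=> mw; have [r _ ->] := string_real lie cartan_t el fl (esym ef) mw.
  by rewrite ltv0 mulr0.
apply/lfunP => k; rewrite zero_lfunE -(killing_tv lie simple_g cartan_t).
exact: (cartan_weights_vanish lie cartan_t).
Qed.

(** The span of [e], of the dual vector [tl] of [l], and of the weight spaces of
[-l, -2l, ...] is stable under [e] and [f], hence [ad tl], a commutator, has trace zero on
it. The trace is [l tl (1 - \sum_(k > 0) k dim g_(-k l))]. *)
Lemma dim_weight_opp l : l \in wts -> l != 0 -> \dim (wsp (- l)) = 1.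
Proof.
move=> lw l0; have lt0 := weight_tv_neq0 lw l0.
have [e [f [el fl e0 eh ef]]] := eigen_pair lw.
set tl := tv l in ef lt0; have [us memw] := weightsP lie cartan_t.
pose P n := `[<exists k : nat, n = - (l *+ k.+1)>].
pose s := [seq n <- wts | P n].
have uns : uniq s by rewrite filter_uniq.
have ls : - l \in s.
  by rewrite mem_filter weight_neg // andbT; apply/asboolP; exists 0; rewrite mulr1n.
have mul_l (k : nat) : l *+ k.+1 != 0.
  by rewrite -scaler_nat scaler_eq0 pnatr_eq0 (negPf l0).
have notin_s n (k : nat) : n = l *+ k -> n \notin s.
  move=> ->; apply/negP; rewrite mem_filter => /andP[/asboolP[j /eqP]] + _.
  by rewrite -addr_eq0 -mulrnDr addnS (negPf (mul_l _)).
have in_s n (k : nat) z : n = - (l *+ k.+1) -> z \in wsp n -> z \in wsum s.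
  move=> nE zn; have [->|z0] := eqVneq z 0; first exact: mem0v.
  apply: (subvP (sub_wsum _ _) _ zn).
  by rewrite mem_filter (mem_weights lie cartan_t zn z0) andbT; apply/asboolP; exists k.
have tl0 : vsval tl != 0.
  apply: contraNneq lt0 => tl0; have -> : tl = 0 by apply: val_inj.
  by rewrite linear0.
have [M ME] : exists M, M = (<[e]> + (<[vsval tl]> + wsum s))%VS by eexists.
have eM : e \in M by rewrite ME; apply: (subvP (addvSl _ _)); apply: memv_line.
have sM : (<[vsval tl]> + wsum s <= M)%VS by rewrite ME; apply: addvSr.
have tM : vsval tl \in M.
  by apply: (subvP sM); apply: (subvP (addvSl _ _)); apply: memv_line.
have wM z : z \in wsum s -> z \in M.
  by move=> zs; apply: (subvP sM); apply: (subvP (addvSr _ _)).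
have Mstab (w : g) : br w e \in M -> br w (vsval tl) \in M ->
    (forall n z, n \in s -> z \in wsp n -> br w z \in M) -> forall z, z \in M -> ad br w z \in M.
  move=> we wt wn z; rewrite {1}ME => /memv_addP[_ /vlineP[a ->] [_ /memv_addP[_ /vlineP[b ->] [u us' ->]] ->]].
  rewrite (adE lie) // !(brDr lie) // !(brZr lie) //; apply: rpredD; first exact: memvZ.
  apply: rpredD; first exact: memvZ.
  have [v vw ->] := wsumP uns us'.
  by rewrite (br_sumr lie) // big_seq; apply: rpred_sum => n ns; exact: (wn n _ ns (vw n)).
have Me : forall z, z \in M -> ad br e z \in M.
  apply: Mstab.
  - by rewrite (brxx lie) // mem0v.
  - by rewrite (brC lie) rpredN eh memvZ.
  move=> n z; rewrite mem_filter => /andP[/asboolP[[|k] nE] _] zn.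
    rewrite (br_eigenvector el eh) ?memvZ //.
    by rewrite -[l]mulr1n -nE.
  apply: wM; apply: (in_s (l + n) k); last exact: wsp_br.
  by rewrite nE (mulrS l k.+1) opprD addrA subrr add0r.
have Mf : forall z, z \in M -> ad br f z \in M.
  apply: Mstab.
  - by rewrite (brC lie) ef rpredN.
  - apply: wM; apply: (in_s (- l) 0); first by rewrite mulr1n.
    rewrite (brC lie) rpredN.
    by apply: (tstable_wsp lie cartan_t) => //; apply: subvsP.
  move=> n z; rewrite mem_filter => /andP[/asboolP[k nE] _] zn.
  apply: wM; apply: (in_s (- l + n) k.+1); last exact: wsp_br.
  by rewrite nE (mulrS l k.+1) opprD.
have tr0 : sub_trace M (ad br (vsval tl)) = 0.
  by rewrite -ef (ad_br lie) // sub_traceD -scaleN1r sub_traceZ sub_traceC // mulN1r subrr.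
have wsp0t : vsval tl \in wsp 0 by rewrite (weight_space0 lie cartan_t) subvsP.
have st n z : z \in wsp n -> ad br (vsval tl) z \in wsp n by apply: weight_stable_ad.
have trn n : sub_trace (wsp n) (ad br (vsval tl)) = (n tl : F) * (\dim (wsp n))%:R.
  apply: sub_trace_geneig => z; first exact: st.
  by move/mem_wsp; apply.
have trline c x : x != 0 -> ad br (vsval tl) x = c *: x ->
    sub_trace <[x]> (ad br (vsval tl)) = c.
  move=> x0 xc; rewrite (@sub_trace_geneig _ _ _ _ c) ?dim_vline ?x0 ?mulr1 //.
    by move=> _ /vlineP[a ->]; rewrite linearZ /= xc !memvZ // memv_line.
  move=> _ /vlineP[a ->]; exists 1; rewrite /= shiftE linearZ /= xc !scalerA mulrC.
  by rewrite subrr.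
have cap_t : (<[vsval tl]> :&: wsum s = 0)%VS.
  apply/eqP; rewrite -subv0 -(wsum_cap0 lie cartan_t (l := 0) uns).
    by apply: capvS => //; rewrite -memvE.
  by apply: (notin_s _ 0); rewrite mulr0n.
have cap_e : (<[e]> :&: (<[vsval tl]> + wsum s) = 0)%VS.
  have u0s : uniq (0 :: s) by rewrite /= uns andbT; apply: (notin_s _ 0); rewrite mulr0n.
  apply/eqP; rewrite -subv0 -(wsum_cap0 lie cartan_t (l := l) u0s).
    apply: capvS; first by rewrite -memvE.
    by rewrite [in X in (_ <= X)%VS]/weight_sum big_cons; apply: addvS => //; rewrite -memvE.
  by rewrite inE negb_or l0; apply: (notin_s _ 1); rewrite mulr1n.
have tl_abel : ad br (vsval tl) (vsval tl) = 0 by rewrite (adE lie) // brxx.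
have tle : ad br (vsval tl) e = (l tl : F) *: e by rewrite adE.
have tlstab z : z \in wsum s -> ad br (vsval tl) z \in wsum s.
  move=> /(wsumP uns)[v vw ->]; rewrite linear_sum big_seq; apply: rpred_sum => n ns.
  by apply: (subvP (sub_wsum _ ns)); apply: st.
have line_st c x : ad br (vsval tl) x = c *: x ->
    forall z, z \in <[x]>%VS -> ad br (vsval tl) z \in <[x]>%VS.
  by move=> xc _ /vlineP[a ->]; rewrite linearZ /= xc !memvZ // memv_line.
have tl_st := line_st 0 (vsval tl); rewrite scale0r in tl_st.
have e_st := line_st _ e tle.
have add_st z : z \in (<[vsval tl]> + wsum s)%VS ->
    ad br (vsval tl) z \in (<[vsval tl]> + wsum s)%VS.
  move=> /memv_addP[u ut [v vs ->]]; rewrite linearD memv_add ?tlstab //.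
  exact: tl_st.
have [k kE] : exists k : dual (subvs_of t) -> nat, forall n, n \in s -> n = - (l *+ (k n).+1).
  have /choice[k kE] n : exists k : nat, n \in s -> n = - (l *+ k.+1).
    have [|] := boolP (n \in s); last by exists 0.
    by rewrite mem_filter => /andP[/asboolP[k nE] _]; exists k.
  by exists k.
have sumN : (\sum_(n <- s) (k n).+1 * \dim (wsp n) = 1)%N.
  apply/eqP; rewrite -(eqr_nat F) natr_sum; apply/eqP.
  apply: (mulfI lt0); rewrite mulr1; apply/eqP; rewrite eq_sym -subr_eq0 -[X in _ == X]tr0.
  rewrite ME (sub_trace_add cap_e e_st add_st).
  rewrite (sub_trace_add cap_t (tl_st tl_abel) tlstab).
  rewrite (trline _ _ e0 tle) (trline 0 _ tl0) ?scale0r // add0r.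
  rewrite (sub_trace_wsum lie cartan_t uns) => [|n z _]; last exact: st.
  rewrite mulr_sumr -sumrN; apply/eqP; congr (_ + _).
  rewrite big_seq [RHS]big_seq; apply: eq_bigr => n ns; rewrite trn.
  have -> : (n tl : F) = - ((l tl : F) * (k n).+1%:R).
    by rewrite {1}(kE n ns) opp_lfunE -scaler_nat scale_lfunE mulrC.
  by rewrite natrM mulNr mulrA.
have : ((k (- l)).+1 * \dim (wsp (- l)) <= 1)%N.
  by rewrite -sumN (big_rem (- l)) //= leq_addr.
have : (0 < \dim (wsp (- l)))%N.
  by rewrite lt0n dimv_eq0; have /memw := weight_neg lw.
by case: (\dim _) => [|[|j]].
Qed.

Lemma dim_weight l : l \in wts -> l != 0 -> \dim (wsp l) = 1.
Proof.
move=> lw l0; rewrite -[l]opprK; apply: dim_weight_opp; rewrite ?oppr_eq0 //.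
exact: weight_neg.
Qed.

(** A root space is the line of a common eigenvector; for the zero weight, a bracket of two
elements of [t] is killed by all weights. *)
Lemma weight_eigen l x h : x \in wsp l -> br (vsval h) x = (l h : F) *: x.
Proof.
have [->|x0] := eqVneq x 0; first by rewrite (br0r lie) // scaler0.
move=> xl; have lw := mem_weights lie cartan_t xl x0.
have [l0|l0] := eqVneq l 0.
  rewrite l0 zero_lfunE scale0r; move: xl; rewrite l0 (weight_space0 lie cartan_t) => xt.
  have hx : br (vsval h) x \in t by apply: (cartan_br lie cartan_t) => //; apply: subvsP.
  have dE : vsval (vsproj t (br (vsval h) x)) = br (vsval h) x by rewrite vsprojK.
  rewrite -dE (_ : vsproj _ _ = 0) //.
  apply: (killing_cartan_nondegenerate lie simple_g cartan_t).
  apply: (cartan_weights_vanish lie cartan_t) => m mw.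
  apply: (weight_br0 lie cartan_t (h := h) (k := vsproj t x)); last by rewrite dE vsprojK.
  by have [_ /(_ m)[]] := weightsP lie cartan_t; move=> /(_ mw).
have [_ /(_ l)[/(_ lw) wl0 _]] := weightsP lie cartan_t.
have [e [el e0 eh]] := common_eigenvector wl0.
have : x \in <[e]>%VS.
  suff -> : <[e]>%VS = wsp l by [].
  apply/eqP; rewrite -(geq_leqif (dimv_leqif_eq _)) -?memvE //.
  by rewrite dim_weight // dim_vline e0.
by move=> /vlineP[a ->]; rewrite (brZr lie) // eh !scalerA mulrC.
Qed.

Lemma mem_wspE l x : x \in wsp l <-> root_space br l x.
Proof.
split=> [xl h|xl]; first exact: weight_eigen.
by apply/mem_wsp => h; exists 1; rewrite /= shiftE (adE lie) // xl subrr.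
Qed.

Lemma rootsP l : roots l <-> l != 0 /\ l \in wts.
Proof.
split=> [[/eqP l0 [x /eqP x0 /mem_wspE xl]]|[l0 lw]].
  by split=> //; apply: (mem_weights lie cartan_t xl).
split; first exact/eqP.
have [_ /(_ l)[/(_ lw) wl0 _]] := weightsP lie cartan_t.
have [e [el e0 eh]] := common_eigenvector wl0.
by exists e => //; apply/eqP.
Qed.
End RootDecomposition.

(** * Root strings *)

Section RootStrings.
Variables (F : numClosedFieldType) (g : vectType F) (br : g -> g -> g).
Hypothesis lie : lie_bracket br.
Hypothesis simple_g : simple_lie br.
Variable t : {vspace g}.
Hypothesis cartan_t : cartan br t.
Implicit Types (x y z : g) (a b l m n : dual (subvs_of t)).
Implicit Types (h d : subvs_of t).
Local Notation wsp := (@weight_space F g br t).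
Local Notation wts := (@weights F g br t).
Local Notation kf := (killing br).
Local Notation tv := (dual_to_cartan br t).
Local Notation form := (@root_form F g br t).
Local Notation roots := (@Defs.roots F g br t).
Local Notation cr := (@coroot F g br t).

Lemma root_formE a b : form a b = a (tv b).
Proof. exact: (killing_tv lie simple_g cartan_t). Qed.

Lemma root_formC a b : form a b = form b a.
Proof. exact: killingC. Qed.

Lemma root_formDl a b l : form (a + b) l = form a l + form b l.
Proof. by rewrite !root_formE add_lfunE. Qed.
Lemma root_formNl a l : form (- a) l = - form a l.
Proof. by rewrite !root_formE opp_lfunE. Qed.

Lemma root_weight a : roots a -> a \in wts.
Proof. by move/(rootsP lie simple_g cartan_t) => []. Qed.

Lemma root_neq0 a : roots a -> a != 0.
Proof. by case=> /eqP. Qed.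

Lemma weight_root a : a \in wts -> a != 0 -> roots a.
Proof. by move=> aw a0; apply/(rootsP lie simple_g cartan_t). Qed.

Lemma root_opp a : roots a -> roots (- a).
Proof.
move=> ra; apply: weight_root; last by rewrite oppr_eq0 root_neq0.
by apply: (weight_neg lie simple_g cartan_t); apply: root_weight.
Qed.

Lemma root_form_neq0 a : roots a -> form a a != 0.
Proof.
move=> ra; rewrite root_formE.
by apply: (weight_tv_neq0 lie simple_g cartan_t); [apply: root_weight | apply: root_neq0].
Qed.

Lemma coroot_eval a b : (b (cr a) : F) = 2 * form b a / form a a.
Proof. by rewrite /coroot linearZ /= !root_formE; apply: mulrAC. Qed.

Lemma coroot_self a : roots a -> (a (cr a) : F) = 2.
Proof. by move=> ra; rewrite coroot_eval mulfK //; apply: root_form_neq0. Qed.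

Lemma sl2_triple a f : roots a -> f \in wsp (- a) -> f != 0 ->
  exists2 e, e \in wsp a & br e f = vsval (cr a).
Proof.
move=> ra fa f0; have [e ea kfe] := weight_dual_killing lie simple_g cartan_t fa f0.
rewrite opprK in ea; have eh h := weight_eigen lie simple_g cartan_t h ea.
exists ((2 / form a a / kf e f) *: e); first exact: memvZ.
rewrite (brZl lie) (br_eigenvector lie simple_g cartan_t ea eh fa) scalerA divfK //.
by rewrite killingC.
Qed.

(** Weights are finite in number and the characteristic is zero. *)
Lemma weights_finite_string m a : a != 0 -> exists k : nat, m + a *+ k \notin wts.
Proof.
move=> a0; apply: contrapT => nex.
have allk (k : nat) : m + a *+ k \in wts.
  by apply: contrapT => /negP k0; apply: nex; exists k.
have inj : injective (fun k : nat => m + a *+ k).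
  move=> j k /addrI /eqP; rewrite -subr_eq0 -!scaler_nat -scalerBl scaler_eq0 (negPf a0) orbF.
  by rewrite subr_eq0 eqr_nat => /eqP.
have := @uniq_leq_size _ [seq m + a *+ k | k <- iota 0 (size wts).+1] wts.
rewrite map_inj_uniq // iota_uniq size_map size_iota ltnn => /(_ isT) H.
by suff: false by []; apply: H => x /mapP[k _ ->].
Qed.

Section Triple.
Variables (a : dual (subvs_of t)) (e f : g) (c : subvs_of t).
Hypotheses (a0 : a != 0) (ea : e \in wsp a) (fa : f \in wsp (- a)).
Hypotheses (efc : br e f = vsval c) (ac : (a c : F) = 2).

Lemma lower_weight k m x : x \in wsp m -> iter k (br f) x \in wsp (m - a *+ k).
Proof.
move=> xm; elim: k => [|k IHk]; first by rewrite mulr0n subr0.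
by rewrite iterS mulrS opprD addrCA; apply: wsp_br.
Qed.

Lemma raise_weight k m x : x \in wsp m -> iter k (br e) x \in wsp (m + a *+ k).
Proof.
move=> xm; elim: k => [|k IHk]; first by rewrite mulr0n addr0.
by rewrite iterS mulrS addrCA; apply: wsp_br.
Qed.

Lemma raise_lower m x k : x \in wsp m -> br e x = 0 ->
  br e (iter k.+1 (br f) x) = (k.+1%:R * ((m c : F) - k%:R)) *: iter k (br f) x.
Proof.
move=> xm ex; elim: k => [|k IHk].
  rewrite /= (br_br lie) efc ex (br0r lie) // addr0 subr0 mul1r.
  exact: weight_eigen.
rewrite iterS (br_br lie) efc IHk (brZr lie) -iterS.
rewrite (weight_eigen lie simple_g cartan_t c (lower_weight k.+1 xm)) -scalerDl.
congr (_ *: _); rewrite add_lfunE opp_lfunE -scaler_nat scale_lfunE.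
have -> : (k.+1%:R *: a c : F^o) = k.+1%:R * 2 by rewrite ac.
by rewrite -![in LHS]natr1 -![in RHS]natr1; ring.
Qed.

(** The standard [sl_2] computation: at the last nonzero power of [f], [raise_lower] forces
[m c = N]. *)
Lemma highest_vector m x : x \in wsp m -> x != 0 -> br e x = 0 ->
  exists2 N : nat, (m c : F) = N%:R & forall k, (k <= N)%N -> iter k (br f) x != 0.
Proof.
move=> xm x0 ex.
have exk : exists k, iter k (br f) x == 0.
  have na0 : - a != 0 by rewrite oppr_eq0.
  have [k kw] := weights_finite_string m na0; exists k.
  apply: contraR kw => xk; rewrite mulNrn.
  by apply: (mem_weights lie cartan_t _ xk); apply: lower_weight.
have minK := ex_minnP exk; case: minK => -[|K] /eqP uK minK; first by case/eqP: x0.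
have uK0 k : (k <= K)%N -> iter k (br f) x != 0.
  by move=> kK; apply/negP => /minK; rewrite ltnNge kK.
exists K => //; have := raise_lower K xm ex; rewrite uK (br0r lie) // => /esym/eqP.
rewrite scaler_eq0 (negPf (uK0 _ (leqnn K))) orbF mulf_eq0 pnatr_eq0 /= subr_eq0.
by move/eqP.
Qed.

Lemma raise_top m x : x \in wsp m -> x != 0 ->
  exists2 r, iter r (br e) x != 0 & br e (iter r (br e) x) = 0.
Proof.
move=> xm x0; have [k kw] := weights_finite_string m a0.
have : iter k (br e) x = 0.
  apply/eqP; apply: contraR kw => xk.
  by apply: (mem_weights lie cartan_t _ xk); apply: raise_weight.
elim: k {kw} => [|k IHk]; first by move=> /eqP; rewrite (negPf x0).
have [/IHk //|xk xk1] := eqVneq (iter k (br e) x) 0.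
by exists k.
Qed.

(** Apply [highest_vector] to the top of the string through [x]. *)
Lemma string_weight m x : x \in wsp m -> x != 0 ->
  exists2 r : nat, exists N : nat, (m c : F) + (2 * r)%:R = N%:R &
    forall N k : nat, (m c : F) + (2 * r)%:R = N%:R -> (k <= N)%N -> m + a *+ r - a *+ k \in wts.
Proof.
move=> xm x0; have [r xr exr] := raise_top xm x0.
have xrm := raise_weight r xm.
have [N NE Nk] := highest_vector xrm xr exr.
have mE : (m c : F) + (2 * r)%:R = N%:R.
  by rewrite -NE add_lfunE -scaler_nat scale_lfunE ac natrM mulrC.
exists r; first by exists N.
move=> N' k; rewrite mE => /eqP; rewrite eqr_nat => /eqP <- kN.
by apply: (mem_weights lie cartan_t _ (Nk k kN)); apply: lower_weight.
Qed.
End Triple.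

Lemma root_triple a : roots a ->
  exists e f, [/\ e \in wsp a, f \in wsp (- a) & br e f = vsval (cr a)].
Proof.
move=> ra; have [_ memw] := weightsP lie cartan_t.
have /memw n0 := root_weight (root_opp ra).
have v0 : vpick (wsp (- a)) != 0 by rewrite vpick0.
have [e ea ef] := sl2_triple ra (memv_pick _) v0.
by exists e, (vpick (wsp (- a))); split=> //; apply: memv_pick.
Qed.

Lemma weight_vectorP m : m \in wts -> exists2 x, x \in wsp m & x != 0.
Proof.
have [_ memw] := weightsP lie cartan_t; move=> /memw m0.
by exists (vpick (wsp m)); rewrite ?memv_pick ?vpick0.
Qed.

Lemma coroot_int a m : roots a -> m \in wts -> exists z : int, (m (cr a) : F) = z%:~R.
Proof.
move=> ra mw; have [e [f [ea fa ef]]] := root_triple ra.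
have [x xm x0] := weight_vectorP mw.
have [r [N NE] _] := string_weight (root_neq0 ra) ea fa ef (coroot_self ra) xm x0.
by exists (N%:Z - (2 * r)%:Z); rewrite rmorphB /= -!pmulrn -NE addrK.
Qed.

Lemma root_string a m (p k : nat) : roots a -> m \in wts -> (m (cr a) : F) = p%:R ->
  (k <= p)%N -> m - a *+ k \in wts.
Proof.
move=> ra mw mp kp; have [e [f [ea fa ef]]] := root_triple ra.
have [x xm x0] := weight_vectorP mw.
have [r _ st] := string_weight (root_neq0 ra) ea fa ef (coroot_self ra) xm x0.
have := st (p + 2 * r)%N (r + k)%N; rewrite mp natrD => /(_ erefl).
rewrite mulrnDr opprD addrA addrK; apply.
by rewrite mul2n -addnn addnA addnC leq_add2r (leq_trans kp) ?leq_addr.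
Qed.

(** The coroot takes integral values on the weights, so its Killing square, which is
[4 / (a, a)], is a sum of squares of integers. *)
Lemma root_form_gt0 a : roots a -> 0 < form a a.
Proof.
move=> ra; have a0 := root_form_neq0 ra.
have c4 : kf (vsval (cr a)) (vsval (cr a)) = 4 / form a a.
  rewrite [vsval (cr a)]/= (killingZl lie) (killingZr lie) -/(form a a).
  by rewrite divfK // mulrAC -natrM.
have : 0 <= kf (vsval (cr a)) (vsval (cr a)).
  rewrite (killing_cartan_sq lie cartan_t) big_seq; apply: sumr_ge0 => l lw.
  have [z ->] := coroot_int ra lw.
  by rewrite mulr_ge0 ?ler0n // real_exprn_even_ge0 // realz.
by rewrite c4 pmulr_rge0 ?ltr0n // invr_ge0 le_eqVlt eq_sym (negPf a0).
Qed.

Lemma root_form_coroot a b : roots a -> form b a = (b (cr a) : F) * form a a / 2.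
Proof.
move=> ra; rewrite coroot_eval divfK ?root_form_neq0 //.
by rewrite mulrAC mulfV ?mul1r // pnatr_eq0.
Qed.

Lemma root_form_real a b : roots a -> roots b -> form a b \is Num.real.
Proof.
move=> ra rb; rewrite (root_form_coroot _ rb) rpredM ?rpredV ?realn //.
have [z ->] := coroot_int rb (root_weight ra).
by rewrite rpredM ?realz // gtr0_real // root_form_gt0.
Qed.

Lemma coroot_nat a m : roots a -> m \in wts -> 0 < form m a ->
  exists p : nat, (m (cr a) : F) = p.+1%:R.
Proof.
move=> ra mw ma; have : 0 < (m (cr a) : F).
  by rewrite coroot_eval divr_gt0 ?root_form_gt0 // pmulr_rgt0 ?ltr0n.
have [[[|p]|p] ->] := coroot_int ra mw.
- by rewrite ltxx.
- by move=> _; exists p.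
- by rewrite ltr0z.
Qed.

Lemma root_sub a b : roots a -> roots b -> 0 < form a b -> a <> b -> roots (a - b).
Proof.
move=> ra rb ab nab; apply: weight_root; last by rewrite subr_eq0; apply/eqP.
have [p pE] := coroot_nat rb (root_weight ra) ab.
by rewrite -[b]mulr1n; apply: (root_string rb (root_weight ra) pE).
Qed.

Lemma root_add_orthogonal a b : roots a -> roots b -> roots (a + b) -> form a b = 0 ->
  roots (a - b).
Proof.
move=> ra rb rab ab; apply: weight_root.
  have -> : a - b = (a + b) - b *+ 2 by rewrite mulr2n opprD addrA addrK.
  apply: (root_string (p := 2) rb (root_weight rab)) => //.
  by rewrite coroot_eval root_formDl ab add0r mulfK // root_form_neq0.
rewrite subr_eq0; apply: contra_eq_neq ab => ->.
exact: root_form_neq0.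
Qed.

(** If [f] kills [x], then [x] is a lowest weight vector and [m] is nonpositive at the coroot
of [a]. *)
Lemma root_bracket_neq0 a m f x : roots a -> f \in wsp (- a) -> f != 0 ->
  x \in wsp m -> x != 0 -> 0 < form m a -> br f x != 0.
Proof.
move=> ra fa f0 xm x0 ma; have [e ea ef] := sl2_triple ra fa f0.
apply/negP => /eqP fx; have mw := mem_weights lie cartan_t xm x0.
have na0 : - a != 0 by rewrite oppr_eq0 root_neq0.
have ea' : e \in wsp (- - a) by rewrite opprK.
have fe : br f e = vsval (- cr a) by rewrite (brC lie) ef.
have ac : ((- a) (- cr a) : F) = 2 by rewrite opp_lfunE linearN /= opprK coroot_self.
have [N NE _] := highest_vector na0 ea' fe ac xm x0 fx.
have [p pE] := coroot_nat ra mw ma.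
have : (0 : F) <= m (- cr a) by rewrite NE ler0n.
have -> : (m (- cr a) : F) = - (m (cr a) : F) by rewrite linearN.
by rewrite pE oppr_ge0 lern0.
Qed.
End RootStrings.

(** * Cones in a root system and the highest root *)

Section ConesAndHighestRoots.
Variables (F : numDomainType) (V : zmodType) (form : V -> V -> F).
Implicit Types (Delta P Q : V -> Prop) (a b c x y : V) (s r : seq V).

(** The properties of a set of roots on which the combinatorics relies. They are weaker than
those of a root system and pass to the subsystems met in the cascade. *)
Record root_system_like Delta : Prop := RootSystemLike {
  rs_sym : forall a b, form a b = form b a;
  rs_add : forall a b c, form (a + b) c = form a c + form b c;
  rs_fin : exists s : seq V, forall a, Delta a -> a \in s;
  rs_real : forall a b, Delta a -> Delta b -> form a b \is Num.real;
  rs_pos : forall a, Delta a -> 0 < form a a;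
  rs_opp : forall a, Delta a -> Delta (- a);
  rs_sub : forall a b, Delta a -> Delta b -> 0 < form a b -> a <> b -> Delta (a - b);
  rs_ortho : forall a b, Delta a -> Delta b -> Delta (a + b) -> form a b = 0 ->
    Delta (a - b) }.

Record half_closed Delta P : Prop := HalfClosed {
  half_sub : forall a, P a -> Delta a;
  half_add : forall a b, P a -> P b -> Delta (a + b) -> form a b < 0 -> P (a + b);
  half_opp : forall a, P a -> ~ P (- a) }.

Definition positive_system Delta P :=
  half_closed Delta P /\ forall a, Delta a -> P a \/ P (- a).

(** The relation [cone P (y - x)] is the order defined by [P]. *)
Definition cone P x := exists s, (forall y, y \in s -> P y) /\ x = \sum_(y <- s) y.

Definition simple_in P a := P a /\ ~ exists b c, [/\ P b, P c & a = b + c].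

Definition maximal_in Delta P a := P a /\ forall b, P b -> ~ Delta (a + b).

Lemma cone0 P : cone P 0.
Proof. by exists [::]; rewrite big_nil. Qed.

Lemma cone1 P a : P a -> cone P a.
Proof. by exists [:: a]; rewrite big_seq1; split=> // y; rewrite inE => /eqP->. Qed.

Lemma coneD P x y : cone P x -> cone P y -> cone P (x + y).
Proof.
move=> [s [sP ->]] [r [rP ->]]; exists (s ++ r); rewrite big_cat; split=> // z.
by rewrite mem_cat => /orP[/sP|/rP].
Qed.

Lemma count_lt (p q : pred V) s x : subpred p q -> x \in s ->
  q x -> ~~ p x -> (count p s < count q s)%N.
Proof.
move=> pq; elim: s => //= y s IHs; rewrite inE => /orP[/eqP <- qx px|xs qx px].
  by rewrite qx (negPf px) add0n add1n ltnS; apply: sub_count.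
by rewrite -addnS leq_add ?IHs //; case: (boolP (p y)) => // /pq ->.
Qed.

Lemma real_sum_lt0 s (f : V -> F) :
  (forall x, x \in s -> f x \is Num.real) -> \sum_(x <- s) f x < 0 ->
  exists2 x, x \in s & f x < 0.
Proof.
move=> rf sf; apply: contrapT => nex; suff : 0 <= \sum_(x <- s) f x.
  by move=> /(lt_le_trans sf); rewrite ltxx.
rewrite big_seq; apply: sumr_ge0 => x xs.
rewrite real_leNgt ?real0 ?rf //; apply/negP => fx; apply: nex.
by exists x.
Qed.

Lemma real_sum_gt0 s (f : V -> F) :
  (forall x, x \in s -> f x \is Num.real) -> 0 < \sum_(x <- s) f x ->
  exists2 x, x \in s & 0 < f x.
Proof.
move=> rf sf; have [||x xs fx] := @real_sum_lt0 s (fun x => - f x).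
- by move=> x xs; rewrite rpredN rf.
- by rewrite sumrN oppr_lt0.
by exists x; rewrite // -oppr_lt0.
Qed.

Section RootSystem.
Variables (Delta : V -> Prop).
Hypothesis RS : root_system_like Delta.

Lemma form_addr a b c : form a (b + c) = form a b + form a c.
Proof. by rewrite !(rs_sym RS a) (rs_add RS). Qed.
Lemma form_0l a : form 0 a = 0.
Proof. by apply: (addrI (form 0 a)); rewrite -(rs_add RS) !addr0. Qed.
Lemma form_oppl a b : form (- a) b = - form a b.
Proof. by apply/eqP; rewrite -addr_eq0 -(rs_add RS) addNr form_0l. Qed.
Lemma form_oppr a b : form a (- b) = - form a b.
Proof. by rewrite !(rs_sym RS a) form_oppl. Qed.
Lemma form_subl a b c : form (a - b) c = form a c - form b c.
Proof. by rewrite (rs_add RS) form_oppl. Qed.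
Lemma form_suml s c : form (\sum_(y <- s) y) c = \sum_(y <- s) form y c.
Proof.
by elim: s => [|y s IHs]; rewrite ?big_nil ?form_0l // !big_cons (rs_add RS) IHs.
Qed.
Lemma root_nz a : Delta a -> a != 0.
Proof. by move=> /(rs_pos RS); apply: contraTneq => ->; rewrite form_0l ltxx. Qed.

Lemma root_add a b : Delta a -> Delta b -> form a b < 0 -> a <> - b -> Delta (a + b).
Proof.
move=> da db ab nab; rewrite -[b]opprK; apply: (rs_sub RS) => //.
  exact: (rs_opp RS).
by rewrite form_oppr oppr_gt0.
Qed.

Lemma cone_ortho P x c : (forall a, P a -> form a c = 0) -> cone P x -> form x c = 0.
Proof.
move=> Pc [s [sP ->]]; rewrite form_suml big_seq big1 // => y /sP; exact: Pc.
Qed.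

(** In a vanishing sum, some term has negative product with the first one, and the two can be
replaced by their sum, which is again in [P]. *)
Lemma no_vanishing_sum P s : half_closed Delta P -> (forall x, x \in s -> P x) ->
  \sum_(x <- s) x = 0 -> s = [::].
Proof.
move=> [Pd Padd Popp]; have [n] := ubnP (size s); elim: n s => // n IHn [//|a s] ns sP s0.
have Pa : P a by apply: sP; rewrite inE eqxx.
have sP' x : x \in s -> P x by move=> xs; apply: sP; rewrite inE xs orbT.
have [b bs ab] : exists2 b, b \in s & form b a < 0.
  apply: real_sum_lt0 => [x /sP' Px|]; first by apply: (rs_real RS); apply: Pd.
  move: s0; rewrite -form_suml big_cons => /eqP; rewrite addrC addr_eq0 => /eqP ->.
  by rewrite form_oppl oppr_lt0 (rs_pos RS) //; apply: Pd.
have Pb := sP' b bs.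
have nab : a <> - b by move=> E; apply: (Popp b) => //; rewrite -E.
have ab' : form a b < 0 by rewrite (rs_sym RS).
have Pab : P (a + b) by apply: Padd => //; apply: root_add => //; apply: Pd.
have : (a + b) :: rem b s = [::].
  apply: IHn; first by rewrite /= size_rem //; case: (s) bs ns.
    move=> x; rewrite inE => /orP[/eqP-> //|/mem_rem]; exact: sP'.
  have sE : \sum_(x <- s) x = b + \sum_(x <- rem b s) x by rewrite (big_rem b).
  by rewrite big_cons -addrA -sE -[RHS]s0 big_cons.
by [].
Qed.

Lemma cone_antisym P x : half_closed Delta P -> cone P x -> cone P (- x) -> x = 0.
Proof.
move=> hP [s [sP xs]] [r [rP xr]].
have : s ++ r = [::].
  apply: (no_vanishing_sum hP) => [y|]; last by rewrite big_cat -xs -xr /= subrr.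
  by rewrite mem_cat => /orP[/sP|/rP].
by case: s xs {sP} => // -> _; rewrite big_nil.
Qed.

Definition roots_seq : seq V := xget [::] [set s : seq V | forall a, Delta a -> a \in s]%classic.

Lemma mem_roots_seq a : Delta a -> a \in roots_seq.
Proof. by move: a; apply: (xgetPex [::] (rs_fin RS)). Qed.

Definition above P x := count (fun d => `[<cone P (d - x)>]) roots_seq.
Definition below P x := count (fun d => `[<cone P (x - d)>]) roots_seq.

(** Together with [below_lt], this allows induction along the order defined by [P]. *)
Lemma above_lt P x c : half_closed Delta P -> Delta x -> cone P c -> c != 0 ->
  (above P (x + c) < above P x)%N.
Proof.
move=> hP dx Pc c0; apply: (@count_lt _ _ _ x).
- move=> d /asboolP dc; apply/asboolP; have := coneD dc Pc.
  by rewrite opprD addrA subrK.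
- exact: mem_roots_seq.
- by apply/asboolP; rewrite subrr; apply: cone0.
apply/negP => /asboolP; rewrite opprD addrA subrr add0r => nc.
by case/eqP: c0; apply: cone_antisym hP Pc nc.
Qed.

Lemma below_lt P x c : half_closed Delta P -> Delta x -> cone P c -> c != 0 ->
  (below P (x - c) < below P x)%N.
Proof.
move=> hP dx Pc c0; apply: (@count_lt _ _ _ x).
- move=> d /asboolP dc; apply/asboolP; have := coneD dc Pc.
  by rewrite addrAC subrK.
- exact: mem_roots_seq.
- by apply/asboolP; rewrite subrr; apply: cone0.
apply/negP => /asboolP; rewrite addrAC subrr add0r => nc.
by case/eqP: c0; apply: cone_antisym hP Pc nc.
Qed.

Section Positive.
Variable P : V -> Prop.
Hypothesis posP : positive_system Delta P.
Let hP : half_closed Delta P. Proof. by case: posP. Qed.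
Let Pd a : P a -> Delta a. Proof. exact: (half_sub hP). Qed.

Lemma pos_nz a : P a -> a != 0.
Proof. by move/Pd/root_nz. Qed.

Lemma pos_of_cone a : Delta a -> cone P a -> P a.
Proof.
case: posP => _ tot da ca; have [//|na] := tot a da.
by have := pos_nz na; rewrite oppr_eq0 (cone_antisym hP ca (cone1 na)) eqxx.
Qed.

Lemma pos_add a b : P a -> P b -> Delta (a + b) -> P (a + b).
Proof. by move=> Pa Pb dab; apply: pos_of_cone => //; apply: coneD; apply: cone1. Qed.

Lemma cone_simple a : P a -> cone (simple_in P) a.
Proof.
have [n] := ubnP (below P a); elim: n a => // n IHn a an Pa.
have [sa|] := pselect (simple_in P a); first exact: cone1.
move=> /not_andP[//|/contrapT[b [c [Pb Pc aE]]]].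
rewrite aE; apply: coneD; apply: IHn => //.
- have -> : b = a - c by rewrite aE addrK.
  by apply: leq_trans (below_lt hP (Pd Pa) (cone1 Pc) (pos_nz Pc)) _.
- have -> : c = a - b by rewrite aE addrC addKr.
  by apply: leq_trans (below_lt hP (Pd Pa) (cone1 Pb) (pos_nz Pb)) _.
Qed.

Lemma simple_form_le0 a b : simple_in P a -> simple_in P b -> a <> b -> form a b <= 0.
Proof.
move=> [Pa sa] [Pb sb] nab; rewrite real_leNgt ?real0 //; last by apply: (rs_real RS); apply: Pd.
apply/negP => ab; case: posP => _ /(_ (a - b)); case.
- by apply: (rs_sub RS) => //; apply: Pd.
- by move=> Pab; apply: sa; exists (a - b), b; rewrite subrK.
- by rewrite opprB => Pab; apply: sb; exists (b - a), a; rewrite subrK.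
Qed.

Lemma maximal_form_ge0 a b : maximal_in Delta P a -> P b -> 0 <= form a b.
Proof.
move=> [Pa ma] Pb; rewrite real_leNgt ?real0 //; last by apply: (rs_real RS); apply: Pd.
apply/negP => ab; apply: (ma b Pb); apply: root_add => //; try exact: Pd.
by move=> E; apply: (half_opp hP Pb); rewrite -E.
Qed.

(** A positive root is a sum of simple roots; remove one, [b], with which it has positive
product. If [a - b] were a sum of elements of [X] and [b] in [Y], then [a - b] would be
orthogonal to [b], so [a - 2b] would be a root. The induction hypothesis excludes that it is
positive, and the simplicity of [b] that it is negative. *)
Lemma simple_split X Y : (forall a, simple_in P a -> X a \/ Y a) ->
  (forall a, X a -> simple_in P a) -> (forall a, Y a -> simple_in P a) ->
  (forall a b, X a -> Y b -> form a b = 0) ->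
  forall a, P a -> cone X a \/ cone Y a.
Proof.
move=> XY Xs Ys oXY a; have [n] := ubnP (below P a); elim: n a => // n IHn a an Pa.
have [sa|nsa] := pselect (simple_in P a).
  by case: (XY a sa) => ?; [left | right]; apply: cone1.
have [s [sS aE]] := cone_simple Pa.
have [b bs ab] : exists2 b, b \in s & 0 < form b a.
  apply: real_sum_gt0 => [x /sS[Px _]|]; first by apply: (rs_real RS); apply: Pd.
  by rewrite -form_suml -aE (rs_pos RS) //; apply: Pd.
have sb := sS b bs; have [Pb nb] := sb.
have dab : Delta (a - b).
  apply: (rs_sub RS); rewrite ?(rs_sym RS a) //; try exact: Pd.
  by move=> E; apply: nsa; rewrite E.
have Pab : P (a - b).
  case: posP => _ /(_ _ dab)[//|]; rewrite opprB => Pba; case: nb.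
  by exists (b - a), a; rewrite subrK.
have lt1 : (below P (a - b) < below P a)%N.
  exact: below_lt hP (Pd Pa) (cone1 Pb) (pos_nz Pb).
have lt2 : (below P (a - b - b) < below P (a - b))%N.
  exact: below_lt hP (Pd Pab) (cone1 Pb) (pos_nz Pb).
have n1 : (below P (a - b) < n)%N by apply: leq_trans lt1 _.
have n2 : (below P (a - b - b) < n)%N by apply: ltn_trans lt2 n1.
have key X' Y' : (forall c d, X' c -> Y' d -> form c d = 0) ->
    (P (a - b - b) -> cone X' (a - b - b) \/ cone Y' (a - b - b)) ->
    cone X' (a - b) -> ~ Y' b.
  move=> o IH cX Yb.
  have o0 : form (a - b) b = 0 by apply: cone_ortho cX => c Xc; apply: o.
  have d2 : Delta (a - b - b).
    by apply: (rs_ortho RS) => //; [apply: Pd | rewrite subrK; apply: Pd].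
  case: posP => _ /(_ _ d2)[P2|].
    have [cX2|cY2] := IH P2.
      have : form (a - b - b) b = 0 by apply: cone_ortho cX2 => c Xc; apply: o.
      rewrite form_subl o0 add0r => /eqP; rewrite oppr_eq0.
      by rewrite gt_eqF // (rs_pos RS) //; apply: Pd.
    have cY : cone Y' (a - b) by rewrite -[a - b](subrK b); apply: coneD cY2 (cone1 Yb).
    have : form (a - b) (a - b) = 0.
      apply: cone_ortho cX => c Xc; rewrite (rs_sym RS).
      by apply: cone_ortho cY => d Yd; rewrite (rs_sym RS); apply: o.
    by move/eqP; rewrite gt_eqF // (rs_pos RS).
  rewrite opprB => Pb2; apply: nb; exists (b - (a - b)), (a - b).
  by rewrite subrK.
have oYX c d : Y c -> X d -> form c d = 0 by move=> Yc Xd; rewrite (rs_sym RS); apply: oXY.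
have IH2 : P (a - b - b) -> cone X (a - b - b) \/ cone Y (a - b - b) by apply: IHn.
have IH2' : P (a - b - b) -> cone Y (a - b - b) \/ cone X (a - b - b).
  by move=> /IH2[]; [right | left].
rewrite -[a](subrK b); have [cX|cY] := IHn _ n1 Pab.
  left; apply: coneD => //; apply: cone1.
  by case: (XY b sb) => // Yb; case: (key X Y oXY IH2 cX Yb).
right; apply: coneD => //; apply: cone1.
by case: (XY b sb) => // Xb; case: (key Y X oYX IH2' cY Xb).
Qed.

Definition irreducible_in :=
  (exists a, Delta a) /\
  forall A : V -> Prop, (forall a, A a -> Delta a) ->
    (forall a b, A a -> Delta b -> ~ A b -> form a b = 0) ->
    (forall a, ~ A a) \/ (forall a, Delta a -> A a).

(** If a simple root does not occur in a maximal root, it is orthogonal to those that occur;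
by [simple_split] the two kinds of simple roots then split the root system. *)
Lemma maximal_support a s : irreducible_in -> maximal_in Delta P a ->
  (forall b, b \in s -> simple_in P b) -> a = \sum_(b <- s) b ->
  forall b, simple_in P b -> b \in s.
Proof.
move=> [_ irr] ma sS aE; have [Pa _] := ma.
pose X b := simple_in P b /\ b \in s; pose Y b := simple_in P b /\ b \notin s.
have oXY b c : X b -> Y c -> form b c = 0.
  move=> [sb bs] [sc cs].
  have le0 d : d \in s -> form d c <= 0.
    by move=> ds; apply: simple_form_le0 => //; [apply: sS | move=> E; rewrite -E ds in cs].
  have : \sum_(d <- s | d \in s) - form d c == 0.
    rewrite -big_seq sumrN -form_suml -aE oppr_eq0 eq_le; apply/andP; split.
      by rewrite aE form_suml big_seq; apply: sumr_le0.
    by apply: maximal_form_ge0 => //; case: sc.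
  rewrite psumr_eq0 => [/allP/(_ b bs)|d ds]; last by rewrite oppr_ge0 le0.
  by rewrite bs oppr_eq0 => /eqP.
have split_ := @simple_split X Y _ _ _ oXY.
have {}split_ b : P b -> cone X b \/ cone Y b.
  apply: split_ => [c sc|c []|c []] //.
  by have [cs|cs] := boolP (c \in s); [left | right].
pose A b := Delta b /\ (cone X b \/ cone X (- b)).
have oc b c : cone X b -> cone Y c -> form b c = 0.
  move=> cb cc; apply: cone_ortho cb => d Xd; rewrite (rs_sym RS).
  by apply: cone_ortho cc => e Ye; rewrite (rs_sym RS); apply: oXY.
case: (irr A) => [b []//|b c|noA|allA].
- move=> [db cb] dc nc.
  have cY : cone Y c \/ cone Y (- c).
    case: posP => _ /(_ c dc)[] /split_[cc|cc]; try (by left); try (by right).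
      by case: nc; split=> //; left.
    by case: nc; split=> //; right.
  case: cb => cb; case: cY => cc; have := oc _ _ cb cc;
    by rewrite ?form_oppl ?form_oppr ?opprK // => /eqP; rewrite oppr_eq0 => /eqP.
- case: (noA a); split; first exact: Pd.
  by left; exists s; split=> // b bs; split=> //; apply: sS.
move=> b sb; apply: contrapT => /negP bs; have [Pb _] := sb.
have Yb : Y b by [].
have [_ [cb|cb]] := allA b (Pd Pb); have := oc _ _ cb (cone1 Yb).
  by move/eqP; rewrite gt_eqF // (rs_pos RS) //; apply: Pd.
by rewrite form_oppl => /eqP; rewrite oppr_eq0 gt_eqF // (rs_pos RS) //; apply: Pd.
Qed.

(** By [maximal_support], two maximal roots have positive product; if distinct, their
difference is a root, and one of them is not maximal. *)
Lemma maximal_unique a b : irreducible_in -> maximal_in Delta P a ->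
  maximal_in Delta P b -> a = b.
Proof.
move=> irr ma mb; have [Pa ma'] := ma; have [Pb mb'] := mb.
have [s [sS aE]] := cone_simple Pa.
have supp := maximal_support irr ma sS aE.
have ge0 c : c \in s -> 0 <= form c b.
  by move=> /sS[Pc _]; rewrite (rs_sym RS); apply: maximal_form_ge0.
have ab0 : 0 < form a b.
  rewrite lt_def aE form_suml; apply/andP; split; last by rewrite big_seq; apply: sumr_ge0.
  rewrite big_seq psumr_eq0 //; apply/negP => /allP all0.
  have : form b b = 0.
    apply: cone_ortho (cone_simple Pb) => c /supp cs.
    by have := all0 c cs; rewrite cs => /eqP.
  by move/eqP; rewrite gt_eqF // (rs_pos RS) //; apply: Pd.
apply: contrapT => nab; have dab : Delta (a - b) by apply: (rs_sub RS) => //; apply: Pd.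
case: posP => _ /(_ _ dab)[Pab|].
  by apply: (mb' _ Pab); rewrite addrC subrK; apply: Pd.
by rewrite opprB => Pba; apply: (ma' _ Pba); rewrite addrC subrK; apply: Pd.
Qed.

Lemma maximal_above a : P a -> exists2 b, maximal_in Delta P b & cone P (b - a).
Proof.
have [n] := ubnP (above P a); elim: n a => // n IHn a an Pa.
have [ma|] := pselect (maximal_in Delta P a).
  by exists a => //; rewrite subrr; apply: cone0.
move=> /not_andP[//|/existsNP[c /not_implyP[Pc /contrapT dac]]].
have Pac := pos_add Pa Pc dac.
have [|//|b mb cb] := IHn (a + c).
  by apply: leq_trans (above_lt hP (Pd Pa) (cone1 Pc) (pos_nz Pc)) _.
exists b => //; have := coneD cb (cone1 Pc).
by rewrite opprD addrA subrK.
Qed.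

Lemma highest_exists : irreducible_in ->
  exists2 a, P a & forall b, Delta b -> cone P (a - b).
Proof.
move=> irr; have [[c dc] _] := irr.
have [c' Pc'] : exists c', P c' by case: posP => _ /(_ c dc)[]; eexists; eassumption.
have [a ma _] := maximal_above Pc'; have [Pa _] := ma.
exists a => // b db; case: posP => _ /(_ b db)[Pb|Pb]; last exact: coneD (cone1 Pa) (cone1 Pb).
have [a' ma' ca'] := maximal_above Pb.
by rewrite (maximal_unique irr ma ma').
Qed.
End Positive.

(** If adjoining either [a] or [-a] creates a vanishing sum, then some multiple of [-a] and some
multiple of [a] are sums of elements of [P], which gives a vanishing sum in [P]. *)
Lemma half_closed_extend P a : half_closed Delta P -> Delta a -> ~ P a -> ~ P (- a) ->
  exists2 b, (b = a \/ b = - a) & forall s,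
    (forall x, x \in s -> P x \/ x = b) -> \sum_(x <- s) x = 0 -> s = [::].
Proof.
move=> hP da nPa nPa'.
have key b : ~ (forall s, (forall x, x \in s -> P x \/ x = b) -> \sum_(x <- s) x = 0 ->
   s = [::]) -> exists2 n : nat, (0 < n)%N & cone P (- (b *+ n)).
  move=> nb; apply: contrapT => nex; apply: nb => s.
  move=> sP s0.
  have split_ r : (forall x, x \in r -> P x \/ x = b) ->
      exists n q, [/\ (forall x, x \in q -> P x), \sum_(x <- r) x = b *+ n + \sum_(x <- q) x
       & size r = (n + size q)%N].
    elim: r => [|x r IHr] rP; first by exists 0, [::]; rewrite !big_nil addr0.
    have [y yr|n [q [qP rE sz]]] := IHr; first by apply: rP; rewrite inE yr orbT.
    have [Px|->] : P x \/ x = b by apply: rP; rewrite inE eqxx.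
      exists n, (x :: q); rewrite !big_cons rE addrCA /= sz addnS; split=> //.
      by move=> y; rewrite inE => /orP[/eqP->|/qP].
    by exists n.+1, q; rewrite big_cons rE mulrS addrA /= sz; split.
  have [n [q [qP sE sz]]] := split_ s sP.
  case: n sE sz => [|n] sE sz.
    apply/eqP; rewrite -size_eq0 sz; rewrite s0 mulr0n add0r in sE.
    by rewrite (no_vanishing_sum hP qP (esym sE)).
  case: nex; exists n.+1 => //; exists q; split=> //.
  by apply/eqP; rewrite eq_sym -addr_eq0 addrC -sE s0.
apply: contrapT => nex.
have [|n n0 cn] := key a; first by move=> H; apply: nex; exists a => //; left.
have [|m m0 cm] := key (- a); first by move=> H; apply: nex; exists (- a) => //; right.
rewrite mulNrn opprK in cm.
have coneM x k : cone P x -> cone P (x *+ k).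
  by move=> cx; elim: k => [|k IHk]; [apply: cone0 | rewrite mulrS; apply: coneD].
have c1 : cone P (a *+ (m * n)) by rewrite mulrnA; apply: coneM.
have c2 : cone P (- (a *+ (m * n))) by rewrite mulnC mulrnA -mulNrn; apply: coneM.
have := cone_antisym hP c1 c2.
move=> amn; have : form (a *+ (m * n)) a = 0 by rewrite amn form_0l.
have -> k : form (a *+ k) a = form a a *+ k.
  by elim: k => [|k IHk]; rewrite ?form_0l // !mulrS (rs_add RS) IHk.
have /gt_eqF faa := rs_pos RS da.
by move/eqP; rewrite mulrn_eq0 faa orbF muln_eq0 (gtn_eqF m0) (gtn_eqF n0).
Qed.

End RootSystem.
End ConesAndHighestRoots.

(** * Borel subalgebras and positive systems *)

Section BorelRoots.
Variables (F : numClosedFieldType) (g : vectType F) (br : g -> g -> g).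
Hypothesis lie : lie_bracket br.
Hypothesis simple_g : simple_lie br.
Variable t : {vspace g}.
Hypothesis cartan_t : cartan br t.
Implicit Types (x y z : g) (a c l m n : dual (subvs_of t)).
Implicit Types (h d : subvs_of t).
Local Notation wsp := (@weight_space F g br t).
Local Notation wts := (@weights F g br t).
Local Notation wsum := (@weight_sum F g br t).
Local Notation form := (@root_form F g br t).
Local Notation roots := (@Defs.roots F g br t).
Local Notation cr := (@coroot F g br t).

Lemma roots_like : root_system_like form roots.
Proof.
split.
- exact: root_formC.
- exact: root_formDl.
- by exists wts => a; apply: root_weight.
- exact: root_form_real.
- exact: root_form_gt0.
- exact: root_opp.
- exact: root_sub.
- exact: root_add_orthogonal.
Qed.

Lemma wsum_span s (P : g -> Prop) : uniq s -> lin_closed P ->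
  (forall l x, l \in s -> x \in wsp l -> P x) -> forall x, x \in wsum s -> P x.
Proof.
move=> us Plin Pw x /(wsumP us)[y yw ->]; rewrite big_seq.
apply: lin_closed_sum => // l ls.
exact: Pw (yw l).
Qed.

Lemma sub_wsum_weights l s : (l \in wts -> l \in s) -> (wsp l <= wsum s)%VS.
Proof.
move=> ls; apply/subvP => x xl; have [->|x0] := eqVneq x 0; first exact: mem0v.
apply: (subvP (sub_wsum _ _) _ xl); apply: ls.
exact: (mem_weights lie cartan_t xl x0).
Qed.

Lemma lin_closed_brl (U : {vspace g}) y : lin_closed (fun x => br x y \in U).
Proof.
split=> [|a u v uU vU]; first by rewrite (br0l lie) mem0v.
by rewrite (brDl lie) (brZl lie) rpredD ?memvZ.
Qed.

Lemma lin_closed_brr (U : {vspace g}) x : lin_closed (fun y => br x y \in U).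
Proof.
split=> [|a u v uU vU]; first by rewrite (br0r lie) mem0v.
by rewrite (brDr lie) (brZr lie) rpredD ?memvZ.
Qed.

Lemma brv_wsum_sub s r (U : {vspace g}) : uniq s -> uniq r ->
  (forall l m x y, l \in s -> m \in r -> x \in wsp l -> y \in wsp m -> br x y \in U) ->
  (brv br (wsum s) (wsum r) <= U)%VS.
Proof.
move=> us ur sU; apply: (brv_sub) => x y xs yr.
move: x xs; apply: (wsum_span us); first exact: lin_closed_brl.
move=> l x ls xl; move: y yr; apply: (wsum_span ur); first exact: lin_closed_brr.
by move=> m y mr ym; apply: (sU l m).
Qed.

Lemma cartan_abelian x y : x \in wsp 0 -> y \in wsp 0 -> br x y = 0.
Proof.
rewrite {1}(weight_space0 lie cartan_t) => xt y0.
have := weight_eigen lie simple_g cartan_t (vsproj t x) y0.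
by rewrite vsprojK // zero_lfunE scale0r.
Qed.

Lemma wsp_line l x : l \in wts -> l != 0 -> x \in wsp l -> x != 0 -> wsp l = <[x]>%VS.
Proof.
move=> lw l0 xl x0; apply/eqP; rewrite eq_sym -(geq_leqif (dimv_leqif_eq _)) -?memvE //.
by rewrite (dim_weight lie simple_g cartan_t) // dim_vline x0.
Qed.

Section Solvable.
Variable Z : dual (subvs_of t) -> Prop.
Hypothesis Z_nv : forall s : seq (dual (subvs_of t)),
  (forall l, l \in s -> Z l) -> \sum_(l <- s) l = 0 -> s = [::].

Let Z_antisym l : cone Z l -> cone Z (- l) -> l = 0.
Proof.
move=> [s [sP xs]] [r [rP xr]].
have : s ++ r = [::].
  apply: Z_nv => [m|]; last by rewrite big_cat -xs -xr /= subrr.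
  by rewrite mem_cat => /orP[/sP|/rP].
by case: s xs {sP} => // -> _; rewrite big_nil.
Qed.

Let zs := [seq l <- wts | `[<cone Z l>]].
Definition cone_algebra : {vspace g} := wsum zs.

Let uz (p : pred (dual (subvs_of t))) : uniq [seq l <- wts | p l].
Proof. by rewrite filter_uniq // (weights_uniq lie cartan_t). Qed.

Lemma sub_cone_algebra l : cone Z l -> (wsp l <= cone_algebra)%VS.
Proof.
by move=> cl; apply: sub_wsum_weights => lw; rewrite mem_filter lw andbT; apply/asboolP.
Qed.

Lemma cone_algebra_subalgebra : subalgebra br cone_algebra.
Proof.
apply: (brv_wsum_sub (uz _) (uz _)) => l m x y; rewrite !mem_filter.
move=> /andP[/asboolP cl _] /andP[/asboolP cm _] xl ym.
by apply: (subvP (sub_cone_algebra (coneD cl cm))); apply: wsp_br.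
Qed.

Let rank l := count (fun m => `[<cone Z (l - m)>]) wts.
Let E i := [seq l <- wts | [&& `[<cone Z l>], l != 0 & (i <= rank l)%N]].

(** A bracket of root vectors strictly increases [rank], the number of weights below, so the
derived series reaches zero. *)
Lemma cone_algebra_solvable : solvable_lie br cone_algebra.
Proof.
have step i : (brv br (wsum (E i)) (wsum (E i)) <= wsum (E i.+1))%VS.
  apply: (brv_wsum_sub (uz _) (uz _)) => l m x y; rewrite !mem_filter.
  move=> /andP[/and3P[/asboolP cl l0 il] lw] /andP[/and3P[/asboolP cm m0 im] mw] xl ym.
  apply: (subvP (sub_wsum_weights _) _ (wsp_br lie xl ym)) => lmw.
  rewrite mem_filter lmw andbT; apply/and3P; split.
  - by apply/asboolP; apply: coneD.
  - apply: contra_neq l0 => lm0; apply: Z_antisym => //.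
    by have /eqP := lm0; rewrite addrC addr_eq0 => /eqP <-.
  apply: leq_ltn_trans il _; apply: (@count_lt _ _ _ _ (l + m)) => //.
  - move=> d /asboolP dc; apply/asboolP; have := coneD dc cm.
    by rewrite addrAC.
  - by apply/asboolP; rewrite subrr; apply: cone0.
  apply/negP => /asboolP; rewrite opprD addrA subrr add0r => nc.
  by case/eqP: m0; apply: Z_antisym.
have start : (brv br cone_algebra cone_algebra <= wsum (E 0))%VS.
  apply: (brv_wsum_sub (uz _) (uz _)) => l m x y; rewrite !mem_filter.
  move=> /andP[/asboolP cl lw] /andP[/asboolP cm mw] xl ym.
  have [lm0|lm0] := eqVneq (l + m) 0.
    have l0 : l = 0.
      by apply: Z_antisym => //; have /eqP := lm0; rewrite addrC addr_eq0 => /eqP <-.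
    move: lm0 xl ym; rewrite l0 add0r => -> xl ym.
    by rewrite cartan_abelian // mem0v.
  apply: (subvP (sub_wsum_weights _) _ (wsp_br lie xl ym)) => lmw.
  rewrite mem_filter lmw lm0 andbT /= andbT; apply/asboolP.
  exact: coneD.
have iterE i : (iter i.+1 (fun V => brv br V V) cone_algebra <= wsum (E i))%VS.
  elim: i => [|i IHi]; first exact: start.
  by rewrite iterS; apply: subv_trans (step i); apply: brvS.
exists (size wts).+2; apply/eqP; rewrite -subv0; apply: subv_trans (iterE _) _.
suff -> : E (size wts).+1 = [::] by rewrite /weight_sum big_nil.
apply/eqP; rewrite -[_ == _]negbK -has_filter; apply/negP => /hasP[l _ /and3P[_ _]].
by rewrite ltnNge count_size.
Qed.
End Solvable.

Variable b : {vspace g}.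
Hypothesis borel_b : borel br b.
Hypothesis t_in_b : (t <= b)%VS.

Definition borel_root a := roots a /\ (wsp a <= b)%VS.

Let b_br x y : x \in b -> y \in b -> br x y \in b.
Proof. by case: borel_b => /(subalgebraP lie) sb _ _; apply: sb. Qed.

Lemma borel_root_of_vector l x : l != 0 -> x \in wsp l -> x != 0 -> x \in b -> borel_root l.
Proof.
move=> l0 xl x0 xb; have lw := mem_weights lie cartan_t xl x0.
split; first exact: weight_root.
by rewrite (wsp_line lw l0 xl x0) -memvE.
Qed.

Lemma borel_span (P : g -> Prop) : lin_closed P -> (forall x, x \in wsp 0 -> P x) ->
  (forall a x, borel_root a -> x \in wsp a -> P x) -> forall x, x \in b -> P x.
Proof.
move=> Plin P0 Pa x xb.
apply: (weight_span lie cartan_t (U := b)) => //.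
  by move=> h y /(subvP t_in_b) ht; apply: b_br.
move=> l y yb yl; have [->|y0] := eqVneq y 0; first by case: Plin.
have [l0|l0] := eqVneq l 0; first by apply: P0; rewrite -l0.
by apply: (Pa l) => //; apply: borel_root_of_vector yb.
Qed.

(** Otherwise [b] contains a triple [e], [f], [[e, f]] spanning a copy of [sl_2], which stays in
all the derived subalgebras. *)
Lemma borel_root_opp a : borel_root a -> ~ borel_root (- a).
Proof.
move=> [ra /subvP ab] [_ /subvP nab].
have [e [f [ea fa ef]]] := root_triple lie simple_g cartan_t ra.
have eh h := weight_eigen lie simple_g cartan_t h ea.
have fh h := weight_eigen lie simple_g cartan_t h fa.
have a2 := coroot_self lie simple_g cartan_t ra.
have F2 : (2 : F) != 0 by rewrite pnatr_eq0.
have c0 : vsval (cr a) != 0.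
  apply: contraNneq F2 => c0; rewrite -a2 (_ : cr a = 0) ?linear0 //.
  exact: val_inj.
have cb : vsval (cr a) \in b by apply: (subvP t_in_b); apply: subvsP.
have eE : e = 2^-1 *: br (vsval (cr a)) e by rewrite eh a2 scalerA mulVf ?scale1r.
have fE : f = (- 2^-1) *: br (vsval (cr a)) f.
  by rewrite fh opp_lfunE a2 scalerA mulrNN mulVf ?scale1r.
case: borel_b => _ [k bk] _.
have : [/\ e \in (iter k (fun V => brv br V V) b), f \in (iter k (fun V => brv br V V) b)
   & vsval (cr a) \in (iter k (fun V => brv br V V) b)].
  elim: k {bk} => [|k [IHe IHf IHc]]; first by split; [apply: ab | apply: nab |].
  rewrite iterS; split.
  - by rewrite eE memvZ // memv_brv.
  - by rewrite fE memvZ // memv_brv.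
  - by rewrite -ef memv_brv.
by rewrite bk memv0 => -[_ _]; rewrite memv0 (negPf c0).
Qed.

Lemma borel_half_closed : half_closed form roots borel_root.
Proof.
split=> [a [] //|a c [ra sa] [rc sc] rac ac|]; last exact: borel_root_opp.
have [x xa x0] := weight_vectorP lie cartan_t (root_weight lie simple_g cartan_t ra).
have [y yc y0] := weight_vectorP lie cartan_t (root_weight lie simple_g cartan_t rc).
apply: (@borel_root_of_vector _ (br x y)).
- exact: root_neq0 rac.
- exact: wsp_br.
- apply: (root_bracket_neq0 lie simple_g cartan_t (a := - a) _ _ x0 yc y0).
  + exact: root_opp.
  + by rewrite opprK.
  by rewrite root_formC (root_formNl lie simple_g cartan_t) oppr_gt0.
- by apply: b_br; [apply: (subvP sa) | apply: (subvP sc)].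
Qed.

(** If neither [a] nor [-a] were a root of [b], the cone generated by the roots of [b] and one
of the two would span, with [t], a larger solvable subalgebra. *)
Lemma borel_positive : positive_system form roots borel_root.
Proof.
split=> [|a ra]; first exact: borel_half_closed.
apply: contrapT => /not_orP[na na'].
have [c cE Z_nv] := half_closed_extend roots_like borel_half_closed ra na na'.
have rc : roots c by case: cE => -> //; apply: root_opp.
pose Z l := borel_root l \/ l = c.
have bc : (b <= cone_algebra Z)%VS.
  apply/subvP; apply: borel_span; first exact: vspace_lin_closed.
    by move=> x x0; apply: (subvP (sub_cone_algebra (cone0 Z))).
  move=> l x bl xl; apply: (subvP (sub_cone_algebra (cone1 _)) _ xl).
  by left.
case: borel_b => _ _ /(_ _ (cone_algebra_subalgebra _) (cone_algebra_solvable Z_nv) bc) cb.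
have : borel_root c.
  by split=> //; rewrite -cb; apply: sub_cone_algebra; apply: cone1; right.
by case: cE => ->.
Qed.

Definition borel_weights := [seq a <- wts | `[<borel_root a>]].

Lemma borel_weights_uniq : uniq borel_weights.
Proof. by rewrite filter_uniq // (weights_uniq lie cartan_t). Qed.

Lemma mem_borel_weights a : a \in borel_weights <-> borel_root a.
Proof.
rewrite mem_filter; split=> [/andP[/asboolP]|ba] //.
rewrite (root_weight lie simple_g cartan_t) ?andbT; first by apply/asboolP.
by case: ba.
Qed.

Lemma derived_borel : brv br b b = wsum borel_weights.
Proof.
apply/eqP; rewrite eqEsubv; apply/andP; split; last first.
  apply/subvP; apply: (wsum_span borel_weights_uniq); first exact: vspace_lin_closed.
  move=> a x /mem_borel_weights[ra /subvP ab] xa.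
  have F2 : (2 : F) != 0 by rewrite pnatr_eq0.
  have -> : x = 2^-1 *: br (vsval (cr a)) x.
    rewrite (weight_eigen lie simple_g cartan_t _ xa) (coroot_self lie simple_g cartan_t ra).
    by rewrite scalerA mulVf ?scale1r.
  apply/memvZ/memv_brv => //; last exact: ab.
  by apply: (subvP t_in_b); apply: subvsP.
apply: (brv_sub) => x y xb yb.
have key l z : l != 0 -> z \in wsp l -> z \in b -> z \in wsum borel_weights.
  move=> l0 zl zb; have [->|z0] := eqVneq z 0; first exact: mem0v.
  apply: (subvP (sub_wsum _ _) _ zl); apply/mem_borel_weights.
  exact: borel_root_of_vector zb.
have t0b z : z \in wsp 0 -> z \in b.
  by rewrite (weight_space0 lie cartan_t); apply: subvP.
have ab a z : borel_root a -> z \in wsp a -> z \in b by case=> _ /subvP; apply.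
move: x xb; apply: borel_span; first exact: lin_closed_brl.
  move=> x x0; move: y yb; apply: borel_span; first exact: lin_closed_brr.
    by move=> y y0; rewrite cartan_abelian // mem0v.
  move=> a y ba ya; apply: (key a); first by case: ba => /root_neq0.
    by rewrite -[a]add0r; apply: wsp_br.
  by apply: b_br; [apply: t0b | apply: ab ya].
move=> a x ba xa; move: y yb; apply: borel_span; first exact: lin_closed_brr.
  move=> y y0; apply: (key a); first by case: ba => /root_neq0.
    by rewrite -[a]addr0; apply: wsp_br.
  by apply: b_br; [apply: ab xa | apply: t0b].
move=> c y bc yc; apply: (key (a + c)).
- apply/eqP => ac0; apply: (borel_root_opp bc).
  by have /eqP := ac0; rewrite addr_eq0 => /eqP <-.
- exact: wsp_br.
- by apply: b_br; [apply: ab xa | apply: ab yc].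
Qed.

Lemma pos_rootsE a : pos_roots br b a <-> borel_root a.
Proof.
split=> [[ra ab]|ba].
  split=> //; apply/subvP => x /(mem_wspE lie simple_g cartan_t)/ab.
  by case: borel_b => /subvP sb _ _; apply: sb.
split; first by case: ba.
move=> x /(mem_wspE lie simple_g cartan_t) xa; rewrite derived_borel.
by apply: (subvP (sub_wsum _ _) _ xa); apply/mem_borel_weights.
Qed.

Lemma pos_roots_positive : positive_system form roots (@pos_roots F g br b t).
Proof.
have -> : @pos_roots F g br b t = borel_root by apply/funext => a; apply/propext/pos_rootsE.
exact: borel_positive.
Qed.
End BorelRoots.

(** * The cascade *)

Section Cascade.
Variables (F : numClosedFieldType) (g : vectType F) (br : g -> g -> g).
Variables (b t : {vspace g}).
Local Notation root := (dual (subvs_of t)).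
Local Notation form := (@root_form F g br t).
Local Notation roots := (@Defs.roots F g br t).
Local Notation pos := (@pos_roots F g br b t).
Local Notation highest := (@highest_root F g br b t).
Local Notation component := (@cascade_component F g br b t).
Implicit Types (Phi Psi : set root) (a c d : root).

Hypothesis RS : root_system_like form roots.
Hypothesis PS : positive_system form roots pos.
Hypothesis IRR : irreducible_in form roots.

Definition pos_in Phi a := Phi a /\ pos a.

Record subsystem Phi : Prop := Subsystem {
  ss_roots : forall a, Phi a -> roots a;
  ss_opp : forall a, Phi a -> Phi (- a);
  ss_diff : forall a c, Phi a -> Phi c -> roots (a - c) -> Phi (a - c);
  ss_irr : irreducible_in form Phi }.

Lemma subsystem_like Phi : subsystem Phi -> root_system_like form Phi.
Proof.
case: RS => sym add [s sP] re po op su or [Pr Po Pd _]; split=> //.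
- by exists s => a /Pr/sP.
- by move=> a c /Pr ra /Pr; apply: re.
- by move=> a /Pr; apply: po.
- by move=> a c Pa Pc ac nac; apply: Pd => //; apply: su => //; apply: Pr.
- move=> a c Pa Pc Pac ac; apply: Pd => //; apply: or => //; exact: Pr.
Qed.

Lemma subsystem_positive Phi : subsystem Phi -> positive_system form Phi (pos_in Phi).
Proof.
case: PS => [[sub add opp] tot] [Pr Po Pd _]; split.
  split=> [a []//|a c [Pa pa] [Pc pc] Pac ac|a [_ pa] [_ pa']]; last exact: (opp a).
  by split=> //; apply: add => //; apply: Pr.
by move=> a Pa; case: (tot a (Pr a Pa)) => pa; [left | right]; split=> //; apply: Po.
Qed.

Lemma highest_in Phi a : highest Phi a -> Phi a /\ pos a.
Proof. by case. Qed.

Lemma highest_cone Phi a c : highest Phi a -> Phi c -> cone (pos_in Phi) (a - c).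
Proof. by case=> _ H /H[s [sP sE]]; exists s. Qed.

Lemma subsystem_highest Phi : subsystem Phi -> exists a, highest Phi a.
Proof.
move=> sP; have [a Pa ac] := highest_exists (subsystem_like sP) (subsystem_positive sP) (ss_irr sP).
by exists a; split=> // c /ac[s [sp sE]]; exists s.
Qed.

Lemma highest_unique Phi a c : subsystem Phi -> highest Phi a -> highest Phi c -> a = c.
Proof.
move=> sP ha hc; have [Pa _] := highest_in ha; have [Pc _] := highest_in hc.
have [hp _] := subsystem_positive sP.
have c1 := highest_cone ha Pc; have := highest_cone hc Pa; rewrite -opprB => c2.
by apply/eqP; rewrite -subr_eq0; apply/eqP; apply: (cone_antisym (subsystem_like sP) hp).
Qed.

Lemma highest_maximal Phi a : subsystem Phi -> highest Phi a ->
  maximal_in Phi (pos_in Phi) a.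
Proof.
move=> sP ha; have PP := subsystem_positive sP; split; first exact: highest_in ha.
move=> c pc /(highest_cone ha); rewrite opprD addrA subrr add0r => cc.
have := cone_antisym (subsystem_like sP) (proj1 PP) (cone1 pc) cc.
by apply/eqP; apply: (pos_nz (subsystem_like sP) PP).
Qed.

Lemma highest_ge0 Phi a c : subsystem Phi -> highest Phi a -> pos_in Phi c -> 0 <= form c a.
Proof.
move=> sP ha pc; rewrite (rs_sym RS).
by apply: (maximal_form_ge0 (subsystem_like sP) (subsystem_positive sP) (highest_maximal sP ha)).
Qed.

(** Reflecting in [c] would turn [a - c] into the root [a + c], above the highest root. *)
Lemma highest_sub_ortho Phi a c : subsystem Phi -> highest Phi a -> Phi c ->
  roots (a - c) -> form c a <> 0.
Proof.
move=> sP ha Pc rac ca; have [Pa _] := highest_in ha.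
(* One of [c] and [-c] is positive, and both can be subtracted from [a]. *)
have key d : Phi d -> roots (a - d) -> form d a = 0 -> pos d -> False.
  move=> Pd rad da pd; have [_ ma] := highest_maximal sP ha.
  apply: (ma d); first by split.
  rewrite -[d]opprK; apply: (ss_diff sP) => //; first exact: (ss_opp sP).
  apply: (rs_ortho RS); [exact: (ss_roots sP)|apply/(ss_roots sP)/(ss_opp sP Pd)|by []|].
  by rewrite (form_oppr RS) (rs_sym RS) da oppr0.
case: PS => _ /(_ c (ss_roots sP Pc))[pc|pc]; first exact: (key c).
apply: (key (- c)) => //; first exact: (ss_opp sP).
  rewrite opprK -[c]opprK; apply: (rs_ortho RS) => //; try exact: (ss_roots sP).
    exact/(ss_roots sP)/(ss_opp sP).
  by rewrite (form_oppr RS) (rs_sym RS) ca oppr0.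
by rewrite (form_oppl RS) ca oppr0.
Qed.

Lemma component_subsystem Phi : component Phi -> subsystem Phi.
Proof.
elim=> {Phi} [|Phi Psi th _ sP hth [sub [ne irr] ort]].
  by split=> //; apply: (rs_opp RS).
have nz a : Psi a -> form a a <> 0.
  move=> /sub[Pa _]; have := rs_pos RS (ss_roots sP Pa).
  by rewrite lt_def => /andP[/eqP].
have inPsi a c : Psi c -> Phi a -> form a th = 0 -> form c a <> 0 -> Psi a.
  by move=> Pc Pa ath; apply: contra_notP => na; apply: ort.
split.
- by move=> a /sub[Pa _]; apply: ss_roots Pa.
- move=> a Psa; have [Pa ath] := sub a Psa; apply: (inPsi _ a) => //.
  + exact: ss_opp.
  + by rewrite (form_oppl RS) ath oppr0.
  by rewrite (form_oppr RS) => /eqP; rewrite oppr_eq0 => /eqP; apply: nz.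
- move=> a c Psa Psc rac; have [Pa ath] := sub a Psa; have [Pc cth] := sub c Psc.
  have Pac := ss_diff sP Pa Pc rac.
  have acth : form (a - c) th = 0 by rewrite (form_subl RS) ath cth subrr.
  apply: contrapT => nac; have nac' : form a (a - c) = 0.
    by apply: contrapT => H; apply: nac; apply: inPsi H.
  have nc' : form c (a - c) = 0.
    by apply: contrapT => H; apply: nac; apply: inPsi H.
  have := rs_pos RS rac; rewrite (form_subl RS) nac' nc' subrr ltxx.
  by [].
split; first by case: ne => a; exists a.
move=> A As Ao; have [|A0|AP] := irr A As.
- by move=> a c Aa [Pc nc]; apply: Ao.
- by left=> a; rewrite A0.
- by right=> a; rewrite AP.
Qed.

(** The component of [a] is the intersection of the subsets that contain [a] and are
orthogonal to their complement in [Phi]. *)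
Lemma irreducible_component_exists Phi a : (forall c, Phi c -> roots c) -> Phi a ->
  exists2 Psi, irreducible_component br Phi Psi & Psi a.
Proof.
move=> sP Pa.
pose cls (A : set root) := forall c d, A c -> Phi d -> ~ A d -> form c d = 0.
pose Psi : set root := [set c | Phi c /\ forall A : set root, A a -> cls A -> A c]%classic.
have oPsi c d : Psi c -> Phi d -> ~ Psi d -> form c d = 0.
  move=> [Pc cA] Pd nd; apply: contrapT => cd; apply: nd; split=> // A Aa clA.
  by apply: contrapT => nA; apply: cd; apply: (clA c d) => //; apply: cA.
exists Psi; last by split.
split=> [c []//||c d Pc [Pd nd]]; last exact: oPsi.
split; first by exists a; split.
move=> B BPsi oB; have [Ba|nBa] := pselect (B a).
  right; apply/seteqP; split=> // c [Pc cA]; apply: (cA B Ba) => u v Bu Pv nv.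
  have [Psv|nPsv] := pselect (Psi v); first by apply: oB.
  by apply: oPsi => //; apply: BPsi.
left; apply/seteqP; split=> // c Bc; have [Pc cA] := BPsi c Bc.
have [||_] := cA (Psi `\` B)%classic; last by apply.
  by split=> //; split.
move=> u v [Pu nBu] Pv nv; have [Psv|nPsv] := pselect (Psi v); last exact: oPsi.
have Bv : B v by apply: contrapT => nBv; apply: nv.
by rewrite (rs_sym RS); apply: oB.
Qed.

(** The root spaces of the roots [a] of a hook span a Heisenberg algebra, with centre the root
space of [beta]. *)
Definition hook Phi beta a :=
  [/\ component Phi, highest Phi beta, Phi a, pos a & form a beta != 0].

Lemma hook_gt0 Phi beta a : hook Phi beta a -> 0 < form a beta.
Proof.
move=> [cP hb Pa pa ab]; rewrite lt_def ab; apply: (highest_ge0 _ hb) => //.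
exact: component_subsystem.
Qed.

(** Descend from the whole root system to the component of [a] as long as [a] is orthogonal to
the highest root; each step loses that root. *)
Lemma hook_exists a : pos a -> exists Phi beta, hook Phi beta a.
Proof.
move=> pa; have ra : roots a by case: PS => [[sub _ _] _]; apply: sub.
pose N Phi := count (fun c => `[<Phi c>]) (roots_seq roots).
suff key n Phi : (N Phi < n)%N -> component Phi -> Phi a -> exists Phi beta, hook Phi beta a.
  by apply: (key (N roots).+1 roots) => //; apply: cascade_start.
elim: n Phi => // n IHn Phi nP cP Pa; have sP := component_subsystem cP.
have [th hth] := subsystem_highest sP; have [Pth _] := highest_in hth.
have [ath|ath] := eqVneq (form a th) 0; last by exists Phi, th; split.
pose Phi0 := (Phi `&` [set c | form c th = 0])%classic.
have [||Psi cPsi Psia] := @irreducible_component_exists Phi0 a; last first.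
- apply: (IHn Psi) => //; last exact: cascade_next cPsi.
  rewrite ltnS in nP; apply: leq_trans nP; case: cPsi => sub _ _.
  apply: (@count_lt _ _ _ _ th).
  + by move=> c /asboolP/sub[Pc _]; apply/asboolP.
  + exact/(mem_roots_seq RS)/(ss_roots sP).
  + exact/asboolP.
  apply/negP => /asboolP/sub[_ /= thth].
  by have := rs_pos RS (ss_roots sP Pth); rewrite thth ltxx.
- by split.
- by move=> c [Pc _]; apply: ss_roots Pc.
Qed.

Definition beneath Phi Psi := exists2 th, highest Phi th &
  forall a, Psi a -> Phi a /\ form a th = 0.
Definition ortho Phi Psi := forall a c, Phi a -> Psi c -> form a c = 0.

Lemma beneath_sub Phi Psi Psi' : beneath Phi Psi -> (forall a, Psi' a -> Psi a) ->
  beneath Phi Psi'.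
Proof. by case=> th hth H sub; exists th => // a /sub; apply: H. Qed.

Lemma subsystem_in_component Phi Psi Psi' : subsystem Psi -> (forall a, Psi a -> Phi a) ->
  irreducible_component br Phi Psi' -> (forall a, Psi a -> Psi' a) \/ ortho Psi Psi'.
Proof.
move=> sPsi sub [sub' _ ort].
have [_ /(_ (Psi `&` Psi')%classic)] := ss_irr sPsi.
case=> [a []//|a c [Pa P'a] Pc nc|none|all].
- by apply: ort => //; split; [apply: sub | move=> P'c; apply: nc].
- right=> a c Pa P'c; rewrite (rs_sym RS); apply: ort => //; split; first exact: sub.
  by move=> P'a; apply: (none a).
- by left=> a /all[].
Qed.

(** Double induction on the construction of the two systems. When one of them, [Phi], lies
below the parent of the other, irreducibility places it inside the latter or orthogonal
to it. *)
Lemma component_tree Phi Psi : component Phi -> component Psi ->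
  [\/ Phi = Psi, beneath Phi Psi, beneath Psi Phi | ortho Phi Psi].
Proof.
have root_tree Psi0 : component Psi0 -> Psi0 = roots \/ beneath roots Psi0.
  elim=> {Psi0} [|Phi0 Psi0 th _ [->|bt0] hth [sub _ _]]; first by left.
    by right; exists th => // a /sub[].
  by right; apply: beneath_sub bt0 _ => a /sub[].
move=> cPhi; elim: cPhi Psi => {Phi} [|Phi0 Phi th cPhi0 IHPhi hth cPhi] Psi cPsi.
  by case: (root_tree Psi cPsi) => [->|?]; [constructor 1 | constructor 2].
have [sub _ _] := cPhi.
have cPhi' : component Phi := cascade_next cPhi0 hth cPhi.
have sPhi := component_subsystem cPhi'; have sPhi0 := component_subsystem cPhi0.
have bPhi : beneath Phi0 Phi by exists th => // a /sub[].
elim: cPsi => {Psi} [|Psi0 Psi th' cPsi0 IHPsi hth' cPsi].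
  case: (root_tree Phi cPhi') => [E|?]; first by constructor 1.
  by constructor 3.
have [sub' _ _] := cPsi; have sPsi0 := component_subsystem cPsi0.
have cPsi' : component Psi := cascade_next cPsi0 hth' cPsi.
have sPsi := component_subsystem cPsi'.
have bPsi : beneath Psi0 Psi by exists th' => // a /sub'[].
case: IHPsi => [E|bt|[th2 hth2 bt]|o].
- by constructor 2; rewrite E.
- by constructor 2; apply: beneath_sub bt _ => a /sub'[].
- have E : th2 = th' by apply: highest_unique hth2 hth'.
  case: (subsystem_in_component sPhi _ cPsi) => [a /bt[Pa]|PhiPsi|o].
  + by rewrite E => ?; split.
  + case: (IHPhi Psi cPsi') => [E2|[th3 hth3 bt3]|bt3|o3].
    * by constructor 3; rewrite -E2.
    * have E3 : th3 = th by apply: highest_unique hth3 hth.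
      case: (subsystem_in_component sPsi _ cPhi) => [a /bt3[Pa]|PsiPhi|o].
      - by rewrite E3 => ?; split.
      - by constructor 1; apply/seteqP; split.
      - by constructor 4 => a c Pa Pc; rewrite (rs_sym RS); apply: o.
    * by constructor 3; apply: beneath_sub bt3 _ => a /sub[].
    * by constructor 4 => a c /sub[Pa _]; apply: o3.
  + by constructor 4.
- by constructor 4 => a c Pa /sub'[Pc _]; apply: o.
Qed.

Lemma cascade_ortho Phi Psi a c : component Phi -> component Psi -> highest Phi a ->
  highest Psi c -> a <> c -> form a c = 0.
Proof.
move=> cP cQ ha hc nac; have [Pa _] := highest_in ha; have [Qc _] := highest_in hc.
have sP := component_subsystem cP; have sQ := component_subsystem cQ.
case: (component_tree cP cQ) => [E|[th hth bt]|[th hth bt]|o].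
- by case: nac; apply: (highest_unique sP ha); rewrite E.
- have [_] := bt c Qc; rewrite (highest_unique sP hth ha) => <-; exact: rs_sym RS _ _.
- by have [_] := bt a Pa; rewrite (highest_unique sQ hth hc).
- exact: o.
Qed.

(** If [b1] differs from [b3], then [c] has negative product with [b1], so [Phi1] lies below
[Phi2] in the tree. This forces [b2 = b3], and makes [a] orthogonal to [b3]
although [b3 - a] is a root, against [highest_sub_ortho]. *)
Lemma hook_sum_left Phi1 Phi2 Phi3 b1 b2 b3 a c : hook Phi1 b1 a -> hook Phi2 b2 c ->
  component Phi3 -> highest Phi3 b3 -> a + c = b3 -> b1 = b3.
Proof.
move=> h1 h2 c3 hb3 ac3; have a1 := hook_gt0 h1; have c2 := hook_gt0 h2.
have [C1 hb1 P1a pa _] := h1; have [C2 hb2 P2c pc _] := h2.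
have s1 := component_subsystem C1; have s2 := component_subsystem C2.
apply: contrapT => n13.
have o13 : form b1 b3 = 0 by apply: cascade_ortho hb1 hb3 n13.
have cb1 : form c b1 < 0.
  have : form (a + c) b1 = 0 by rewrite ac3 (rs_sym RS).
  rewrite (rs_add RS) => /eqP; rewrite addrC addr_eq0 => /eqP ->.
  by rewrite oppr_lt0.
have n12 : b1 <> b2.
  by move=> E; have := c2; rewrite -E => /lt_trans/(_ cb1); rewrite ltxx.
have cb1' : form c b1 <> 0 by move=> E; rewrite E ltxx in cb1.
case: (component_tree C1 C2) => [E|[th hth bt]|[th hth bt]|o].
- by apply: n12; apply: (highest_unique s1 hb1); rewrite E.
- by apply: cb1'; have [_] := bt c P2c; rewrite (highest_unique s1 hth hb1).
- have [P2a] := bt a P1a; rewrite (highest_unique s2 hth hb2) => ab2.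
  have b23 : b2 = b3.
    apply: contrapT => n23; have := cascade_ortho C2 c3 hb2 hb3 n23.
    rewrite (rs_sym RS) -ac3 (rs_add RS) ab2 add0r => E.
    by rewrite E ltxx in c2.
  apply: (highest_sub_ortho s2 hb2 P2a) ab2.
  by rewrite b23 -ac3 addrC addKr; apply: ss_roots P2c.
- by apply: cb1'; rewrite (rs_sym RS); apply: o => //; case: (highest_in hb1).
Qed.

(** That [beta - a] is not orthogonal to [beta] is [highest_sub_ortho]. *)
Lemma hook_complement Phi beta a : hook Phi beta a -> a <> beta -> hook Phi beta (beta - a).
Proof.
move=> h nab; have ab := hook_gt0 h; have [C hb Pa pa _] := h.
have [Pb pb] := highest_in hb.
have s := component_subsystem C.
have rb := ss_roots s Pb; have ra := ss_roots s Pa.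
have rba : roots (beta - a).
  by apply: (rs_sub RS) => //; [rewrite (rs_sym RS) | move=> E; apply: nab].
have Pba := ss_diff s Pb Pa rba.
split=> //.
  by have [] := pos_of_cone (subsystem_like s) (subsystem_positive s) Pba (highest_cone hb Pa).
apply/eqP; apply: (highest_sub_ortho s hb Pba).
by rewrite opprB addrC subrK; apply: ss_roots Pa.
Qed.
End Cascade.

(** * The cascade element is an Ooms element *)

Section Irreducibility.
Variables (F : numClosedFieldType) (g : vectType F) (br : g -> g -> g).
Hypothesis lie : lie_bracket br.
Hypothesis simple_g : simple_lie br.
Variable t : {vspace g}.
Hypothesis cartan_t : cartan br t.
Implicit Types (x y z : g) (a c l m : dual (subvs_of t)).
Local Notation wsp := (@weight_space F g br t).
Local Notation form := (@root_form F g br t).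
Local Notation roots := (@Defs.roots F g br t).
Local Notation cr := (@coroot F g br t).

Lemma roots_nonempty : exists a, roots a.
Proof.
apply: contrapT => nr; case: simple_g => nab _; apply: nab; apply/eqP.
rewrite -subv0; apply: (brv_sub) => x y _ _; rewrite memv0; apply/eqP.
have w0 l z : z \in wsp l -> z \in wsp 0.
  move=> zl; have [->|z0] := eqVneq z 0; first exact: mem0v.
  have [<- //|l0] := eqVneq l 0; case: nr; exists l.
  exact: weight_root (mem_weights lie cartan_t zl z0) l0.
have all0 z : z \in wsp 0.
  by move: z; apply: (weight_span_full lie cartan_t) w0; apply: vspace_lin_closed.
exact: (cartan_abelian lie simple_g cartan_t).
Qed.

(** If [a + c] were a root, it would have nonzero product with both [a] and [c], hence could
neither be in [A] nor outside. *)
Lemma br_root_ortho (A : dual (subvs_of t) -> Prop) a c x y : (forall a, A a -> roots a) ->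
  (forall a c, A a -> roots c -> ~ A c -> form a c = 0) ->
  A a -> roots c -> ~ A c -> x \in wsp a -> y \in wsp c -> br x y = 0.
Proof.
move=> Ar Ao Aa rc nc xa yc; apply: contrapT => /eqP xy0.
have RS := roots_like lie simple_g cartan_t.
have ra := Ar a Aa; have ac := Ao a c Aa rc nc.
have faa := rs_pos RS ra; have fcc := rs_pos RS rc.
have [ac0|ac0] := eqVneq (a + c) 0.
  have cE : c = - a by move/eqP: ac0; rewrite addrC addr_eq0 => /eqP.
  by move: ac; rewrite cE (form_oppr RS) => /eqP; rewrite oppr_eq0 gt_eqF.
have rac : roots (a + c).
  exact: weight_root (mem_weights lie cartan_t (wsp_br lie xa yc) xy0) ac0.
have [Aac|nac] := pselect (A (a + c)).
  by move/eqP: (Ao _ c Aac rc nc); rewrite (rs_add RS) ac add0r gt_eqF.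
by move/eqP: (Ao a _ Aa rac nac); rewrite (form_addr RS) ac addr0 gt_eqF.
Qed.

(** If [A] is nonempty and orthogonal to its complement, the centralizer of the root spaces
outside [A] is an ideal that contains those of [A]; by simplicity it is all of [g], and a
root space outside [A] would be killed by its own coroot. *)
Lemma roots_irreducible : irreducible_in form roots.
Proof.
split=> [|A Ar Ao]; first exact: roots_nonempty.
have [[a Aa]|nA] := pselect (exists a, A a); last by left=> a Aa; apply: nA; exists a.
right=> c rc; apply: contrapT => nc.
(* The centralizer of the root spaces outside [A]. *)
pose J x := forall d y, roots d -> ~ A d -> y \in wsp d -> br x y = 0.
have Jlin : lin_closed J.
  split=> [d y _ _ _|k u v Ju Jv d y rd nd yd]; first exact: br0l.
  by rewrite (brDl lie) (brZl lie) (Ju d) ?(Jv d) // scaler0 addr0.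
have memJ z : z \in vspace_of J <-> J z := mem_vspace_of z Jlin.
have JA x l : A l -> x \in wsp l -> J x.
  by move=> Al xl d y rd nd yd; apply: (br_root_ortho Ar Ao Al rd nd xl yd).
have Jbr z x : J x -> J (br z x).
  move=> Jx; have [J0 JL] := Jlin; move: z; apply: (weight_span_full lie cartan_t).
    by split=> [|k u v Ju Jv]; rewrite ?(br0l lie) // (brDl lie) (brZl lie); apply: JL.
  move=> l z zl; have [->|z0] := eqVneq z 0; first by rewrite (br0l lie).
  have brE d y : roots d -> ~ A d -> y \in wsp d -> br (br z x) y = - br x (br z y).
    move=> rd nd yd; have := br_br lie z x y; rewrite (Jx d y rd nd yd) (br0r lie).
    by move=> /esym/eqP; rewrite addr_eq0 => /eqP.
  have [l0|l0] := eqVneq l 0.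
    move=> d y rd nd yd; rewrite (brE d) //.
    rewrite (_ : br x (br z y) = 0) ?oppr0 //; apply: (Jx d) => //.
    by rewrite -[d]add0r -l0; apply: wsp_br.
  have rl : roots l := weight_root lie simple_g cartan_t (mem_weights lie cartan_t zl z0) l0.
  have [Al|nl] := pselect (A l).
    move=> d y rd nd yd; rewrite (brE d) //.
    by rewrite (JA z l Al zl d) // (br0r lie) oppr0.
  by rewrite (brC lie) (Jx l z rl nl zl) oppr0.
have [x xa x0] := weight_vectorP lie cartan_t (root_weight lie simple_g cartan_t (Ar a Aa)).
have [y yc y0] := weight_vectorP lie cartan_t (root_weight lie simple_g cartan_t rc).
case: simple_g => _ /(_ (vspace_of J)) [|J0|Jf].
- by apply/(idealP lie) => z w /memJ Jw; apply/memJ/Jbr.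
- have : x \in vspace_of J by apply/memJ; apply: JA xa.
  by rewrite J0 memv0 (negPf x0).
have /memJ Jc : vsval (cr c) \in vspace_of J by rewrite Jf memvf.
have /eqP := Jc c y rc nc yc; rewrite (weight_eigen lie simple_g cartan_t _ yc).
by rewrite (coroot_self lie simple_g cartan_t rc) scaler_eq0 pnatr_eq0 (negPf y0).
Qed.
End Irreducibility.

Section CascadeAlgebra.
Variables (F : numClosedFieldType) (g : vectType F) (br : g -> g -> g).
Hypothesis lie : lie_bracket br.
Hypothesis simple_g : simple_lie br.
Variables b t : {vspace g}.
Hypothesis borel_b : borel br b.
Hypothesis cartan_t : cartan br t.
Hypothesis t_in_b : (t <= b)%VS.
Variable K : seq (dual (subvs_of t)).
Hypothesis uniq_K : uniq K.
Hypothesis K_cascade : forall beta : dual (subvs_of t),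
  beta \in K <-> kostant_cascade br b beta.
Implicit Types (x y z u v : g) (a c d l m beta : dual (subvs_of t)).
Local Notation wsp := (@weight_space F g br t).
Local Notation wsum := (@weight_sum F g br t).
Local Notation kf := (killing br).
Local Notation tv := (dual_to_cartan br t).
Local Notation form := (@root_form F g br t).
Local Notation roots := (@Defs.roots F g br t).
Local Notation cr := (@coroot F g br t).
Local Notation pos := (@pos_roots F g br b t).
Local Notation bw := (borel_weights br t b).
Local Notation tK := (cascade_torus br K).
Local Notation bK := (cascade_algebra br b K).
Local Notation xK := (cascade_element br K).

Let RS : root_system_like form roots := roots_like lie simple_g cartan_t.
Let PS : positive_system form roots pos :=
  pos_roots_positive lie simple_g cartan_t borel_b t_in_b.
Let IRR : irreducible_in form roots := roots_irreducible lie simple_g cartan_t.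
Let formE a c : form a c = a (tv c) := root_formE lie simple_g cartan_t a c.
Let derivedE : brv br b b = wsum bw := derived_borel lie simple_g cartan_t borel_b t_in_b.

Let mem_bw a : a \in bw <-> pos a.
Proof.
rewrite (mem_borel_weights lie simple_g cartan_t).
by rewrite (pos_rootsE lie simple_g cartan_t borel_b t_in_b).
Qed.

Let pos_root a : pos a -> roots a. Proof. by case: PS => -[sub _ _] _; apply: sub. Qed.

Lemma cascade_hook beta : beta \in K -> exists Phi, hook br b Phi beta beta.
Proof.
move=> /K_cascade[Phi cP hb]; exists Phi; have [[Pb pb] _] := hb; split=> //.
by rewrite gt_eqF // (rs_pos RS) //; apply: pos_root.
Qed.

Lemma hook_cascade Phi beta a : hook br b Phi beta a -> beta \in K.
Proof. by move=> [cP hb _ _ _]; apply/K_cascade; exists Phi. Qed.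

Lemma cascade_root beta : beta \in K -> roots beta.
Proof. by case/cascade_hook => Phi [_ _ _ pb _]; apply: pos_root. Qed.

Lemma cascade_pos beta : beta \in K -> pos beta.
Proof. by case/cascade_hook => Phi []. Qed.

Lemma cascade_orthogonal a c : a \in K -> c \in K -> a != c -> form a c = 0.
Proof.
move=> /K_cascade[Phi cP ha] /K_cascade[Psi cQ hc] /eqP.
exact: (cascade_ortho RS PS IRR cP cQ ha hc).
Qed.

Lemma cascade_hook_sum Phi1 Phi2 b1 b2 beta a c : hook br b Phi1 b1 a ->
  hook br b Phi2 b2 c -> beta \in K -> a + c = beta -> b1 = beta.
Proof.
by move=> h1 h2 /K_cascade[Phi cP hb]; apply: (hook_sum_left RS PS IRR h1 h2 cP hb).
Qed.

Lemma torus_sub : (tK <= t)%VS.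
Proof. by apply/span_subvP => _ /mapP[c _ ->]; apply: subvsP. Qed.

Lemma mem_torus beta : beta \in K -> vsval (tv beta) \in tK.
Proof. by move=> bK; apply/memv_span/map_f. Qed.

Lemma derived_sub_algebra : (brv br b b <= bK)%VS.
Proof. exact: addvSr. Qed.

Lemma algebra_sub_borel : (bK <= b)%VS.
Proof.
rewrite subv_add (subv_trans torus_sub) //=.
by case: borel_b.
Qed.

Lemma algebra_br x y : x \in bK -> y \in bK -> br x y \in bK.
Proof.
move=> /(subvP algebra_sub_borel) xb /(subvP algebra_sub_borel) yb.
by apply: (subvP derived_sub_algebra); apply: memv_brv.
Qed.

Lemma torus_cap_derived : (tK :&: brv br b b = 0)%VS.
Proof.
apply/eqP; rewrite -subv0 derivedE.
rewrite -(wsum_cap0 lie cartan_t (l := 0) (borel_weights_uniq lie cartan_t b)).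
  apply: capvS => //; apply: subv_trans torus_sub _.
  by rewrite (weight_space0 lie cartan_t) subvv.
apply/negP => /mem_bw/pos_root/root_neq0.
by rewrite eqxx.
Qed.

Lemma wsp_sub_algebra a : pos a -> (wsp a <= bK)%VS.
Proof.
move=> pa; apply: subv_trans derived_sub_algebra; rewrite derivedE.
by apply: sub_wsum; apply/mem_bw.
Qed.

Lemma cascade_element_eval beta : beta \in K -> (beta xK : F) = 1.
Proof.
move=> Kb; rewrite /cascade_element linearZ /= linear_sum /= (big_rem beta) //=.
rewrite big_seq big1 => [|c]; last first.
  rewrite mem_rem_uniq // inE => /andP[cb Kc].
  rewrite (coroot_eval lie simple_g cartan_t) cascade_orthogonal ?mulr0 ?mul0r //.
  by rewrite eq_sym.
rewrite addr0; have -> : (beta (cr beta) : F) = 2.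
  by apply: (coroot_self lie simple_g cartan_t); apply: cascade_root.
by rewrite [LHS](mulVf _) // pnatr_eq0.
Qed.

Lemma cascade_element_torus : vsval xK \in tK.
Proof.
rewrite /cascade_element linearZ linear_sum /= memvZ // big_seq.
apply: rpred_sum => c Kc; apply: memvZ.
exact: mem_torus.
Qed.

(** Any choice of root vectors for the roots [- beta] would do. *)
Definition lowering : g := \sum_(beta <- K) vpick (wsp (- beta)).
Local Notation ev beta := (vpick (wsp (- beta))).

Let ev_in beta : ev beta \in wsp (- beta). Proof. exact: memv_pick. Qed.

Let ev0 beta : beta \in K -> ev beta != 0.
Proof.
move=> /cascade_root/root_opp rb; rewrite vpick0.
have [_ memw] := weightsP lie cartan_t; apply/memw.
by apply: (root_weight lie simple_g cartan_t); apply: rb.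
Qed.

Lemma br_element_lowering : br (vsval xK) lowering = - lowering.
Proof.
rewrite /lowering (br_sumr lie) -sumrN; apply: eq_big_seq => beta Kb.
rewrite (weight_eigen lie simple_g cartan_t _ (ev_in beta)) opp_lfunE.
by rewrite cascade_element_eval // scaleN1r.
Qed.

Lemma ev_kf beta l v : v \in wsp l -> l != beta -> kf (ev beta) v = 0.
Proof.
move=> vl lb; apply: (killing_weights lie _ (ev_in beta) vl).
by rewrite addrC subr_eq0.
Qed.

Lemma lowering_kf l v : l \in K -> v \in wsp l -> kf lowering v = kf (ev l) v.
Proof.
move=> Kl vl; rewrite /lowering (killing_suml lie) (big_rem l) //= big_seq big1 ?addr0 //.
move=> c; rewrite mem_rem_uniq // inE => /andP[cl _]; apply: (ev_kf vl).
by rewrite eq_sym.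
Qed.

Lemma lowering_kf0 l v : l \notin K -> v \in wsp l -> kf lowering v = 0.
Proof.
move=> Kl vl; rewrite /lowering (killing_suml lie) big_seq big1 // => c Kc.
by apply: (ev_kf vl); apply: contraNneq Kl => ->.
Qed.

(** Both sides are linear in [h] and agree on the spanning vectors by orthogonality. *)
Lemma torus_expand h : vsval h \in tK ->
  h = \sum_(beta <- K) ((beta h : F) / form beta beta) *: tv beta.
Proof.
pose Q z := exists2 d : subvs_of t, z = vsval d &
  d = \sum_(beta <- K) ((beta d : F) / form beta beta) *: tv beta.
have Qlin : lin_closed Q.
  split.
    exists 0; first by rewrite linear0.
    by rewrite big1 // => c _; rewrite linear0 mul0r scale0r.
  move=> k z w [d -> dE] [e -> eE]; exists (k *: d + e) => //.
  rewrite {1}dE {1}eE scaler_sumr -big_split; apply: eq_bigr => c _.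
  by rewrite linearP /= scalerA -scalerDl mulrA mulrDl.
have memQ z : z \in vspace_of Q <-> Q z := mem_vspace_of z Qlin.
have sub : (tK <= vspace_of Q)%VS.
  apply/span_subvP => _ /mapP[c Kc ->]; apply/memQ; exists (tv c) => //.
  rewrite (big_rem c) //= big_seq big1 ?addr0 => [|d].
    by rewrite -formE divff ?scale1r // gt_eqF //; apply/(rs_pos RS)/cascade_root.
  rewrite mem_rem_uniq // inE => /andP[dc Kd].
  by rewrite -formE cascade_orthogonal // mul0r scale0r.
by move=> /(subvP sub)/memQ[d /val_inj -> dE].
Qed.

(** Testing against the root space of [beta - a] shows that the component of [x] in the root
space of a hook member [a] of [beta], [a <> beta], is zero; testing against the dual vector
of [beta] shows this for [beta] itself; testing against the root space of [beta] shows that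
the torus component is killed by [beta]. *)
Lemma lowering_nondegenerate x : x \in bK ->
  (forall y, y \in bK -> kf lowering (br x y) = 0) -> x = 0.
Proof.
move=> /memv_addP[h hK [u uU ->]] B.
have uw : uniq bw := borel_weights_uniq lie cartan_t b.
rewrite derivedE in uU; have [w ww uE] := wsumP uw uU.
have hE : vsval (vsproj t h) = h by rewrite vsprojK // (subvP torus_sub).
set h' := vsproj t h in hE.
have Bexp y : kf lowering (br (h + u) y) =
    kf lowering (br h y) + \sum_(c <- bw) kf lowering (br (w c) y).
  by rewrite (brDl lie) (killingDr lie) uE (br_suml lie) (killing_sumr lie).
have hbr l y : y \in wsp l -> br h y \in wsp l.
  by move=> yl; rewrite -hE (weight_eigen lie simple_g cartan_t _ yl) memvZ.
have w0 a : pos a -> w a = 0.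
  move=> pa; apply: contrapT => /eqP wa0.
  have [Ka|nKa] := boolP (a \in K).
    have := B _ (subvP (addvSl _ _) _ (mem_torus Ka)); rewrite Bexp.
    have -> : br h (vsval (tv a)) = 0.
      have ta : vsval (tv a) \in wsp 0 by rewrite (weight_space0 lie cartan_t) subvsP.
      by rewrite -hE (weight_eigen lie simple_g cartan_t _ ta) zero_lfunE scale0r.
    have brw c : br (w c) (vsval (tv a)) = - (form c a *: w c).
      by rewrite (brC lie) (weight_eigen lie simple_g cartan_t _ (ww c)) formE.
    rewrite (killing0r lie) add0r (big_rem a) /=; last exact/mem_bw.
    rewrite big_seq big1 ?addr0 => [|c]; last first.
      rewrite mem_rem_uniq // inE => /andP[ca _]; rewrite brw (killingNr lie) (killingZr lie).
      have [Kc|nKc] := boolP (c \in K).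
        by rewrite cascade_orthogonal // mul0r oppr0.
      by rewrite (lowering_kf0 nKc (ww c)) mulr0 oppr0.
    rewrite brw (killingNr lie) (killingZr lie) (lowering_kf Ka (ww a)) => /eqP.
    rewrite oppr_eq0 mulf_eq0 gt_eqF /=; last exact/(rs_pos RS)/cascade_root.
    have [v vna] := weight_dual_killing lie simple_g cartan_t (ww a) wa0.
    have ra := root_opp lie simple_g cartan_t (cascade_root Ka).
    have vl : v \in <[ev a]>%VS.
      rewrite -(wsp_line lie simple_g cartan_t _ _ (ev_in a) (ev0 Ka)) //.
        exact: (root_weight lie simple_g cartan_t).
      exact: root_neq0 ra.
    case/vlineP: vl => k ->; rewrite killingC (killingZl lie) mulf_eq0 negb_or.
    by move=> /andP[_ /negPf ->].
  have [Phi [beta ha]] := hook_exists RS PS IRR pa.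
  have Kb := hook_cascade ha; have rb := cascade_root Kb.
  have nab : a <> beta by move=> E; rewrite E Kb in nKa.
  have hd := hook_complement RS PS IRR ha nab; set d := beta - a in hd.
  have [_ _ _ pd _] := hd.
  have ab := hook_gt0 RS PS IRR ha.
  have eb0 := root_bracket_neq0 lie simple_g cartan_t rb (ev_in beta) (ev0 Kb) (ww a) wa0 ab.
  have [v] := weight_dual_killing lie simple_g cartan_t
    (wsp_br lie (ev_in beta) (ww a)) eb0.
  rewrite opprD opprK -/d => vd.
  rewrite (killing_br lie); apply/negP; rewrite negbK; apply/eqP.
  have dE : a + d = beta by rewrite /d addrC subrK.
  have wv c : br (w c) v \in wsp (c + d) by apply: wsp_br.
  rewrite -lowering_kf //; last by rewrite -dE.
  have := B v (subvP (wsp_sub_algebra pd) _ vd); rewrite Bexp.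
  rewrite (lowering_kf0 _ (hbr _ _ vd)); last first.
    apply/negP => /cascade_hook[Psi hdd].
    have := cascade_hook_sum hdd ha Kb; rewrite addrC dE => /(_ erefl) db.
    have : a = 0 by apply: (addIr d); rewrite add0r dE.
    by apply/eqP; apply: root_neq0 (pos_root pa).
  rewrite add0r (big_rem a) /=; last exact/mem_bw.
  rewrite big_seq big1 ?addr0 // => c; rewrite mem_rem_uniq // inE => /andP[ca /mem_bw pc].
  have [Kcd|nK] := boolP (c + d \in K); last exact: lowering_kf0 nK (wv c).
  have [Psi [b2 hc]] := hook_exists RS PS IRR pc.
  have := cascade_hook_sum hd hc Kcd; rewrite addrC => /(_ erefl) E.
  by case/eqP: ca; apply: (addIr d); rewrite -E dE.
have u0 : u = 0.
  by rewrite uE big_seq big1 // => c /mem_bw; apply: w0.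
rewrite u0 addr0 in B *.
have h0 beta : beta \in K -> (beta h' : F) = 0.
  move=> Kb; have [v vb kv] := weight_dual_killing lie simple_g cartan_t (ev_in beta) (ev0 Kb).
  rewrite opprK in vb; have := B v (subvP (wsp_sub_algebra (cascade_pos Kb)) _ vb).
  rewrite -hE (weight_eigen lie simple_g cartan_t _ vb) (killingZr lie).
  by rewrite (lowering_kf Kb vb) => /eqP; rewrite mulf_eq0 (negPf kv) orbF => /eqP.
rewrite -hE in hK *; rewrite (torus_expand hK) big_seq big1 ?linear0 // => c /h0 ->.
by rewrite mul0r scale0r.
Qed.

Lemma sub_brE (x y : subvs_of bK) : vsval (sub_br br x y) = br (vsval x) (vsval y).
Proof. by rewrite /sub_br vsprojK // algebra_br ?subvsP. Qed.

Lemma cascade_ooms : exists2 x : subvs_of bK, vsval x = vsval xK &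
  ooms_element (@sub_br _ g br bK) x.
Proof.
have xKb : vsval xK \in bK by apply: (subvP (addvSl _ _)); apply: cascade_element_torus.
exists (vsproj bK (vsval xK)); first by rewrite vsprojK.
pose phi (y : subvs_of bK) : F^o := kf lowering (vsval y).
have phil : linear phi.
  by move=> k u v; rewrite /phi linearP (killingDr lie) (killingZr lie).
exists (linfun phi); split=> [x Bx|y].
  apply: val_inj; apply: lowering_nondegenerate; first exact: subvsP.
  move=> y yb; have := Bx (vsproj bK y).
  by rewrite /kirillov linfunE // /phi sub_brE vsprojK.
rewrite /kirillov !linfunE // /phi sub_brE vsprojK // -(killing_br lie).
by rewrite (brC lie) br_element_lowering opprK.
Qed.

Lemma cascade_algebra_theorem :
  [/\ (tK :&: brv br b b = 0)%VS, subalgebra br bK, frobenius_lie (@sub_br _ g br bK)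
    & exists2 x : subvs_of bK, vsval x = vsval xK & ooms_element (@sub_br _ g br bK) x].
Proof.
split; first exact: torus_cap_derived.
- by apply/(subalgebraP lie); apply: algebra_br.
- by have [x _ [xi [nd _]]] := cascade_ooms; exists xi.
- exact: cascade_ooms.
Qed.
End CascadeAlgebra.

Theorem mainTheorem6 (R : realType) (g : vectType R[i]) (br : g -> g -> g)
    (lie_g : lie_bracket br) (simple_g : simple_lie br)
    (b t : {vspace g}) (borel_b : borel br b) (cartan_t : cartan br t)
    (t_in_b : (t <= b)%VS)
    (K : seq (dual (subvs_of t))) (uniq_K : uniq K)
    (K_cascade : forall beta : dual (subvs_of t),
       beta \in K <-> kostant_cascade br b beta) :
  let tK := cascade_torus br K in
  let bK := cascade_algebra br b K in
  [/\ (tK :&: brv br b b = 0)%VS,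
      subalgebra br bK,
      frobenius_lie (@sub_br _ g br bK)
    & exists2 x : subvs_of bK,
        vsval x = vsval (cascade_element br K)
      & ooms_element (@sub_br _ g br bK) x].
Proof.
exact: (@cascade_algebra_theorem R[i] g br lie_g simple_g b t borel_b cartan_t t_in_b K uniq_K K_cascade).
Qed.
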